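(* Let $N\ge2$ and $p=1+\frac4N$. Let $g\in C([0,\infty),\mathbb{R})$ be of the form $g(s)=|s|^{p-1}s+h(s)$, where $h\in C([0,\infty),\mathbb{R})$ satisfies $\lim_{s\to0}\frac{h(s)}{|s|^{p-1}s}=0$ and $\lim_{s\to\infty}\frac{h(s)}{s}=0$. Set $G(s)=\int_0^s g(t)\,dt$. Consider the property (L) if $u_0\in F$ satisfies $-\Delta u_0=g(u_0)$ in $\mathbb{R}^N$ and $u_0\ge0$ in $\mathbb{R}^N$, then $u_0\equiv0$. Then: (i) when $N=2,3,4$, property (L) holds; (ii) when $N\ge5$, if in addition $NG(s)-\frac{N-2}{2}g(s)s\ge0$ for all $s\ge0$, then property (L) holds.
   Context: $F=\{u\in L^{p+1}(\mathbb{R}^N): \nabla u\in L^2(\mathbb{R}^N),\ u(x)=u(|x|)\}$ with norm $\|u\|_F=\|\nabla u\|_2+\|u\|_{p+1}$. The equation is understood in the weak sense. *)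

(* Defs.v *)
From HB Require Import structures.
From mathcomp Require Import all_boot all_order all_algebra.
From mathcomp Require Import all_classical all_reals all_analysis.
Set Implicit Arguments.
Unset Strict Implicit.
Unset Printing Implicit Defensive.
Import Order.TTheory GRing.Theory Num.Theory.
Import numFieldNormedType.Exports.
Local Open Scope classical_set_scope.
Local Open Scope ring_scope.

(* The Borel sigma-algebra of R^n, generated by the coordinate projections. *)
Fact rV_display : measure_display. Proof. exact: default_measure_display. Qed.

Section measurable_rV.
Context {R : realType} (n : nat).

Definition rV_coord (i : 'I_n) (x : 'rV[R]_n) : R := x ord0 i.

Let rV_set0 : g_sigma_preimage rV_coord set0.
Proof. exact: sigma_algebra0. Qed.

Let rV_setC A : g_sigma_preimage rV_coord A -> g_sigma_preimage rV_coord (~` A).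
Proof. exact: sigma_algebraC. Qed.

Let rV_bigcup (F : (set 'rV[R]_n)^nat) :
  (forall i, g_sigma_preimage rV_coord (F i)) ->
  g_sigma_preimage rV_coord (\bigcup_i (F i)).
Proof. exact: sigma_algebra_bigcup. Qed.

HB.instance Definition _ := @isMeasurable.Build rV_display
  'rV[R]_n (g_sigma_preimage rV_coord) rV_set0 rV_setC rV_bigcup.

End measurable_rV.

Lemma measurable_coord_rV (R : realType) n (i : 'I_n) :
  measurable_fun [set: 'rV[R]_n] (fun x : 'rV[R]_n => x ord0 i).
Proof.
move=> _ Y mY; rewrite setTI; apply: sub_sigma_algebra => /=.
rewrite -bigcup_seq/=; exists i => /=; first by rewrite mem_index_enum.
by exists Y => //; rewrite setTI.
Qed.

Lemma measurable_fun_rVP d (T : measurableType d) (R : realType) n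
    (f : T -> 'rV[R]_n) :
  measurable_fun [set: T] f <->
  forall i, measurable_fun [set: T] (fun x => f x ord0 i).
Proof.
split=> [mf i|mf].
  apply: (@measurableT_comp _ _ _ _ _ _ (fun x : 'rV[R]_n => x ord0 i)) => //.
  exact: measurable_coord_rV.
pose G := \big[setU/set0]_(i < n)
  preimage_set_system setT (@rV_coord R n i) measurable.
refine (measurability G erefl _).
move=> _ [B + <-]; rewrite /G -bigcup_seq => -[i _] [A mA <-].
by have := mf i measurableT A mA; rewrite !setTI.
Qed.

Section lebesgue_rV.
Context {R : realType}.

Definition cons_rV n (p : measurableTypeR R * 'rV[R]_n) : 'rV[R]_n.+1 :=
  row_mx (const_mx p.1 : 'rV[R]_1) p.2.

Definition uncons_rV n (x : 'rV[R]_n.+1) : measurableTypeR R * 'rV[R]_n :=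
  (x ord0 ord0, \row_i x ord0 (lift ord0 i)).

Lemma cons_rV0 n p : @cons_rV n p ord0 ord0 = p.1.
Proof.
rewrite /cons_rV (_ : ord0 = lshift n (ord0 : 'I_1)); last exact: val_inj.
by rewrite (row_mxEl (const_mx p.1 : 'rV_1)) mxE.
Qed.

Lemma cons_rV_lift n p i : @cons_rV n p ord0 (lift ord0 i) = p.2 ord0 i.
Proof.
rewrite /cons_rV (_ : lift ord0 i = rshift 1 i); last exact: val_inj.
by rewrite (row_mxEr (const_mx p.1 : 'rV_1)).
Qed.

Lemma cons_rVK n : cancel (@cons_rV n) (@uncons_rV n).
Proof.
move=> p; rewrite /uncons_rV cons_rV0 [RHS]surjective_pairing; congr pair.
by apply/rowP => i; rewrite mxE cons_rV_lift.
Qed.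

Lemma uncons_rVK n : cancel (@uncons_rV n) (@cons_rV n).
Proof.
move=> x; apply/rowP => i; case: (unliftP ord0 i) => [j|] ->.
  by rewrite cons_rV_lift mxE.
by rewrite cons_rV0.
Qed.

Lemma measurable_cons_rV n : measurable_fun setT (@cons_rV n).
Proof.
apply/measurable_fun_rVP => i; case: (unliftP ord0 i) => [j|] ->.
  under eq_fun do rewrite cons_rV_lift.
  apply: (@measurableT_comp _ _ _ _ _ _ (fun x : 'rV[R]_n => x ord0 j)) => //.
  exact: measurable_coord_rV.
under eq_fun do rewrite cons_rV0.
exact: measurable_fst.
Qed.

Lemma measurable_uncons_rV n : measurable_fun setT (@uncons_rV n).
Proof.
apply/measurable_fun_pairP; split; first exact: measurable_coord_rV.
apply/measurable_fun_rVP => i.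
rewrite [X in measurable_fun _ X](_ : _ =
  fun x : 'rV[R]_n.+1 => x ord0 (lift ord0 i)).
  exact: measurable_coord_rV.
by apply/funext => x /=; rewrite mxE.
Qed.

Section cons_measure.
Variables (n : nat) (mu : {sigma_finite_measure set 'rV[R]_n -> \bar R}).

Definition cons_measure : set 'rV[R]_n.+1 -> \bar R :=
  pushforward (lebesgue_measure \x mu)%E (@cons_rV n).

Let cons_measure0 : cons_measure set0 = 0%E.
Proof. by rewrite /cons_measure /pushforward preimage_set0 measure0. Qed.

Let cons_measure_ge0 A : (0 <= cons_measure A)%E.
Proof. by rewrite /cons_measure /pushforward; exact: measure_ge0. Qed.

Let cons_measure_sigma_additive : semi_sigma_additive cons_measure.
Proof.
have mcons (A : set 'rV[R]_n.+1) : measurable A -> measurable (@cons_rV n @^-1` A).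
  by move=> mA; rewrite -[X in measurable X]setTI; exact: measurable_cons_rV.
move=> F mF tF mUF; rewrite /cons_measure /pushforward preimage_bigcup.
apply: measure_semi_sigma_additive.
- by move=> k; exact: mcons.
- apply/trivIsetP => /= i j _ _ ij; rewrite -preimage_setI.
  by move/trivIsetP : tF => /(_ _ _ _ _ ij) ->//; rewrite preimage_set0.
- by rewrite -preimage_bigcup; exact: mcons.
Qed.

HB.instance Definition _ := isMeasure.Build _ _ _ cons_measure
  cons_measure0 cons_measure_ge0 cons_measure_sigma_additive.

Let cons_measure_sigma_finite : sigma_finite setT cons_measure.
Proof.
have /sigma_finiteP[F [TF ndF Foo]] := sigma_finiteT (@lebesgue_measure R).
have /sigma_finiteP[G [TG ndG Goo]] := sigma_finiteT mu.
exists (fun k => @uncons_rV n @^-1` (F k `*` G k)).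
  apply/seteqP; split=> // x _.
  have [i _ Fi] : (\bigcup_i F i) (uncons_rV x).1 by rewrite -TF.
  have [j _ Gj] : (\bigcup_i G i) (uncons_rV x).2 by rewrite -TG.
  exists (maxn i j) => //; split.
    by move: Fi; exact/subsetPset/ndF/leq_maxl.
  by move: Gj; exact/subsetPset/ndG/leq_maxr.
move=> k; have [mF Fk] := Foo k; have [mG Gk] := Goo k; split.
  rewrite -[X in measurable X]setTI; apply: measurable_uncons_rV => //.
  exact: measurableX.
rewrite /cons_measure /pushforward -comp_preimage.
rewrite (_ : _ \o _ = id); last by apply/funext => p /=; rewrite cons_rVK.
by rewrite preimage_id product_measure1E// lte_mul_pinfty// ge0_fin_numE.
Qed.

HB.instance Definition _ := Measure_isSigmaFinite.Build _ _ _ cons_measure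
  cons_measure_sigma_finite.

End cons_measure.

(* Iterated product of the one-dimensional Lebesgue measure; see lebesgue_rV_box
   for its values on products of measurable sets. *)
Fixpoint lebesgue_rV n : {sigma_finite_measure set 'rV[R]_n -> \bar R} :=
  match n with
  | 0 => \d_(0 : 'rV[R]_0)
  | n'.+1 => cons_measure (lebesgue_rV n')
  end.

Lemma measurable_box_rV n (A : 'I_n -> set (measurableTypeR R)) :
  (forall i, measurable (A i)) ->
  measurable [set x : 'rV[R]_n | forall i, A i (x ord0 i)].
Proof.
move=> mA; rewrite [X in measurable X](_ : _ =
  \bigcap_(i in [set: 'I_n]) ((fun x : 'rV[R]_n => x ord0 i) @^-1` A i)).
  apply: fin_bigcap_measurable => [|i _]; first exact: finite_finset.
  have := @measurable_coord_rV R n i measurableT (A i) (mA i).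
  by rewrite setTI.
by apply/seteqP; split=> x Ax i; [move=> _|]; exact: Ax.
Qed.

Lemma lebesgue_rV_box n (A : 'I_n -> set (measurableTypeR R)) :
  (forall i, measurable (A i)) ->
  lebesgue_rV n [set x | forall i, A i (x ord0 i)] =
  (\prod_(i < n) lebesgue_measure (A i))%E.
Proof.
elim: n A => [|n IH] A mA.
  by rewrite big_ord0 /= diracE mem_set// => -[].
rewrite big_ord_recl -(IH (fun i => A (lift ord0 i))) => [|i]; last exact: mA.
rewrite -product_measure1E//; last first.
  by apply: (@measurable_box_rV n (fun i => A (lift ord0 i))) => i; exact: mA.
congr product_measure1; apply/seteqP; split=> -[x y] /=.
  move=> Axy; split=> [|i]; first by have := Axy ord0; rewrite cons_rV0.
  by have := Axy (lift ord0 i); rewrite cons_rV_lift.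
move=> [Ax Ay] i; case: (unliftP ord0 i) => [j|] ->.
  by rewrite cons_rV_lift; exact: Ay.
by rewrite cons_rV0.
Qed.

End lebesgue_rV.

Section radial_weak_solutions.
Context {R : realType} (N : nat).
Local Notation mu := (@lebesgue_rV R N).
Local Notation e_ i := (delta_mx ord0 i : 'rV[R]_N).

(* `|x| is the sup norm on 'rV[R]_N. *)
Definition enorm (x : 'rV[R]_N) : R := Num.sqrt (\sum_i x ord0 i ^+ 2).

(* C^k: all iterated partial derivatives of order <= k exist and are
   continuous. *)
Fixpoint Ck (k : nat) (f : 'rV[R]_N -> R) : Prop :=
  continuous f /\
  match k with
  | 0 => True
  | k'.+1 => forall i, (forall x, derivable f x (e_ i)) /\ Ck k' ('D_(e_ i) f)
  end.

Definition test_function (phi : 'rV[R]_N -> R) : Prop :=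
  (forall k, Ck k phi) /\ compact (closure [set x | phi x != 0]).

Definition weak_partial (i : 'I_N) (u v : 'rV[R]_N -> R) : Prop :=
  forall phi, test_function phi ->
    (\int[mu]_x (u x * 'D_(e_ i) phi x)%:E =
     - \int[mu]_x (v x * phi x)%:E)%E.

Definition L2_weak_gradient (u : 'rV[R]_N -> R) (v : 'I_N -> 'rV[R]_N -> R) :
    Prop :=
  forall i, v i \in Lfun mu 2%:E /\ weak_partial i u (v i).

(* u is a representative of a class modulo a.e. equality, whence the a.e.
   form of u(x) = u(|x|). *)
Definition radial (u : 'rV[R]_N -> R) : Prop :=
  exists2 f : R -> R, measurable_fun setT f &
    {ae mu, forall x, u x = f (enorm x)}.

Definition F_space (p : R) (u : 'rV[R]_N -> R) : Prop :=
  [/\ u \in Lfun mu (p + 1)%:E, exists v, L2_weak_gradient u v & radial u].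

(* - Delta u = g(u) in R^N.  The integrals are extended-real valued, so the
   equation forces the right-hand side to be a finite integral. *)
Definition weak_solution (g : R -> R) (u : 'rV[R]_N -> R) : Prop :=
  exists2 v, L2_weak_gradient u v &
    forall phi, test_function phi ->
      (\int[mu]_x (\sum_i v i x * 'D_(e_ i) phi x)%:E =
       \int[mu]_x (g (u x) * phi x)%:E)%E.

Definition property_L (p : R) (g : R -> R) : Prop :=
  forall u : 'rV[R]_N -> R,
    F_space p u -> weak_solution g u -> {ae mu, forall x, 0 <= u x} ->
    {ae mu, forall x, u x = 0}.

End radial_weak_solutions.

Definition primitive0 {R : realType} (g : R -> R) (s : R) : R :=
  \int[lebesgue_measure]_(t in `[0, s]) g t.

(* Main.v *)
(* A weak radial solution tested against smooth approximations of
   (b - |x|^2)_+^2 / 2 satisfies, for each b > 0, an identity that involves only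
   u and g(u). In the coordinate t = volume of the ball of radius |x|, u becomes
   a function f on (0, +oo), and differentiating the identity in b gives the
   Emden-Fowler system
     f' = - c t^(e-2) M,  M' = g(f),  M(0+) = 0,  with e = 2/N,
   where f^(2+2e) is integrable since p + 1 = 2 + 2e. If f vanishes at some
   point, so does f' and f is zero by Gronwall's lemma. Otherwise f is small
   somewhere with M >= 0; from there on f decreases, g(f) >= f^p/2, and f is
   O(t^(-1/2)), M is O(t^(1/2-e)). For e >= 1/2 (N <= 4) M would then be bounded,
   yet f >= const * M t^(e-1) forces the integral of f^p to diverge. For e < 1
   and N >= 5, the Pohozaev function
     t G(f) + (c/2) t^(e-1) M^2 - (1-e)/2 f M
   has derivative G(f) - (1-e)/2 f g(f) >= 0; it is nonnegative by its behaviour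
   at 0 and tends to 0 at infinity, whereas its derivative is positive once f is
   small. *)

From mathcomp Require Import all_boot all_order all_algebra.
From mathcomp Require Import all_classical all_reals all_analysis.
From mathcomp Require Import measurable_realfun ring lra.
Require Import Defs.
Import Order.TTheory GRing.Theory Num.Theory.
Import numFieldNormedType.Exports.
Local Open Scope classical_set_scope.
Local Open Scope ring_scope.
Set Implicit Arguments.
Unset Strict Implicit.
Unset Printing Implicit Defensive.

(** * Monotonicity from derivatives *)

(** The solution is only a class in L^(p+1), and its weak gradient is not known to be radial, so no
    differential equation is available at the outset. Testing with a function of |x|^2 and
    integrating by parts once more removes the gradient. The square in (b - |x|^2)_+^2 keeps second
    derivatives bounded, and inside the ball the kernel is a polynomial in |x|^2, so only finitely
    many moments of f and g(f) occur. Differentiating at almost every point expresses f through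
    continuous primitives; this replaces elliptic regularity. The volume coordinate turns integrals
    of radial functions into plain Lebesgue integrals, without polar coordinates.

    Since p = 1 + 2e, the rate t^(-1/2) comes from f^(-2e) growing at least like t^e. The bound f >=
    const t^(e-1) gives g(f) >= const t^((e-1)(1+2e)), and (e-1)(1+2e) >= -1 exactly when e >= 1/2.
    The factor (1-e)/2 in the Pohozaev function is (N-2)/(2N). Near 0 only the integrability of
    f^(2+2e) is at hand; it yields M = O(t^(1/(2+2e))) and points arbitrarily close to 0 where t
    f^(2+2e) is small. *)

Section monotonicity.
Context {R : realType}.
Implicit Types (F dF : R -> R) (a b : R).

Lemma ge0_is_derive_le F dF a b : a <= b ->
  (forall x, a <= x <= b -> is_derive x 1 F (dF x)) ->
  (forall x, a <= x <= b -> 0 <= dF x) -> F a <= F b.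
Proof.
move=> ab dFE dF0.
have dFoo x : x \in `]a, b[ -> is_derive x 1 F (dF x).
  by rewrite in_itv/= => /andP[ax xb]; apply: dFE; rewrite !ltW.
have cF : {within `[a, b], continuous F}.
  apply: derivable_within_continuous => x; rewrite in_itv/= => xab.
  by have [] := dFE _ xab.
have [c cab /eqP] := MVT_segment ab dFoo cF.
rewrite subr_eq => /eqP ->.
by rewrite lerDr mulr_ge0 ?subr_ge0 ?dF0.
Qed.

Lemma le0_is_derive_ge F dF a b : a <= b ->
  (forall x, a <= x <= b -> is_derive x 1 F (dF x)) ->
  (forall x, a <= x <= b -> dF x <= 0) -> F b <= F a.
Proof.
move=> ab dFE dF0; rewrite -lerN2.
apply: (@ge0_is_derive_le (fun x => - F x) (fun x => - dF x)) => // x xab.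
  by have ? := dFE _ xab; exact: is_deriveN.
by rewrite oppr_ge0 dF0.
Qed.

Lemma gt0_is_derive_lt F dF a b : a < b ->
  (forall x, a <= x <= b -> is_derive x 1 F (dF x)) ->
  (forall x, a <= x <= b -> 0 < dF x) -> F a < F b.
Proof.
move=> ab dFE dF0.
have dFoo x : x \in `]a, b[ -> is_derive x 1 F (dF x).
  by rewrite in_itv/= => /andP[ax xb]; apply: dFE; rewrite !ltW.
have cF : {within `[a, b], continuous F}.
  apply: derivable_within_continuous => x; rewrite in_itv/= => xab.
  by have [] := dFE _ xab.
have [c + /eqP] := MVT ab dFoo cF.
rewrite in_itv/= subr_eq => /andP[ac cb] /eqP ->.
by rewrite ltrDr mulr_gt0 ?subr_gt0 ?dF0// !ltW.
Qed.

(** F(x) exp(-Lx) is nonincreasing and F(x) exp(Lx) is nondecreasing. The first bounds F by 0 to the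
    right of [t0], the second to the left. *)
Lemma gronwall_eq0 F dF (L a b t0 : R) : a <= t0 <= b ->
  (forall x, a <= x <= b -> is_derive x 1 F (dF x)) ->
  (forall x, a <= x <= b -> 0 <= F x) ->
  (forall x, a <= x <= b -> `|dF x| <= L * F x) ->
  F t0 = 0 -> forall x, a <= x <= b -> F x = 0.
Proof.
move=> /andP[at0 t0b] dFE F0 dFL Ft0 x /andP[ax xb].
have dexp (k y : R) : a <= y <= b ->
    is_derive y 1 (fun z => F z * expR (k * z)) (expR (k * y) * (dF y + k * F y)).
  move=> yab; have ? := dFE _ yab.
  have ? : is_derive y 1 (fun z => k * z) k.
    by apply: is_derive_eq; rewrite /GRing.scale/= mulr1.
  have ? : is_derive y 1 (fun z => expR (k * z)) (k * expR (k * y)).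
    by rewrite mulrC; exact: (is_derive1_comp (f:=expR) (g:=fun z => k * z)).
  apply: is_derive_eq; rewrite /GRing.scale/=; ring.
apply/eqP; rewrite eq_le F0 ?ax// andbT.
have E k : 0 < expR (k * x) :> R by exact: expR_gt0.
have [t0x|/ltW xt0] := leP t0 x.
- rewrite -(pmulr_lle0 _ (E (- L))) -[leRHS](mul0r (expR (- L * t0))) -Ft0.
  apply: (@le0_is_derive_ge (fun z => F z * expR (- L * z))
    (fun y => expR (- L * y) * (dF y + - L * F y))) => // y /andP[t0y yx].
    by apply: dexp; rewrite (le_trans at0)// (le_trans yx).
  have yab : a <= y <= b by rewrite (le_trans at0)// (le_trans yx).
  rewrite pmulr_rle0 ?expR_gt0// mulNr subr_le0 (le_trans (ler_norm _))//.
  exact: dFL.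
- rewrite -(pmulr_lle0 _ (E L)) -[leRHS](mul0r (expR (L * t0))) -Ft0.
  apply: (@ge0_is_derive_le (fun z => F z * expR (L * z))
    (fun y => expR (L * y) * (dF y + L * F y))) => // y /andP[xy yt0].
    by apply: dexp; rewrite (le_trans ax)// (le_trans yt0).
  have yab : a <= y <= b by rewrite (le_trans ax)// (le_trans yt0).
  rewrite pmulr_rge0 ?expR_gt0// -lerBlDr sub0r lerNl.
  by apply: le_trans (dFL _ yab); rewrite -normrN ler_norm.
Qed.

(** The point is the infimum of the set where F is at least v. It serves to close a bootstrap: a
    bound on f is needed to prove the very monotonicity that preserves it. *)
Lemma first_crossing F a b v : a <= b -> {in `[a, b], continuous F} ->
  F a < v -> v <= F b ->
  exists2 s, a < s <= b & v <= F s /\ forall x, a <= x < s -> F x < v.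
Proof.
move=> ab cF Fav vFb.
pose S := [set t | a <= t <= b /\ v <= F t].
have S0 : S !=set0 by exists b; split => //; rewrite ab lexx.
have lbS : lbound S a by move=> y [/andP[]].
have hlbS : has_lbound S by exists a.
have as_ : a <= inf S by exact: lb_le_inf.
have sb : inf S <= b by apply: ge_inf => //; split => //; rewrite ab lexx.
have vFs : v <= F (inf S).
  (* Were F below v at the infimum, it would stay below v on a ball around it, which contains points
     of S. *)
  rewrite leNgt; apply/negP => Fsv.
  have /cF/cvgrPdist_lt : inf S \in `[a, b] by rewrite in_itv/= as_.
  move=> /(_ (v - F (inf S))); rewrite subr_gt0 => /(_ Fsv)[d/= d0 Hd].
  have [t [/andP[ta tb] vt] tS] := inf_adherent d0 (conj S0 hlbS).
  have st : inf S <= t by apply: ge_inf => //; split => //; rewrite ta.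
  have : ball (inf S) d t by rewrite /ball/= distrC ger0_norm ?subr_ge0// ltrBlDl.
  move=> /Hd; rewrite distrC => /(le_lt_trans (ler_norm _)).
  by rewrite ltrD2r ltNge vt.
exists (inf S).
  rewrite sb andbT lt_neqAle as_ andbT; apply/eqP => aE.
  by move: vFs; rewrite -aE leNgt Fav.
split => // x /andP[ax xs]; rewrite ltNge; apply/negP => vFx.
have /(ge_inf hlbS) : S x by split => //; rewrite ax (le_trans (ltW xs)).
by rewrite leNgt xs.
Qed.

End monotonicity.

(** * Emden-Fowler systems *)

Lemma is_derive1_powR_comp (R : realType) (r : R) (F : R -> R) (x dF : R) :
  0 < F x -> is_derive x 1 F dF ->
  is_derive x 1 (fun y => F y `^ r) (r * F x `^ (r - 1) * dF).
Proof.
move=> Fx0 dFx; have dp := is_derive1_powR r Fx0.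
exact: (is_derive1_comp dp dFx).
Qed.

Lemma le0_ler_powR (R : realType) (r x y : R) :
  r <= 0 -> 0 < x <= y -> y `^ r <= x `^ r.
Proof.
move=> r0 /andP[x0 xy]; have y0 := lt_le_trans x0 xy.
rewrite -(opprK r) powRN [leRHS]powRN lef_pV2 ?posrE ?powR_gt0//.
by rewrite ge0_ler_powR ?nnegrE ?oppr_ge0// ltW.
Qed.

Section emden_fowler.
Context {R : realType}.
Variables (e c C d : R) (g f M : R -> R).
Hypothesis e01 : 0 < e <= 1.
Hypothesis c_gt0 : 0 < c.
Hypothesis C_gt0 : 0 < C.
Hypothesis d_gt0 : 0 < d.
Hypothesis g_le : forall s : R, 0 <= s -> `|g s| <= C * s `^ (1 + 2 * e).
Hypothesis g_ge : forall s : R, 0 < s <= d -> s `^ (1 + 2 * e) / 2 <= g s.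
Hypothesis f_ge0 : forall t : R, 0 < t -> 0 <= f t.
Hypothesis df : forall t : R, 0 < t -> is_derive t 1 f (- (c * t `^ (e - 2) * M t)).
Hypothesis dM : forall t : R, 0 < t -> is_derive t 1 M (g (f t)).

Let derivable_f t : 0 < t -> derivable f t 1.
Proof. by move=> t0; have [] := df t0. Qed.

Let continuous_f t : 0 < t -> {for t, continuous f}.
Proof.
by move=> t0; apply/differentiable_continuous/derivable1_diffP/derivable_f.
Qed.

Let continuous_M t : 0 < t -> {for t, continuous M}.
Proof.
move=> t0; apply/differentiable_continuous/derivable1_diffP.
by have [] := dM t0.
Qed.

Let within_continuous_f a b : 0 < a -> {within `[a, b], continuous f}.
Proof.
move=> a0; apply: derivable_within_continuous => x.
by rewrite in_itv/= => /andP[ax _]; apply/derivable_f/(lt_le_trans a0).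
Qed.

(** A zero of f is an interior minimum, so f' vanishes there, and f' is a nonzero multiple of M. *)
Let M_eq0 t : 0 < t -> f t = 0 -> M t = 0.
Proof.
move=> t0 ft0.
have t2 : t \in `]t / 2, 2 * t[ by rewrite in_itv/=; apply/andP; split; lra.
have min0 : is_derive t 1 f 0.
  apply: derive1_at_min t2 _; first by lra.
  - by move=> x; rewrite in_itv/= => /andP[tx _]; apply: derivable_f; lra.
  - by move=> x; rewrite in_itv/= ft0 => /andP[tx _]; apply: f_ge0; lra.
have := @derive_val _ _ _ _ _ _ _ (df t0).
rewrite derive_val => /esym/eqP; rewrite oppr_eq0 !mulf_eq0 (gt_eqF c_gt0)/=.
by rewrite gt_eqF ?powR_gt0//= => /eqP.
Qed.

(** Gronwall's lemma for the energy f^2 + M^2 on the segment between [t0] and t. No Lipschitz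
    condition on g is required: at the zero solution the growth bound on g plays that part. *)
Lemma emden_fowler_unique t0 : 0 < t0 -> f t0 = 0 -> forall t : R, 0 < t -> f t = 0.
Proof.
move=> t00 ft0 t tgt0.
pose a := Num.min t0 t; pose b := Num.max t0 t.
have a0 : 0 < a by rewrite lt_min t00.
have abt0 : a <= t0 <= b by rewrite ge_min le_max lexx.
have abt : a <= t <= b by rewrite ge_min le_max lexx !orbT.
have ab : a <= b by case/andP: abt0 => /le_trans; apply.
have [x0 x0ab fmax] := EVT_max ab (@within_continuous_f a b a0).
have x00 : 0 < x0.
  by move: x0ab; rewrite in_itv/= => /andP[/(lt_le_trans a0)].
pose K := f x0; have K0 : 0 <= K by exact: f_ge0.
(* The first summand bounds c x^(e-2), which decreases in x; the second linearizes g through g(f) <=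
   C f^(2e) f <= C K^(2e) f. Both multiply 2 f |M| <= f^2 + M^2. *)
pose L := c * a `^ (e - 2) + C * K `^ (2 * e).
pose dE x := 2 * f x * (- (c * x `^ (e - 2) * M x)) + 2 * M x * g (f x).
have dEE x : a <= x <= b -> is_derive x 1 (fun y => f y ^+ 2 + M y ^+ 2) (dE x).
  move=> /andP[/(lt_le_trans a0) x_gt0 _].
  have ? := df x_gt0; have ? := dM x_gt0.
  by apply: is_derive_eq; rewrite /dE /GRing.scale/=; ring.
have E0 x : a <= x <= b -> 0 <= f x ^+ 2 + M x ^+ 2.
  by rewrite addr_ge0 ?sqr_ge0.
have dEL x : a <= x <= b -> `|dE x| <= L * (f x ^+ 2 + M x ^+ 2).
  move=> xab; have /andP[ax xb] := xab; have x_gt0 := lt_le_trans a0 ax.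
  have fx0 := f_ge0 x_gt0.
  have gfx : `|g (f x)| <= C * K `^ (2 * e) * f x.
    apply: le_trans (g_le fx0) _.
    rewrite -mulrA ler_pM2l// [1 + _]addrC powRD; last first.
      by apply/implyP; case/andP: e01 => ? _; lra.
    rewrite powRr1// ler_wpM2r// ge0_ler_powR//; first by case/andP: e01; lra.
    by apply: fmax; rewrite in_itv.
  have xp : x `^ (e - 2) <= a `^ (e - 2).
    by apply: le0_ler_powR; rewrite ?a0//; case/andP: e01; lra.
  have x0p : 0 <= x `^ (e - 2) by exact: powR_ge0.
  have fM : 2 * (f x * `|M x|) <= f x ^+ 2 + M x ^+ 2.
    rewrite -(real_normK (num_real (M x))) -subr_ge0.
    rewrite (_ : _ - _ = (f x - `|M x|) ^+ 2) ?sqr_ge0//; ring.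
  apply: (@le_trans _ _ (L * (2 * (f x * `|M x|)))); last first.
    by rewrite ler_wpM2l// addr_ge0// ?mulr_ge0 ?powR_ge0// ltW.
  rewrite (le_trans (ler_normD _ _))// !normrM normrN !normrM.
  rewrite (ger0_norm fx0) (gtr0_norm c_gt0) (ger0_norm x0p) (ger0_norm (_ : 0 <= 2))//.
  have M0 : 0 <= `|M x| by [].
  rewrite /L [leRHS]mulrDl lerD//.
    rewrite [leLHS](_ : _ = x `^ (e - 2) * (c * (2 * (f x * `|M x|)))); last ring.
    rewrite [leRHS](_ : _ = a `^ (e - 2) * (c * (2 * (f x * `|M x|)))); last ring.
    by rewrite ler_wpM2r// !mulr_ge0// ltW.
  rewrite [leRHS](_ : _ = 2 * `|M x| * (C * K `^ (2 * e) * f x)); last ring.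
  by rewrite ler_wpM2l// mulr_ge0.
have := gronwall_eq0 abt0 dEE E0 dEL _ abt.
rewrite ft0 (M_eq0 t00 ft0) expr0n/= addr0 => /(_ erefl)/eqP.
by rewrite paddr_eq0 ?sqr_ge0// !sqrf_eq0 => /andP[/eqP].
Qed.

(** * Asymptotics of positive solutions *)

Section positive.
Hypothesis f_gt0 : forall t : R, 0 < t -> 0 < f t.
Hypothesis f_small : forall eps T : R, 0 < eps -> exists2 t, T < t & f t < eps.

Let f_le_dM a b : 0 < a -> a <= b -> (forall x, a <= x <= b -> 0 <= M x) ->
  f b <= f a.
Proof.
move=> a0 ab M0.
apply: (@le0_is_derive_ge _ f (fun x => - (c * x `^ (e - 2) * M x))) => // x xab.
  by apply: df; case/andP: xab => /(lt_le_trans a0).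
by rewrite oppr_le0 !mulr_ge0 ?M0 ?powR_ge0// ltW.
Qed.

(** A minimum point of f on a segment supplies a place where M >= 0 and f < d. From there a
    bootstrap runs: f < d makes g(f) >= 0, so M stays nonnegative, so f does not increase. *)
Lemma emden_fowler_eventually_decreasing :
  exists2 t1 : R, 0 < t1 & forall t, t1 <= t -> f t <= d /\ 0 <= M t.
Proof.
(* Being below f(1) keeps the minimum point on [1, t'] away from the left endpoint; being below d
   starts the bootstrap. *)
have [t' t'1 ft'] : exists2 t, 1 < t & f t < Num.min (f 1) d.
  by apply: f_small; rewrite lt_min d_gt0 f_gt0.
have [t1 + fmin] := EVT_min (ltW t'1) (@within_continuous_f 1 t' ltr01).
rewrite in_itv/= => /andP[t1_ge1 t1t'].
have ft1 : f t1 < Num.min (f 1) d.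
  by apply: le_lt_trans (fmin t' _) ft'; rewrite in_itv/= (ltW t'1) lexx.
have t1_gt1 : 1 < t1.
  rewrite lt_neqAle t1_ge1 andbT; apply/eqP => t1E.
  by move: ft1; rewrite -t1E lt_min ltxx.
have t1_gt0 : 0 < t1 by lra.
have Mt1 : 0 <= M t1.
  (* If M were negative at [t1], then f would increase just to the left of [t1] and take a smaller
     value there. *)
  rewrite leNgt; apply/negP => Mt1.
  have /cvgrPdist_lt /(_ (- M t1)) := continuous_M t1_gt0.
  rewrite oppr_gt0 => /(_ Mt1)[r/= r0 rM].
  pose s := Num.max 1 (t1 - r / 2).
  have st1 : s < t1 by rewrite gt_max t1_gt1/=; lra.
  have s1 : 1 <= s by rewrite le_max lexx.
  have sr : t1 - r / 2 <= s by rewrite le_max lexx orbT.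
  have : f s < f t1.
    apply: (@gt0_is_derive_lt _ f (fun x => - (c * x `^ (e - 2) * M x))) => // x /andP[sx xt].
      by apply: df; lra.
    have /rM : ball t1 r x by rewrite /ball/= ger0_norm; lra.
    rewrite distrC => /(le_lt_trans (ler_norm _)); rewrite ltrBlDl subrr => Mx.
    by rewrite oppr_gt0 pmulr_rlt0// mulr_gt0// powR_gt0; lra.
  apply/negP; rewrite -leNgt; apply: fmin; rewrite in_itv/= s1 (le_trans (ltW st1))//.
exists t1 => // t t1t.
have key s : t1 <= s -> (forall x, t1 <= x < s -> f x < d) ->
    forall x, t1 <= x <= s -> 0 <= M x.
  move=> t1s fd x /andP[t1x xs]; apply: le_trans Mt1 _.
  have [->//|xs'] := eqVneq x t1.
  have [c0 + /eqP] : exists2 y, y \in `]t1, x[ & M x - M t1 = g (f y) * (x - t1).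
    apply: MVT; first by rewrite lt_neqAle eq_sym xs'.
    - by move=> y; rewrite in_itv/= => /andP[ty _]; apply: dM; lra.
    - apply: derivable_within_continuous => y; rewrite in_itv/= => /andP[ty _].
      by have [] : is_derive y 1 M (g (f y)) by apply: dM; lra.
  rewrite in_itv/= subr_eq => /andP[tc cx] /eqP ->.
  have c00 : 0 < c0 by lra.
  rewrite lerDr mulr_ge0 ?subr_ge0//.
  apply: le_trans (g_ge _); first by rewrite divr_ge0 ?powR_ge0.
  by rewrite f_gt0// ltW// fd//; apply/andP; split; lra.
have ft1d : f t1 < d by move: ft1; rewrite lt_min => /andP[].
(* At the first point r where f reaches d, [key] gives M >= 0 on [t1, r], hence f(r) <= f(t1) <
   d. *)
have main s : t1 <= s -> f s < d.
  move=> t1s; rewrite ltNge; apply/negP => dfs.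
  have cf : {in `[t1, s], continuous f}.
    by move=> x; rewrite in_itv/= => /andP[tx _]; apply: continuous_f; lra.
  have [r /andP[t1r rs] [dfr frd]] := first_crossing t1s cf ft1d dfs.
  have := f_le_dM t1_gt0 (ltW t1r) (key r (ltW t1r) frd).
  by apply/negP; rewrite -ltNge (lt_le_trans ft1d).
split; first by rewrite ltW ?main.
by apply: (key t) => //; [move=> x /andP[t1x _]; exact: main|rewrite t1t lexx].
Qed.

(** Integrating g(f) >= f^(1+2e)/2 with f decreasing bounds M below by t f^(1+2e)/4. Put into the
    equation for f, this makes f^(-2e) grow like t^e, whence the decay of f. Conversely, the loss of
    f over [t, 2t] bounds M(t) above by f(t), so the decay of f controls M. *)
Lemma emden_fowler_decay : exists K t2 : R,
  [/\ 0 < K, 0 < t2 & forall t, t2 <= t ->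
    [/\ f t <= d, 0 < M t, f t <= K * t `^ (- (1 / 2)),
       M t <= K * t `^ (1 / 2 - e) & c * M t * t `^ (e - 1) <= 4 * f t]].
Proof.
have [t1 t1_gt0 H] := emden_fowler_eventually_decreasing.
have fdec a b : t1 <= a -> a <= b -> f b <= f a.
  move=> t1a ab; apply: f_le_dM => //; first lra.
  by move=> x /andP[ax _]; apply: (proj2 (H x _)); lra.
have e0 : 0 < e by case/andP: e01.
have e1 : e <= 1 by case/andP: e01.
(* On [t1, t] the integrand is at least f(t)^(1+2e)/2, and t - t1 >= t/2. *)
have Mge t : 2 * t1 <= t -> t * f t `^ (1 + 2 * e) / 4 <= M t.
  move=> t1t.
  have : M t1 - t1 * (f t `^ (1 + 2 * e) / 2) <= M t - t * (f t `^ (1 + 2 * e) / 2).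
    apply: (@ge0_is_derive_le _ (fun x => M x - x * (f t `^ (1 + 2 * e) / 2))
      (fun x => g (f x) - f t `^ (1 + 2 * e) / 2)); first lra.
      move=> x /andP[tx xt]; have ? : is_derive x 1 M (g (f x)) by apply: dM; lra.
      by apply: is_derive_eq; rewrite /GRing.scale/=; ring.
    move=> x /andP[tx xt]; rewrite subr_ge0.
    apply: le_trans (g_ge _); last by rewrite f_gt0 ?(proj1 (H _ tx))//; lra.
    rewrite ler_pM2r// ge0_ler_powR ?nnegrE ?fdec//; [lra| |];
      by apply/ltW/f_gt0; lra.
  have := proj2 (H t1 (lexx _)).
  have : 0 <= f t `^ (1 + 2 * e) by exact: powR_ge0.
  move: (f t `^ (1 + 2 * e)) => y y0 Mt1 tM.
  have : t1 * y <= t / 2 * y by rewrite ler_wpM2r//; lra.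
  lra.
have Mgt0 t : 2 * t1 <= t -> 0 < M t.
  move=> t1t; apply: lt_le_trans (Mge t t1t).
  by rewrite divr_gt0// mulr_gt0 ?powR_gt0 ?f_gt0; lra.
have Mmon a b : t1 <= a -> a <= b -> M a <= M b.
  move=> t1a ab; apply: (@ge0_is_derive_le _ M (g \o f)) => // x /andP[ax xb].
    by apply: dM; lra.
  apply: le_trans (g_ge _); first by rewrite divr_ge0 ?powR_ge0.
  by rewrite f_gt0 ?(proj1 (H x _)); lra.
(* By [Mge] the derivative 2e c x^(e-2) M f^(-(1+2e)) of f^(-2e) is at least (c e/2) x^(e-1), the
   derivative of (c/2) x^e. *)
have fgrow t : 2 * t1 <= t ->
    c / 2 * (t `^ e - (2 * t1) `^ e) <= f t `^ (- (2 * e)).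
  move=> t1t.
  have : f (2 * t1) `^ (- (2 * e)) - c / 2 * (2 * t1) `^ e <=
         f t `^ (- (2 * e)) - c / 2 * t `^ e.
    apply: (@ge0_is_derive_le _ (fun x => f x `^ (- (2 * e)) - c / 2 * x `^ e)
      (fun x => (- (2 * e) * f x `^ (- (2 * e) - 1)) * (- (c * x `^ (e - 2) * M x))
         - c / 2 * (e * x `^ (e - 1)))) => // x /andP[tx xt].
      have x0 : 0 < x by lra.
      have ? := df x0.
      have ? := is_derive1_powR e x0.
      have ? := is_derive1_powR_comp (- (2 * e)) (f_gt0 x0) (df x0).
      by apply: is_derive_eq; rewrite /GRing.scale/=; ring.
    have x0 : 0 < x by lra.
    have fx0 := f_gt0 x0.
    rewrite (_ : - (2 * e) - 1 = - (1 + 2 * e)); last ring.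
    rewrite powRN (_ : e - 2 = (e - 1) - 1); last ring.
    rewrite powRB; last by rewrite (gt_eqF x0)//= implybT.
    rewrite powRr1 ?(ltW x0)//.
    have := Mge x tx.
    have := powR_gt0 (1 + 2 * e) fx0; have := powR_gt0 (e - 1) x0.
    move: (_ `^ (1 + 2 * e)) (_ `^ (e - 1)) => y z z0 y0 yM.
    rewrite (_ : _ - _ = 2 * e * c * z / (y * x) * (M x - x * y / 4)).
      by rewrite mulr_ge0 ?subr_ge0// ltW// divr_gt0 ?mulr_gt0//.
    by field; rewrite !gt_eqF.
  have := powR_ge0 (f (2 * t1)) (- (2 * e)).
  lra.
(* The factor 2^(1/e) makes (2 t1)^e at most half of t^e, so that it can be absorbed in [fgrow]. *)
pose T := Num.max (2 * t1) (2 * t1 * 2 `^ e^-1).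
have TE t : T <= t -> 2 * (2 * t1) `^ e <= t `^ e.
  rewrite ge_max => /andP[_ tt].
  have -> : 2 * (2 * t1) `^ e = (2 * t1 * 2 `^ e^-1) `^ e.
    rewrite [RHS]powRM ?powR_ge0//; last lra.
    by rewrite -powRrM mulVf ?gt_eqF// powRr1// mulrC.
  have ? : 0 <= 2 * t1 * 2 `^ e^-1 by rewrite mulr_ge0 ?powR_ge0//; lra.
  by rewrite ge0_ler_powR// ?nnegrE//; lra.
have Tt1 t : T <= t -> 2 * t1 <= t by rewrite ge_max => /andP[].
pose K1 := (c / 4) `^ (- (2 * e)^-1).
have K10 : 0 < K1 by rewrite powR_gt0 ?divr_gt0.
have fdecay t : T <= t -> f t <= K1 * t `^ (- (1 / 2)).
  move=> Tt; have t1t := Tt1 t Tt; have t0 : 0 < t by lra.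
  have H1 : c / 4 * t `^ e <= f t `^ (- (2 * e)).
    apply: le_trans (fgrow t t1t); have := TE t Tt.
    move: (t `^ e) (_ `^ e) => x y xy.
    rewrite -mulrA [leRHS](_ : _ = c * (2^-1 * (x - y))); last ring.
    by rewrite ler_pM2l//; lra.
  have -> : K1 * t `^ (- (1 / 2)) = (c / 4 * t `^ e) `^ (- (2 * e)^-1).
    rewrite powRM ?powR_ge0 ?divr_ge0 ?ltW// -powRrM; congr (_ * _ `^ _).
    by field; rewrite gt_eqF.
  have -> : f t = (f t `^ (- (2 * e))) `^ (- (2 * e)^-1).
    rewrite -powRrM mulrNN divff ?powRr1 ?mulf_neq0 ?gt_eqF//.
    by rewrite ltW ?f_gt0.
  apply: le0_ler_powR; first by rewrite oppr_le0 invr_ge0; lra.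
  by rewrite H1 andbT mulr_gt0 ?divr_gt0 ?powR_gt0.
(* On [t, 2t] the slope of f is at most -c (2t)^(e-2) M(t), because M increases and x^(e-2)
   decreases. The constant 4 comes from 2^(e-2) >= 1/4. *)
have Mdecay t : T <= t -> c * M t * t `^ (e - 1) <= 4 * f t.
  move=> Tt; have t1t := Tt1 t Tt; have t0 : 0 < t by lra.
  have : f (2 * t) + c * M t * (2 * t) `^ (e - 2) * (2 * t) <=
         f t + c * M t * (2 * t) `^ (e - 2) * t.
    apply: (@le0_is_derive_ge _ (fun x => f x + c * M t * (2 * t) `^ (e - 2) * x)
      (fun x => - (c * x `^ (e - 2) * M x) + c * M t * (2 * t) `^ (e - 2))).
    - by lra.
    - move=> x /andP[tx xt]; have x0 : 0 < x by lra.
      have ? := df x0.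
      by apply: is_derive_eq; rewrite /GRing.scale/=; ring.
    - move=> x /andP[tx xt]; have x0 : 0 < x by lra.
      rewrite addrC subr_le0 mulrAC; apply: ler_pM.
      + by rewrite mulr_ge0 ?powR_ge0// ltW.
      + by rewrite ltW ?Mgt0.
      + by rewrite ler_pM2l//; apply: le0_ler_powR; [lra|rewrite x0].
      + by apply: Mmon; lra.
  have := f_gt0 t0; have : 0 < f (2 * t) by apply: f_gt0; lra.
  have -> : (2 * t) `^ (e - 2) = 2 `^ (e - 2) * (t `^ (e - 1) / t).
    rewrite powRM ?(ltW t0)//; congr (_ * _).
    rewrite (_ : e - 2 = (e - 1) - 1); last ring.
    rewrite powRB; last by rewrite (gt_eqF t0)//= implybT.
    by rewrite powRr1 ?ltW.
  have : 4^-1 <= 2 `^ (e - 2) :> R.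
    have -> : 4^-1 = 2 `^ (- 2) :> R by rewrite powR_invn//; field.
    by rewrite ler_powR//; lra.
  have := powR_gt0 (e - 1) t0; have := Mgt0 t t1t.
  move: (2 `^ _) (t `^ _) => x y Mt y0 x4 f2t ft.
  rewrite (_ : _ * (2 * t) = 2 * (x * (c * M t * y))); last by field; rewrite gt_eqF.
  rewrite (_ : c * M t * _ * t = x * (c * M t * y)); last by field; rewrite gt_eqF.
  have : 4^-1 * (c * M t * y) <= x * (c * M t * y).
    by rewrite ler_wpM2r// !mulr_ge0// ltW.
  lra.
have T0 : 0 < T by rewrite lt_max; apply/orP; left; lra.
(* The first summand serves the bound on f, the second the bound on M. *)
exists (K1 + 4 * K1 / c), T; split => //.
  by rewrite addr_gt0 ?divr_gt0 ?mulr_gt0.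
move=> t Tt; have t1t := Tt1 t Tt; have t0 : 0 < t by lra.
have K2 : 0 < 4 * K1 / c by rewrite divr_gt0 ?mulr_gt0.
split.
- by apply: (proj1 (H t _)); lra.
- exact: Mgt0.
- by apply: le_trans (fdecay t Tt) _; rewrite ler_wpM2r ?powR_ge0//; lra.
- apply: (@le_trans _ _ (4 * K1 / c * t `^ (1 / 2 - e))).
    have : c * M t * t `^ (e - 1) <= 4 * (K1 * t `^ (- (1 / 2))).
      by apply: le_trans (Mdecay t Tt) _; rewrite ler_pM2l// fdecay.
    have -> : t `^ (- (1 / 2)) = t `^ (1 / 2 - e) * t `^ (e - 1).
      rewrite -powRD; last by rewrite (gt_eqF t0)/= implybT.
      by congr (_ `^ _); field.
    rewrite mulrA mulrA ler_pM2r ?powR_gt0// => cM.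
    by rewrite mulrAC ler_pdivlMr// mulrC.
  by rewrite ler_wpM2r ?powR_ge0//; lra.
- exact: Mdecay.
Qed.

(** M is bounded since its exponent 1/2 - e is at most 0. But M' = g(f) is at least c2/x, so M grows
    at least logarithmically. *)
Lemma emden_fowler_half_le : 1 / 2 <= e -> False.
Proof.
move=> e2.
have [K [t2 [K0 t20 H]]] := emden_fowler_decay.
have e0 : 0 < e by case/andP: e01.
have e1 : e <= 1 by case/andP: e01.
pose T := Num.max 1 t2.
have T1 : 1 <= T by rewrite le_max lexx.
have T2 : t2 <= T by rewrite le_max lexx orbT.
have MK t : T <= t -> M t <= K.
  move=> Tt; have [_ _ _ + _] := H t (le_trans T2 Tt).
  move=> /le_trans; apply; rewrite -[leRHS]mulr1 ler_pM2l//.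
  by rewrite -[leRHS](powRr0 t) ler_powR//; lra.
have [_ MT0 _ _ _] := H T T2.
have Mmon a b : T <= a -> a <= b -> M a <= M b.
  move=> t1a ab; apply: (@ge0_is_derive_le _ M (g \o f)) => // x /andP[ax xb].
    by apply: dM; lra.
  apply: le_trans (g_ge _); first by rewrite divr_ge0 ?powR_ge0.
  by rewrite f_gt0 ?(let: And5 fd _ _ _ _ := H x _ in fd)//; lra.
pose c1 := c * M T / 4.
have c10 : 0 < c1 by rewrite divr_gt0// mulr_gt0.
pose c2 := c1 `^ (1 + 2 * e) / 2.
have c20 : 0 < c2 by rewrite divr_gt0// powR_gt0.
have dMge x : T <= x -> c2 / x <= g (f x).
  move=> Tx; have x0 : 0 < x by lra.
  have [fxd Mx _ _ Mf] := H x (le_trans T2 Tx).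
  apply: le_trans (g_ge _); last by rewrite f_gt0.
  rewrite mulrAC ler_pM2r//.
  have c1f : c1 * x `^ (e - 1) <= f x.
    rewrite /c1 mulrAC ler_pdivrMr// [leRHS]mulrC; apply: le_trans Mf.
    by rewrite ler_wpM2r ?powR_ge0// ler_pM2l// Mmon.
  apply: (@le_trans _ _ ((c1 * x `^ (e - 1)) `^ (1 + 2 * e))); last first.
    rewrite ge0_ler_powR ?nnegrE ?(ltW (f_gt0 x0))//; first lra.
    by rewrite mulr_ge0 ?powR_ge0 ?(ltW c10).
  rewrite powRM ?powR_ge0 ?(ltW c10)// ler_wpM2l ?powR_ge0//.
  rewrite -powRrM -powR_inv1 ?(ltW x0)// ler_powR//; first lra.
  (* The exponent (e-1)(1+2e) equals -1 + e(2e-1); this is where e >= 1/2 enters. *)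
  have : 0 <= e * (2 * e - 1) by rewrite mulr_ge0; lra.
  lra.
(* Chosen so that c2 ln(X/T) = K + 1, more than the bound K on M allows. *)
pose X := T * expR ((K + 1) / c2).
have TX : T <= X.
  rewrite -[leLHS]mulr1 ler_pM2l; last lra.
  by rewrite -[leLHS]expR0 ler_expR divr_ge0//; lra.
have : M T - c2 * ln T <= M X - c2 * ln X.
  apply: (@ge0_is_derive_le _ (fun x => M x - c2 * ln x)
    (fun x => g (f x) - c2 / x)) => // x /andP[Tx xX]; last first.
    by rewrite subr_ge0 dMge.
  have x0 : 0 < x by lra.
  have ? := dM x0; have ? := is_derive1_ln x0.
  by apply: is_derive_eq; rewrite /GRing.scale/=; ring.
have := MK X TX.
rewrite /X lnM ?posrE ?expR_gt0//; last lra.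
rewrite expRK mulrDr (_ : c2 * (_ / c2) = K + 1); last by field; rewrite gt_eqF.
lra.
Qed.

(** * The Pohozaev function *)

Section pohozaev.
Variables (G J : R -> R) (J1 : R).
Hypothesis e_lt1 : e < 1.
Hypothesis dG : forall s : R, 0 < s -> is_derive s 1 G (g s).
Hypothesis G_le : forall s : R, 0 < s -> `|G s| <= C * s `^ (2 + 2 * e).
Hypothesis G_ge0 : forall s : R, 0 < s -> 0 <= G s - (1 - e) / 2 * (s * g s).
Hypothesis G_gt0 : exists2 r : R, 0 < r &
  forall s, 0 < s < r -> 0 < G s - (1 - e) / 2 * (s * g s).
Hypothesis dJ : forall t : R, 0 < t -> is_derive t 1 J (f t `^ (2 + 2 * e)).
Hypothesis J_le : forall t : R, 0 < t -> 0 <= J t <= J1.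
Hypothesis J_cvg0 : J t @[t --> 0^'+] --> 0.
Hypothesis M_cvg0 : M t @[t --> 0^'+] --> 0.

(** For the system of a radial solution this is the boundary term of the Pohozaev identity on the
    ball of volume t, divided by N; -M is then the flux of the gradient through the sphere. *)
Let P t := t * G (f t) + c / 2 * t `^ (e - 1) * M t ^+ 2
           - (1 - e) / 2 * (f t * M t).

(** The coefficients are such that the terms in M g(f) and those in M^2 cancel. *)
Let dP (t : R) : 0 < t ->
  is_derive t 1 P (G (f t) - (1 - e) / 2 * (f t * g (f t))).
Proof.
move=> t0; have ft0 := f_gt0 t0.
have df_t := df t0; have dM_t := dM t0; have dG_t := dG ft0.
have ? := is_derive1_powR (e - 1) t0.
have ? : is_derive t 1 (fun x => G (f x)) (g (f t) * - (c * t `^ (e - 2) * M t)).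
  exact: (is_derive1_comp dG_t df_t).
apply: is_derive_eq; rewrite /GRing.scale/=.
rewrite (_ : e - 1 - 1 = e - 2); last ring.
have -> : t `^ (e - 1) = t `^ (e - 2) * t.
  rewrite (_ : e - 1 = (e - 2) + 1); last ring.
  by rewrite [LHS]powRD ?(gt_eqF t0) ?implybT// powRr1 ?(ltW t0).
by field.
Qed.

Let P_mon a b : 0 < a -> a <= b -> P a <= P b.
Proof.
move=> a0 ab; apply: (@ge0_is_derive_le _ P
    (fun t => G (f t) - (1 - e) / 2 * (f t * g (f t)))) => // t /andP[/(lt_le_trans a0) t0 _].
  exact: dP.
by apply: G_ge0; exact: f_gt0.
Qed.

(* Young's inequality for [f ^ (1 + 2e)] against the weight
   [t ^ (- 1 / (2 + 2e))]. *)
Let M_le (t : R) : 0 < t -> `|M t| <= C * (1 + J1) * t `^ (2 + 2 * e)^-1.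
Proof.
move=> t0; have [e0 _] := andP e01.
(* At this threshold both contributions have the same size: l^(1+2e) t and 1/l are both equal to
   t^(1/(2+2e)). *)
pose l := t `^ (- (2 + 2 * e)^-1).
have l0 : 0 < l by exact: powR_gt0.
have young (x : R) : 0 < x -> f x `^ (1 + 2 * e) <=
    l `^ (1 + 2 * e) + f x `^ (2 + 2 * e) / l.
  move=> x0; have fx0 := f_gt0 x0; have [fl|lf] := leP (f x) l.
    apply: (@le_trans _ _ (l `^ (1 + 2 * e))).
      by rewrite ge0_ler_powR ?nnegrE ?(ltW fx0) ?(ltW l0)//; lra.
    by rewrite lerDl divr_ge0 ?powR_ge0// ltW.
  apply: (@le_trans _ _ (f x `^ (2 + 2 * e) / l)); last by rewrite lerDr powR_ge0.
  rewrite (_ : 2 + 2 * e = (1 + 2 * e) + 1); last ring.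
  rewrite (powRD (r := 1 + 2 * e)); last by rewrite (gt_eqF fx0)/= implybT.
  rewrite powRr1 ?(ltW fx0)// -mulrA ler_peMr ?powR_ge0//.
  by rewrite ler_pdivlMr// mul1r ltW.
have ltE : l `^ (1 + 2 * e) * t = t `^ (2 + 2 * e)^-1.
  rewrite -powRrM -[X in _ * X](powRr1 (ltW t0)) -powRD; last first.
    by rewrite (gt_eqF t0)/= implybT.
  by congr (_ `^ _); field; rewrite gt_eqF; lra.
have lVE : l^-1 = t `^ (2 + 2 * e)^-1 by rewrite /l powRN invrK.
(* The difference D of the two sides is nondecreasing by [young], and it tends to 0 at 0. The sign
   covers M and -M at once. *)
have bound (sgn : R) : `|sgn| = 1 -> sgn * M t <= C * (l `^ (1 + 2 * e) * t + J t / l).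
  move=> sgn1.
  pose D x := C * (l `^ (1 + 2 * e) * x + J x / l) - sgn * M x.
  have D0 : D x @[x --> 0^'+] --> 0.
    rewrite -[X in _ --> X](_ : C * (l `^ (1 + 2 * e) * 0 + 0 / l) - sgn * 0 = 0).
      apply: cvgB; last exact: cvgMl_tmp.
      apply: cvgMl_tmp; apply: cvgD; last exact: cvgMr_tmp.
      by apply: cvgMl_tmp; apply: cvg_at_right_filter; exact: cvg_id.
    by rewrite !(mulr0, mul0r, addr0, subr0).
  have Dmon : forall x, 0 < x <= t -> D x <= D t.
    move=> x /andP[x0 xt].
    apply: (@ge0_is_derive_le _ D (fun y => C * (l `^ (1 + 2 * e) + f y `^ (2 + 2 * e) / l)
       - sgn * g (f y))) => // y /andP[/(lt_le_trans x0) y0 _].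
      have ? := dJ y0; have ? := dM y0.
      by apply: is_derive_eq; rewrite /GRing.scale/=; ring.
    rewrite subr_ge0 (le_trans (ler_norm _))// normrM sgn1 mul1r.
    by rewrite (le_trans (g_le (f_ge0 y0)))// ler_pM2l// young.
  rewrite -subr_ge0 -/(D t).
  apply: (cvgr_to_le D0); near=> x.
  by apply: Dmon; apply/andP; split; near: x; [exact: nbhs_right_gt|exact: nbhs_right_le].
have Jt := J_le t0.
have le2 : C * (l `^ (1 + 2 * e) * t + J t / l) <= C * (1 + J1) * t `^ (2 + 2 * e)^-1.
  rewrite ltE lVE -mulrA ler_pM2l// [leRHS]mulrDl mul1r lerD2l ler_wpM2r ?powR_ge0//.
  by case/andP: Jt.
rewrite ler_norml; apply/andP; split.
  rewrite lerNl -mulN1r; apply: le_trans le2; apply: bound; by rewrite normrN1.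
by rewrite -[M t]mul1r; apply: le_trans le2; apply: bound; rewrite normr1.
Unshelve. all: by end_near.
Qed.

(** Otherwise f^(2+2e) >= eps/t on (0, T), and its integral, which is at most [J1], would diverge at
    0. *)
Let small_at0 (eps T : R) : 0 < eps -> 0 < T ->
  exists2 t, 0 < t < T & t * f t `^ (2 + 2 * e) < eps.
Proof.
move=> eps0 T0; apply: contrapT => /forall2NP H.
(* Chosen so that eps ln((T/2)/s) = J1 + 1. *)
pose s := T / 2 * expR (- ((J1 + 1) / eps)).
have J10 : 0 <= J1 by have /andP[] := J_le T0; exact: le_trans.
have s0 : 0 < s by rewrite mulr_gt0 ?expR_gt0// divr_gt0.
have sT : s <= T / 2.
  rewrite -[leRHS]mulr1 ler_pM2l ?divr_gt0// -[leRHS]expR0 ler_expR.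
  by rewrite oppr_le0 divr_ge0//; lra.
have : J s - eps * ln s <= J (T / 2) - eps * ln (T / 2).
  apply: (@ge0_is_derive_le _ (fun x => J x - eps * ln x)
    (fun x => f x `^ (2 + 2 * e) - eps / x)) => // x /andP[sx xT].
    have x0 : 0 < x by lra.
    have ? := dJ x0; have ? := is_derive1_ln x0.
    by apply: is_derive_eq; rewrite /GRing.scale/=; ring.
  have x0 : 0 < x by lra.
  have [/negP|/negP] := H x; first by rewrite x0/=; lra.
  by rewrite -leNgt subr_ge0 ler_pdivrMr// mulrC.
rewrite {2}/s lnM ?posrE ?expR_gt0 ?divr_gt0// expRK.
rewrite mulrDr mulrN (_ : eps * (_ / eps) = J1 + 1); last by field; rewrite gt_eqF.
have /andP[J0 _] := J_le s0.
have /andP[_ +] := J_le (divr_gt0 T0 (ltr0Sn R 1)).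
lra.
Qed.

(** P is nondecreasing, so it suffices to bound it below by -eps at some point before t. The term in
    M^2 is nonnegative, and the other two are small wherever t f^(2+2e) is: f M is at most K (t
    f^(2+2e))^(1/(2+2e)) by [M_le]. *)
Let P_ge0 (t : R) : 0 < t -> 0 <= P t.
Proof.
move=> t0; have [e0 _] := andP e01.
have J10 : 0 <= J1 by have /andP[] := J_le t0; exact: le_trans.
pose K := C * (1 + J1).
have K0 : 0 < K by rewrite mulr_gt0//; lra.
have a0 : 0 < 2 + 2 * e by lra.
rewrite -oppr_le0; apply/ler_addgt0Pr => eps eps0; rewrite add0r.
(* The first bound controls s G(f(s)), the second f(s) M(s). *)
have [s /andP[s0 st]] : exists2 s, 0 < s < t & s * f s `^ (2 + 2 * e) <
    Num.min (eps / (2 * C)) ((eps / K) `^ (2 + 2 * e)).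
  by apply: small_at0; rewrite // lt_min powR_gt0 ?divr_gt0// mulr_gt0.
rewrite lt_min => /andP[y1 y2].
have fs0 := f_gt0 s0.
apply: (@le_trans _ _ (- P s)); first by rewrite lerN2 P_mon// ltW.
have H1 : - (s * G (f s)) <= eps / 2.
  apply: (@le_trans _ _ (C * (s * f s `^ (2 + 2 * e)))).
    rewrite -mulrN [leRHS]mulrCA ler_pM2l//.
    by apply: le_trans (G_le fs0); rewrite -normrN ler_norm.
  move: y1; rewrite ltr_pdivlMr ?mulr_gt0// => y1.
  by rewrite ler_pdivlMr//; apply/ltW; rewrite mulrC mulrCA mulrC; lra.
have H2 : 0 <= c / 2 * s `^ (e - 1) * M s ^+ 2.
  by rewrite mulr_ge0 ?sqr_ge0// mulr_ge0 ?powR_ge0// divr_ge0// ltW.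
have H3 : f s * M s <= eps.
  apply: (@le_trans _ _ (f s * (K * s `^ (2 + 2 * e)^-1))).
    by rewrite ler_pM2l// (le_trans (ler_norm _))// M_le.
  rewrite mulrCA mulrC -ler_pdivlMr//.
  have -> : f s * s `^ (2 + 2 * e)^-1 = (s * f s `^ (2 + 2 * e)) `^ (2 + 2 * e)^-1.
    rewrite powRM ?powR_ge0 ?(ltW s0)// -powRrM divff ?gt_eqF//.
    by rewrite powRr1 ?(ltW fs0)// mulrC.
  have -> : eps / K = ((eps / K) `^ (2 + 2 * e)) `^ (2 + 2 * e)^-1.
    by rewrite -powRrM divff ?gt_eqF// powRr1// divr_ge0// ltW.
  rewrite ge0_ler_powR ?nnegrE ?powR_ge0 ?mulr_ge0 ?powR_ge0 ?invr_ge0 ?(ltW a0) ?(ltW s0)//.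
  exact: ltW.
have H4 : (1 - e) / 2 * (f s * M s) <= eps / 2.
  apply: (@le_trans _ _ ((1 - e) / 2 * eps)).
    by rewrite ler_wpM2l// divr_ge0// subr_ge0 ltW.
  have : 0 <= e * eps by rewrite mulr_ge0// ltW.
  lra.
rewrite /P; lra.
Qed.

Lemma emden_fowler_pohozaev : False.
Proof.
have [e0 _] := andP e01.
have [K [t2 [K0 t20 H]]] := emden_fowler_decay.
have [r r0 Gr] := G_gt0.
have vanish (a eps : R) : 0 < a -> 0 < eps ->
    exists2 T, 0 < T & forall t, T <= t -> t `^ (- a) <= eps.
  move=> a0 eps0; exists (eps `^ (- a^-1)); first exact: powR_gt0.
  move=> t Tt; have -> : eps = (eps `^ (- a^-1)) `^ (- a).
    by rewrite -powRrM mulrNN mulVf ?gt_eqF// powRr1 ?ltW.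
  by apply: le0_ler_powR; rewrite ?oppr_le0 ?powR_gt0//= ltW.
pose K3 := C * K `^ (2 + 2 * e) + c / 2 * K ^+ 2.
have K30 : 0 < K3 by rewrite addr_gt0// mulr_gt0 ?powR_gt0 ?divr_gt0 ?exprn_gt0.
(* With f = O(t^(-1/2)) and M = O(t^(1/2-e)), the first two terms of P are both O(t^(-e)); the third
   one has a favourable sign. *)
have P_le t : t2 <= t -> P t <= K3 * t `^ (- e).
  move=> t2t; have t0 : 0 < t by lra.
  have [_ Mt fK MK _] := H t t2t; have ft0 := f_gt0 t0.
  have H1 : t * G (f t) <= C * K `^ (2 + 2 * e) * t `^ (- e).
    apply: (@le_trans _ _ (t * (C * f t `^ (2 + 2 * e)))).
      by rewrite ler_pM2l// (le_trans (ler_norm _))// G_le.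
    rewrite mulrCA -mulrA ler_pM2l//.
    apply: (@le_trans _ _ (t * (K * t `^ (- (1 / 2))) `^ (2 + 2 * e))).
      rewrite ler_pM2l// ge0_ler_powR ?nnegrE ?(ltW ft0)//; first lra.
      by rewrite mulr_ge0 ?powR_ge0 ?(ltW K0).
    rewrite powRM ?powR_ge0 ?(ltW K0)// mulrCA ler_wpM2l ?powR_ge0//.
    rewrite -powRrM -[X in X * _](powRr1 (ltW t0)) -powRD; last first.
      by rewrite (gt_eqF t0)/= implybT.
    by rewrite le_eqVlt; apply/orP; left; apply/eqP; congr (_ `^ _); field.
  have H2 : c / 2 * t `^ (e - 1) * M t ^+ 2 <= c / 2 * K ^+ 2 * t `^ (- e).
    apply: (@le_trans _ _ (c / 2 * t `^ (e - 1) * (K * t `^ (1 / 2 - e)) ^+ 2)).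
      rewrite ler_wpM2l ?mulr_ge0 ?powR_ge0 ?divr_ge0 ?(ltW c_gt0)//.
      by rewrite lerXn2r ?nnegrE ?(ltW Mt) ?mulr_ge0 ?powR_ge0 ?(ltW K0).
    rewrite exprMn -(powR_mulrn _ (powR_ge0 _ _)) -powRrM.
    rewrite mulrACA -powRD; last first.
      by rewrite (gt_eqF t0)/= implybT.
    by rewrite le_eqVlt; apply/orP; left; apply/eqP; congr (_ * _ `^ _); field.
  have H3 : 0 <= (1 - e) / 2 * (f t * M t).
    by apply: mulr_ge0; [rewrite divr_ge0// subr_ge0 ltW|rewrite mulr_ge0// ltW].
  rewrite /P /K3 mulrDl; lra.
have P0 t : 0 < t -> P t = 0.
  move=> t0; apply/eqP; rewrite eq_le P_ge0// andbT.
  apply/ler_addgt0Pr => eps eps0; rewrite add0r.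
  have [T T0 HT] := vanish e (eps / K3) e0 (divr_gt0 eps0 K30).
  pose s := Num.max t (Num.max t2 T).
  have ts : t <= s by rewrite le_max lexx.
  have t2s : t2 <= s by rewrite !le_max lexx orbT.
  have Ts : T <= s by rewrite !le_max lexx !orbT.
  apply: le_trans (P_mon t0 ts) _; apply: le_trans (P_le s t2s) _.
  by rewrite mulrC -ler_pdivlMr// HT.
(* From this T on, f is at most r/2, hence in the range where P' > 0, although P vanishes
   identically. *)
have [T T0 HT] := vanish (1 / 2) (r / (2 * K)) (divr_gt0 ltr01 (ltr0Sn R 1))
  (divr_gt0 r0 (mulr_gt0 (ltr0Sn R 1) K0)).
pose s := Num.max t2 T.
have t2s : t2 <= s by rewrite !le_max lexx.
have Ts : T <= s by rewrite !le_max lexx !orbT.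
have : P s < P (s + 1).
  apply: (@gt0_is_derive_lt _ P
      (fun t => G (f t) - (1 - e) / 2 * (f t * g (f t)))); first lra.
    by move=> t /andP[st _]; apply: dP; lra.
  move=> t /andP[st _]; have t0 : 0 < t by lra.
  apply: Gr; rewrite f_gt0//=.
  have [_ _ fK _ _] := H t (le_trans t2s st).
  apply: (le_lt_trans fK); apply: (@le_lt_trans _ _ (K * (r / (2 * K)))).
    by rewrite ler_pM2l// HT// (le_trans Ts).
  by rewrite (_ : K * _ = r / 2); [lra|field; rewrite gt_eqF].
by rewrite !P0 ?ltxx//; lra.
Qed.

End pohozaev.

End positive.

(** * Vanishing of nonnegative solutions *)

Section vanishing.
Variables (J : R -> R) (J1 : R).
Hypothesis dJ : forall t : R, 0 < t -> is_derive t 1 J (f t `^ (2 + 2 * e)).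
Hypothesis J_le : forall t : R, 0 < t -> 0 <= J t <= J1.

(** Otherwise J would grow at least linearly beyond T; on [a, b] it would gain y (b - a) = J1 +
    1. *)
Let f_small (eps T : R) : 0 < eps -> exists2 t, T < t & f t < eps.
Proof.
move=> eps0; apply: contrapT => /forall2NP H; have [e0 _] := andP e01.
pose y := eps `^ (2 + 2 * e); have y0 : 0 < y by exact: powR_gt0.
pose a := `|T| + 1; pose b := a + (J1 + 1) / y.
have aT : T < a by rewrite ltr_pwDr// ler_norm.
have a0 : 0 < a by rewrite ltr_wpDl.
have J10 : 0 <= J1 by have /andP[] := J_le a0; exact: le_trans.
have ab : a <= b by rewrite lerDl divr_ge0 ?powR_ge0 ?addr_ge0.
have : J a - y * a <= J b - y * b.
  apply: (@ge0_is_derive_le _ (fun x => J x - y * x)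
    (fun x => f x `^ (2 + 2 * e) - y)) => // x /andP[ax _].
    have ? := dJ (lt_le_trans a0 ax).
    by apply: is_derive_eq; rewrite /GRing.scale/=; ring.
  have x0 := lt_le_trans a0 ax; have fx0 := f_ge0 x0.
  have [/negP|/negP] := H x; first by rewrite (lt_le_trans aT).
  by rewrite -leNgt subr_ge0 => epsf; rewrite ge0_ler_powR ?nnegrE// ?ltW//; lra.
have -> : y * b = y * a + (J1 + 1) by rewrite /b; field; rewrite gt_eqF.
have /andP[J0 _] := J_le a0; have /andP[_] := J_le (lt_le_trans a0 ab).
lra.
Qed.

Lemma emden_fowler_eq0_half_le : 1 / 2 <= e -> forall t : R, 0 < t -> f t = 0.
Proof.
move=> e2 t t0; have [[s s0 fs]|/forall2NP H] := pselect (exists2 s, 0 < s & f s = 0).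
  exact: emden_fowler_unique fs _ t0.
exfalso; apply: emden_fowler_half_le e2 => // s s0.
have [//|/eqP fs0] := H s.
by rewrite lt_neqAle eq_sym fs0 f_ge0.
Qed.

Lemma emden_fowler_eq0_pohozaev (G : R -> R) : e < 1 ->
  (forall s : R, 0 < s -> is_derive s 1 G (g s)) ->
  (forall s : R, 0 < s -> `|G s| <= C * s `^ (2 + 2 * e)) ->
  (forall s : R, 0 < s -> 0 <= G s - (1 - e) / 2 * (s * g s)) ->
  (exists2 r : R, 0 < r &
    forall s, 0 < s < r -> 0 < G s - (1 - e) / 2 * (s * g s)) ->
  J t @[t --> 0^'+] --> 0 -> M t @[t --> 0^'+] --> 0 ->
  forall t : R, 0 < t -> f t = 0.
Proof.
move=> e1 dG Gle G0 Ggt0 J0 M0 t t0.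
have [[s s0 fs]|/forall2NP H] := pselect (exists2 s, 0 < s & f s = 0).
  exact: emden_fowler_unique fs _ t0.
exfalso; apply: (emden_fowler_pohozaev _ f_small e1 dG Gle G0 Ggt0 dJ J_le J0 M0).
move=> s s0; have [//|/eqP fs0] := H s.
by rewrite lt_neqAle eq_sym fs0 f_ge0.
Qed.

End vanishing.

End emden_fowler.

(** * Lebesgue measure in the volume coordinate *)

Definition image_measure d d' (T1 : measurableType d) (T2 : measurableType d')
  (R : realFieldType) (m : {measure set T1 -> \bar R}) (f : T1 -> T2)
  (mf : measurable_fun setT f) : {measure set T2 -> \bar R}.
Proof. by refine (@Measure.clone _ _ _ (pushforward m f) _); exact mf. Defined.

Section lebesgue_scaling.
Context {R : realType}.
Local Notation leb := (@lebesgue_measure R).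
Implicit Types (r : R).

Let measurable_scale r :
  measurable_fun setT (fun x : measurableTypeR R => r * x : measurableTypeR R).
Proof. exact: measurable_realfun.mulrl_measurable. Qed.

Let scaled_lebesgue r (r0 : 0 < r) : {measure set (measurableTypeR R) -> \bar R} :=
  mscale (NngNum (ltW r0)) (image_measure leb (measurable_scale r)).

(** Comparing the two measures on half-open intervals suffices: dilation by r shrinks the preimage
    of an interval by the factor that [mscale] restores. *)
Let scaled_lebesgueE r (r0 : 0 < r) (A : set (measurableTypeR R)) :
  measurable A -> leb A = scaled_lebesgue r0 A.
Proof.
apply: lebesgue_measure_unique => _ [[a b] /= ab <-].
rewrite /scaled_lebesgue /mscale/= /image_measure/= /pushforward.
rewrite (_ : _ @^-1` _ = `]a / r, b / r]%classic); last first.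
  apply/seteqP; split => x /=; rewrite !in_itv/= ltr_pdivrMr// ler_pdivlMr//;
    by rewrite mulrC.
rewrite !lebesgue_measure_itv/= !lte_fin ltr_pM2r ?invr_gt0//.
case: ifPn => // _; last by rewrite mule0.
by rewrite -!EFinB -EFinM -mulrBl mulrCA divff ?gt_eqF// mulr1.
Qed.

Lemma ge0_integral_lebesgue_scale r (f : R -> \bar R) : 0 < r ->
  measurable_fun setT f -> (forall x, 0 <= f x)%E ->
  (\int[leb]_x f x = r%:E * \int[leb]_x f (r * x)%R)%E.
Proof.
move=> r0 mf f0.
transitivity (\int[scaled_lebesgue r0]_x f x)%E.
  by apply: eq_measure_integral => /= A mA _; exact: scaled_lebesgueE.
rewrite ge0_integral_mscale//; congr (_ * _)%E.
by rewrite (ge0_integral_pushforward (measurable_scale r)).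
Qed.

Lemma measurable_scale_rV n r :
  measurable_fun setT (fun x : 'rV[R]_n => r *: x).
Proof.
apply/measurable_fun_rVP => i; under eq_fun do rewrite mxE.
by apply: measurable_funM => //; exact: measurable_coord_rV.
Qed.

(** Induction on the dimension by slicing along the first coordinate: the substitution in that
    coordinate gives one factor r, and the slices give r^n by the induction hypothesis. *)
Lemma lebesgue_rV_scale n r (A : set 'rV[R]_n) : 0 < r -> measurable A ->
  lebesgue_rV n A = ((r ^+ n)%:E * lebesgue_rV n [set x | A (r *: x)])%E.
Proof.
move=> r0; elim: n A => [|n IH] A mA.
  rewrite expr0 mul1e /= !diracE; congr (_%:R%:E); congr nat_of_bool.
  by apply/idP/idP; rewrite !inE/= scaler0.
pose B := @cons_rV R n @^-1` A.
have mB : measurable B.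
  by rewrite -[B]setTI; exact: measurable_cons_rV.
have mAr : measurable [set x | A (r *: x)].
  by rewrite -[X in measurable X]setTI; exact: measurable_scale_rV.
pose C := @cons_rV R n @^-1` [set x | A (r *: x)].
have mC : measurable C.
  by rewrite -[C]setTI; exact: measurable_cons_rV.
rewrite /= /cons_measure /pushforward -/B -/C /product_measure1.
have consZ (x : R) (y : 'rV_n) : r *: cons_rV (x, y) = cons_rV (r * x, r *: y).
  apply/rowP => i; rewrite mxE; case: (unliftP ord0 i) => [j|] ->.
    by rewrite !cons_rV_lift/= mxE.
  by rewrite !cons_rV0.
have mphi : measurable_fun setT (fun x : measurableTypeR R => lebesgue_rV n (xsection B x)).
  exact: measurable_fun_xsection.
have mphiC : measurable_fun setT (fun x : measurableTypeR R => lebesgue_rV n (xsection C x)).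
  exact: measurable_fun_xsection.
have secE (x : R) : (lebesgue_rV n (xsection B (r * x)%R) =
    (r ^+ n)%:E * lebesgue_rV n (xsection C x))%E.
  rewrite IH; last exact: measurable_xsection.
  congr (_ * lebesgue_rV n _)%E.
  by apply/seteqP; split => y /=; rewrite !xsectionE/= /C /B/= consZ.
rewrite (@ge0_integral_lebesgue_scale r (fun x => lebesgue_rV n (xsection B x)) r0 mphi); last first.
  by move=> x; exact: measure_ge0.
under [X in (_ * X)%E = _]eq_integral => x _ do rewrite secE.
rewrite ge0_integralZl//; last by rewrite lee_fin exprn_ge0// ltW.
by rewrite muleA -EFinM -exprS.
Qed.

End lebesgue_scaling.

(** * Volumes of balls and integrals of radial functions *)

Section radial_measure.
Context {R : realType}.
Local Notation leb := (@lebesgue_measure R).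

(** Preferred to [enorm] because it is a polynomial in the coordinates, hence smooth at 0 too. *)
Definition sqnorm n (x : 'rV[R]_n) : R := \sum_i x ord0 i ^+ 2.

Lemma sqnorm_ge0 n (x : 'rV[R]_n) : 0 <= sqnorm x.
Proof. by apply: sumr_ge0 => i _; exact: sqr_ge0. Qed.

Lemma sqnormZ n (r : R) (x : 'rV[R]_n) : sqnorm (r *: x) = r ^+ 2 * sqnorm x.
Proof. by rewrite /sqnorm mulr_sumr; apply: eq_bigr => i _; rewrite mxE exprMn. Qed.

Lemma measurable_sqnorm n : measurable_fun setT (@sqnorm n).
Proof.
by apply: measurable_sum => i; apply: measurable_funX; exact: measurable_coord_rV.
Qed.

Lemma measurable_sqnorm_le n (s : R) : measurable [set x : 'rV[R]_n | sqnorm x <= s].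
Proof.
rewrite [X in measurable X](_ : _ = @sqnorm n @^-1` `]-oo, s]).
  by rewrite -[X in measurable X]setTI; exact: measurable_sqnorm.
by apply/seteqP; split => x /=; rewrite in_itv.
Qed.

Let vol n : \bar R := lebesgue_rV n [set x | sqnorm x <= 1].

Let prod_cst n (c : R) : (\prod_(i < n) c%:E = (c ^+ n)%:E)%E.
Proof.
by elim: n => [|n IH]; rewrite ?big_ord0// big_ord_recl IH -EFinM exprS.
Qed.

Let vol_lty n : (vol n < +oo)%E.
Proof.
pose A (_ : 'I_n) : set (measurableTypeR R) := `[-1, 1]%classic.
apply: (@le_lt_trans _ _ (lebesgue_rV n [set x | forall i, A i (x ord0 i)])).
  apply: le_measure; rewrite ?inE.
  - exact: measurable_sqnorm_le.
  - by apply: measurable_box_rV => i; exact: measurable_itv.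
  - move=> x /= x1 i; rewrite /A/= in_itv/= -ler_norml.
    rewrite -(@ler_pXn2r _ 2)// ?nnegrE// expr1n real_normK ?num_real//.
    apply: le_trans x1; rewrite /sqnorm (bigD1 i)//= lerDl.
    by apply: sumr_ge0 => j _; exact: sqr_ge0.
rewrite lebesgue_rV_box => [|i]; last exact: measurable_itv.
have AE i : leb (A i) = (1 - -1 : R)%:E.
  by rewrite lebesgue_measure_itv/= lte_fin (lt_trans (ltrN10 _) ltr01).
by under eq_bigr do rewrite AE; rewrite prod_cst ltry.
Qed.

Let vol_gt0 n : (0 < vol n)%E.
Proof.
(* The cube [0, a]^n lies in the unit ball since n a^2 <= 1; the successor keeps a meaningful when n
   = 0. *)
pose a : R := n.+1%:R^-1.
have a0 : 0 < a by rewrite invr_gt0.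
pose A (_ : 'I_n) : set (measurableTypeR R) := `[0, a]%classic.
apply: (@lt_le_trans _ _ (lebesgue_rV n [set x | forall i, A i (x ord0 i)])).
  rewrite lebesgue_rV_box => [|i]; last exact: measurable_itv.
  have AE i : leb (A i) = a%:E.
    by rewrite lebesgue_measure_itv/= lte_fin a0 oppr0 adde0.
  by under eq_bigr do rewrite AE; rewrite prod_cst lte_fin exprn_gt0.
apply: le_measure; rewrite ?inE.
- by apply: measurable_box_rV => i; exact: measurable_itv.
- exact: measurable_sqnorm_le.
- move=> x /= Ax; apply: (@le_trans _ _ (\sum_(i < n) a ^+ 2)).
    apply: ler_sum => i _; have := Ax i; rewrite /A/= in_itv/= => /andP[x0 xa].
    by rewrite lerXn2r ?nnegrE// ltW.
  rewrite sumr_const card_ord -mulr_natl expr2 mulrA.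
  have na : n%:R * a <= 1 by rewrite ler_pdivrMr// mul1r ler_nat.
  by apply: mulr_ile1 => //; rewrite ?mulr_ge0 ?(ltW a0)// invf_le1// ler1n.
Qed.

Definition ball_volume n : R := fine (lebesgue_rV n [set x : 'rV[R]_n | sqnorm x <= 1]).

Lemma ball_volume_gt0 n : 0 < ball_volume n.
Proof. by apply: fine_gt0; rewrite vol_gt0 vol_lty. Qed.

(** Dilation by the square root of s maps the unit ball onto this one. *)
Lemma lebesgue_rV_ball n (s : R) : 0 < s ->
  lebesgue_rV n [set x | sqnorm x <= s] = (s `^ (n%:R / 2) * ball_volume n)%:E.
Proof.
move=> s0; pose r := Num.sqrt s.
have r0 : 0 < r by rewrite sqrtr_gt0.
rewrite (lebesgue_rV_scale r0); last exact: measurable_sqnorm_le.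
rewrite (_ : [set x | [set y : 'rV_n | sqnorm y <= s] (r *: x)] =
    [set x : 'rV[R]_n | sqnorm x <= 1]); last first.
  apply/seteqP; split => x /=; rewrite sqnormZ sqr_sqrtr ?(ltW s0)//.
    by rewrite -[leRHS]mulr1 ler_pM2l.
  by move=> x1; rewrite -[leRHS]mulr1 ler_pM2l.
rewrite EFinM [in RHS]/ball_volume fineK; last first.
  by rewrite ge0_fin_numE ?vol_lty//; exact: measure_ge0.
congr (_%:E * _)%E.
by rewrite mulrC powRrM powR12_sqrt ?(ltW s0)// powR_mulrn ?(ltW r0).
Qed.

Section volume_coordinate.
Variable n : nat.
Hypothesis n_gt0 : (0 < n)%N.
Local Notation mu := (@lebesgue_rV R n).
Local Notation k := (ball_volume n).

(* the volume of the ball centered at 0 whose boundary contains [x], so that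
   the pushforward of [mu] is the Lebesgue measure of [0, +oo) *)
Definition ball_vol (x : 'rV[R]_n) : R := k * sqnorm x `^ (n%:R / 2).

Lemma ball_vol_ge0 x : 0 <= ball_vol x.
Proof. by rewrite mulr_ge0 ?powR_ge0// ltW// ball_volume_gt0. Qed.

Lemma measurable_ball_vol : measurable_fun setT ball_vol.
Proof.
apply: measurable_funM => //.
apply: (@measurableT_comp _ _ _ _ _ _ (@powR R ^~ (n%:R / 2))).
  exact: measurable_powR.
exact: measurable_sqnorm.
Qed.

Lemma sqnormE x : sqnorm x = (ball_vol x / k) `^ (2 / n%:R).
Proof.
rewrite /ball_vol mulrAC divff ?gt_eqF ?ball_volume_gt0// mul1r -powRrM.
rewrite (_ : _ * _ = 1) ?powRr1 ?sqnorm_ge0//; field.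
by rewrite pnatr_eq0 -lt0n.
Qed.

Let e_gt0 : 0 < 2 / n%:R :> R.
Proof. by rewrite divr_gt0// ltr0n. Qed.

Let e_inv : 2 / n%:R * (n%:R / 2) = 1 :> R.
Proof. by field; rewrite pnatr_eq0 -lt0n. Qed.

Let ball_vol_le (t : R) : 0 <= t ->
  [set x | ball_vol x <= t] = [set x | sqnorm x <= (t / k) `^ (2 / n%:R)].
Proof.
move=> t0; apply/seteqP; split => x /= H.
  rewrite sqnormE; apply: ge0_ler_powR; rewrite ?nnegrE ?(ltW e_gt0)//.
  - by rewrite divr_ge0 ?ball_vol_ge0// ltW// ball_volume_gt0.
  - by rewrite divr_ge0// ltW// ball_volume_gt0.
  - by rewrite ler_pM2r// invr_gt0 ball_volume_gt0.
rewrite /ball_vol mulrC -ler_pdivlMr ?ball_volume_gt0//.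
have -> : t / k = ((t / k) `^ (2 / n%:R)) `^ (n%:R / 2).
  by rewrite -powRrM e_inv powRr1// divr_ge0// ltW// ball_volume_gt0.
by apply: ge0_ler_powR; rewrite ?nnegrE ?sqnorm_ge0 ?powR_ge0// divr_ge0.
Qed.

Let measurable_ball_vol_le (t : R) : measurable [set x | ball_vol x <= t].
Proof.
rewrite [X in measurable X](_ : _ = ball_vol @^-1` `]-oo, t]).
  by rewrite -[X in measurable X]setTI; exact: measurable_ball_vol.
by apply/seteqP; split => x /=; rewrite in_itv.
Qed.

Let mu_ball_vol_le_gt0 (t : R) : 0 < t -> mu [set x | ball_vol x <= t] = t%:E.
Proof.
move=> t0; rewrite ball_vol_le ?(ltW t0)// lebesgue_rV_ball; last first.
  by rewrite powR_gt0 // divr_gt0 ?ball_volume_gt0.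
congr (_%:E).
rewrite -powRrM e_inv powRr1 ?divfK ?gt_eqF ?ball_volume_gt0//.
by rewrite divr_ge0 ?(ltW t0) ?(ltW (ball_volume_gt0 _)).
Qed.

Let mu_ball_vol_le (t : R) : mu [set x | ball_vol x <= t] = (Num.max t 0)%:E.
Proof.
have [t0|t0] := ltP 0 t; first exact: mu_ball_vol_le_gt0.
apply/eqP; rewrite eq_le measure_ge0 andbT.
apply/lee_addgt0Pr => eps eps0; rewrite add0e -(mu_ball_vol_le_gt0 eps0).
apply: le_measure; rewrite ?inE//.
by move=> x /= /le_trans; apply; exact: (le_trans t0 (ltW eps0)).
Qed.

Let mu_preimage_oc (a b : R) : a < b ->
  mu (ball_vol @^-1` `]a, b]) = (Num.max b 0 - Num.max a 0)%:E.
Proof.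
move=> ab.
rewrite (_ : _ @^-1` _ = [set x | ball_vol x <= b] `\` [set x | ball_vol x <= a]); last first.
  apply/seteqP; split => x /=; rewrite in_itv/=.
    by move=> /andP[ax xb]; split => //; apply/negP; rewrite -ltNge.
  by move=> [xb /negP]; rewrite -ltNge => ax; rewrite ax.
rewrite measureD//; last first.
  exact: (@eq_ind_r _ _ (fun y => y < +oo)%E (ltry _) _ (mu_ball_vol_le b)).
rewrite setIidr; last by move=> x /= /le_trans; apply; exact: ltW.
by rewrite EFinB; apply: (congr2 (fun x y => x - y)%E); exact: mu_ball_vol_le.
Qed.

Let bv : 'rV[R]_n -> measurableTypeR R := ball_vol.

Let measurable_bv : measurable_fun setT bv.
Proof. exact: measurable_ball_vol. Qed.

(** The image of [mu] lives on [0, +oo). Adding Lebesgue measure on the negative half-line gives a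
    measure that can be compared with [leb] on every interval []a, b]], as the uniqueness theorem
    asks. *)
Let nu := measure_add (image_measure mu measurable_bv)
  (mrestr leb (measurable_itv `]-oo, (0 : R)[)).

Let nuE (B : set R) :
  (nu B = mu (ball_vol @^-1` B) + leb (B `&` [set` `]-oo, 0%R[]))%E.
Proof. exact: measure_addE. Qed.

Lemma image_ball_vol (A : set R) : measurable A -> A `<=` `[0, +oo[ ->
  mu (ball_vol @^-1` A) = leb A.
Proof.
move=> mA A0.
have H : leb A = nu A.
  apply: lebesgue_measure_unique => // _ [[a b] /= _ <-].
  have [ba|ab] := leP b a.
    by rewrite set_itv_ge ?measure0// bnd_simp -leNgt.
  rewrite [RHS]nuE.
  rewrite mu_preimage_oc//.
  have [a0|a0] := leP 0 a.
    rewrite (_ : _ `&` _ = set0); last first.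
      by apply/seteqP; split => // x /=; rewrite !in_itv/= => -[]; lra.
    rewrite measure0 adde0 lebesgue_measure_itv/= lte_fin ab EFinB.
    rewrite max_l// (le_trans a0 (ltW ab))//.
  have [b0|b0] := leP 0 b.
    rewrite (_ : _ `&` _ = `]a, 0[%classic); last first.
      by apply/seteqP; split => x /=; rewrite !in_itv/=; [move=> []|]; lra.
    rewrite !lebesgue_measure_itv/= !lte_fin a0 (lt_le_trans a0 b0).
    by rewrite -!EFinB -EFinD; congr (_%:E); ring.
  rewrite subrr add0e (_ : _ `&` _ = `]a, b]%classic)//.
  by apply/seteqP; split => x /=; rewrite !in_itv/=; [move=> []|]; lra.
rewrite H nuE (_ : _ `&` _ = set0); last first.
  apply/seteqP; split => // x [/A0/=]; rewrite !in_itv/= andbT; lra.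
by rewrite measure0 adde0.
Qed.

Lemma ge0_integral_ball_vol (f : R -> \bar R) : measurable_fun setT f ->
  (forall t, 0 <= f t)%E ->
  (\int[mu]_x f (ball_vol x) = \int[leb]_(t in `[0%R, +oo[) f t)%E.
Proof.
move=> mf f0.
transitivity (\int[image_measure mu measurable_bv]_(t in `[0%R, +oo[) f t)%E.
  rewrite (ge0_integral_pushforward measurable_bv)//; last first.
    exact: measurable_funTS.
  congr (integral _ _ _); apply/seteqP; split => // x _ /=.
  by rewrite in_itv/= ball_vol_ge0.
by apply: eq_measure_integral => A mA A0; exact: image_ball_vol.
Qed.

Lemma integrable_ball_vol (f : R -> \bar R) : measurable_fun setT f ->
  mu.-integrable setT (f \o ball_vol) -> leb.-integrable `[0%R, +oo[ f.
Proof.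
move=> mf /integrableP[_ foo]; apply/integrableP; split; first exact: measurable_funTS.
rewrite -(ge0_integral_ball_vol (f := fun t => `|f t|%E))//.
exact: measurableT_comp.
Qed.

Lemma integral_ball_vol (f : R -> \bar R) : measurable_fun setT f ->
  mu.-integrable setT (f \o ball_vol) ->
  (\int[mu]_x f (ball_vol x) = \int[leb]_(t in `[0%R, +oo[) f t)%E.
Proof.
move=> mf intf.
transitivity (\int[image_measure mu measurable_bv]_(t in `[0%R, +oo[) f t)%E.
  have T : ball_vol @^-1` `[0, +oo[ = setT.
    by apply/seteqP; split => // x _ /=; rewrite in_itv/= ball_vol_ge0.
  by rewrite (integral_pushforward measurable_bv)//= T.
by apply: eq_measure_integral => A mA A0; exact: image_ball_vol.
Qed.

End volume_coordinate.
End radial_measure.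

(** * Smooth flat functions *)

Section exp_inv.
Context {R : realType}.
Implicit Types (p : {poly R}) (x : R).

(* [P(1/x) exp(-1/x)] extended by 0: a class of flat functions that is closed
   under derivation. *)
Definition expinv p x : R := if 0 < x then p.[x^-1] * expR (- x^-1) else 0.

Lemma expinv_le0 p x : x <= 0 -> expinv p x = 0.
Proof. by rewrite /expinv ltNge => ->. Qed.

Lemma expinv_gt0 p x : 0 < x -> expinv p x = p.[x^-1] * expR (- x^-1).
Proof. by rewrite /expinv => ->. Qed.

Lemma expXn_expRN_le n (z : R) : 0 <= z -> z ^+ n * expR (- z) <= n`!%:R.
Proof.
move=> z0; rewrite expRN ler_pdivrMr ?expR_gt0//.
case: n => [|n]; first by rewrite expr0 fact0 mul1r (le_trans _ (expR_ge1Dx z))// lerDl.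
have := expR_ge1Dxn n z0; have : 0 < (n.+1)`!%:R :> R by rewrite ltr0n fact_gt0.
by move: (n.+1`!%:R) => c c0 H; rewrite mulrC -ler_pdivrMr//; lra.
Qed.

Lemma horner_expRN_bounded p :
  exists K : R, forall z, 0 <= z -> `|p.[z]| * expR (- z) <= K.
Proof.
exists (\sum_(i < size p) `|p`_i| * i`!%:R) => z z0.
rewrite horner_coef (le_trans (ler_wpM2r (expR_ge0 _) (ler_norm_sum _ _ _)))//.
rewrite mulr_suml; apply: ler_sum => i _.
by rewrite normrM normrX (ger0_norm z0) -mulrA ler_wpM2l// expXn_expRN_le.
Qed.

(** Meant for the flat point 0 of [expinv], where the usual rules of derivation do not apply. *)
Lemma is_derive_quadratic (F : R -> R) x (K : R) :
  (forall h, `|F (x + h) - F x| <= K * h ^+ 2) -> is_derive x 1 F 0.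
Proof.
move=> FK.
suff H : (fun h : R => h^-1 *: ((F \o shift x) (h *: 1) - F x)) @ 0^' --> (0 : R).
  by apply: DeriveDef; [apply/cvg_ex; exists 0|exact: cvg_lim].
have K0 : 0 <= K by have := FK 1; rewrite expr1n mulr1; apply: le_trans.
apply/cvgr0Pnorm_le => eps eps0; near=> h.
have h0 : h != 0 by near: h; exact: nbhs_dnbhs_neq.
rewrite /GRing.scale/= mulr1 normrM [h + x]addrC normfV.
rewrite ler_pdivrMl ?normr_gt0//.
apply: (le_trans (FK h)); rewrite -(real_normK (num_real h)) expr2 mulrCA.
rewrite ler_wpM2l//.
apply: (@le_trans _ _ ((K + 1) * `|h|)); first by rewrite ler_wpM2r//; lra.
rewrite mulrC -ler_pdivlMr; last lra.
near: h; apply: dnbhs0_le.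
by rewrite divr_gt0//; lra.
Unshelve. all: by end_near. Qed.

(** Away from 0 this is the chain rule. At 0, boundedness of z^2 p(z) exp(-z) at z = 1/h gives a
    bound K h^2 on the function, whence a zero derivative. *)
Lemma is_derive_expinv p x :
  is_derive x 1 (expinv p) (expinv ('X^2 * (p - p^`())) x).
Proof.
have [x0|x0|->] := ltgtP x 0.
- rewrite expinv_le0 ?ltW//.
  apply: (@near_eq_is_derive _ _ _ (cst 0)).
  by near=> y; rewrite expinv_le0// ltW//; near: y; exact: lt_nbhsl.
- rewrite expinv_gt0//.
  have xn0 : x != 0 by rewrite gt_eqF.
  have dV : is_derive x 1 (fun y : R => y^-1) (- (x ^- 2)).
    have /= H := @is_deriveV _ id x 1 1 xn0 (is_derive_id _ _).
    by apply: is_derive_eq; rewrite /GRing.scale/= mulr1.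
  have dp : is_derive x 1 (fun y => p.[y^-1]) (p^`().[x^-1] * - (x ^- 2)).
    by have dpx := is_derive_poly p x^-1; exact: (is_derive1_comp dpx dV).
  have dN : is_derive x 1 (fun y : R => - y^-1) (x ^- 2).
    by rewrite -[x ^- 2]opprK; exact: is_deriveN.
  have de : is_derive x 1 (fun y => expR (- y^-1)) (expR (- x^-1) * x ^- 2).
    by have dex := is_derive_expR (- x^-1);
      exact: (@is_derive1_comp _ expR (fun y : R => - y^-1) x _ _ dex dN).
  have H : is_derive x 1 (fun y => p.[y^-1] * expR (- y^-1))
      (('X^2 * (p - p^`())).[x^-1] * expR (- x^-1)).
    apply: is_derive_eq; rewrite /GRing.scale/= hornerM hornerXn hornerD hornerN exprVn.
    ring.
  apply: near_eq_is_derive H.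
  by near=> y; rewrite expinv_gt0//; near: y; exact: lt_nbhsr.
- rewrite expinv_le0//.
  have [K HK] := horner_expRN_bounded ('X^2 * p).
  apply: (@is_derive_quadratic _ _ K) => h.
  rewrite add0r [expinv p 0]expinv_le0// subr0.
  have K0 : 0 <= K by have := HK 0 (lexx _); apply: le_trans; rewrite mulr_ge0 ?expR_ge0.
  have [h0|h0] := leP h 0; first by rewrite expinv_le0// normr0 mulr_ge0 ?sqr_ge0.
  rewrite expinv_gt0// normrM (ger0_norm (expR_ge0 _)).
  have := HK h^-1; rewrite invr_ge0 (ltW h0) => /(_ isT).
  rewrite hornerM hornerXn normrM -mulrA normrX ger0_norm ?invr_ge0 ?(ltW h0)//.
  by rewrite exprVn ler_pdivrMl ?exprn_gt0// [_ * K]mulrC.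
Unshelve. all: by end_near. Qed.

Lemma continuous_expinv p : continuous (expinv p).
Proof.
move=> x; apply/differentiable_continuous/derivable1_diffP.
by have [] := is_derive_expinv p x.
Qed.

(* [x^2/2 exp(-1/(nx))] on [x > 0] and its first two derivatives: a smooth
   approximation of [x_+^2/2] whose second derivative is bounded uniformly in
   [n]. *)
Definition flat_sqr (n : R) x : R := x ^+ 2 / 2 * expinv 1 (n * x).
Definition flat_sqr1 (n : R) x : R := (x + n^-1 / 2) * expinv 1 (n * x).
Definition flat_sqr2 (n : R) x : R := expinv (1 + 'X + 2^-1 *: 'X^2) (n * x).

Let is_derive_expinv_scale p (n x : R) :
  is_derive x 1 (fun y => expinv p (n * y)) (n * expinv ('X^2 * (p - p^`())) (n * x)).
Proof.
have dE := is_derive_expinv p (n * x).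
have dn : is_derive x 1 (fun y => n * y) n.
  by apply: is_derive_eq; rewrite /GRing.scale/= mulr1.
by rewrite mulrC; exact: (is_derive1_comp dE dn).
Qed.

Lemma is_derive_flat_sqr (n x : R) : 0 < n ->
  is_derive x 1 (flat_sqr n) (flat_sqr1 n x).
Proof.
move=> n0; have ? := is_derive_expinv_scale 1 n x.
have H : is_derive x 1 (flat_sqr n)
    (x * expinv 1 (n * x) + x ^+ 2 / 2 * (n * expinv ('X^2 * (1 - 1^`())) (n * x))).
  by apply: is_derive_eq; rewrite /GRing.scale/= ; field.
apply: is_derive_eq; rewrite /flat_sqr1.
have [x0|x0] := leP x 0.
  by rewrite !expinv_le0 ?pmulr_rle0// !mulr0 addr0.
rewrite !expinv_gt0 ?mulr_gt0// derivC.
rewrite !(hornerM, hornerXn, hornerD, hornerN, hornerC, hornerX, hornerZ).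
by field; rewrite !gt_eqF.
Qed.

Lemma is_derive_flat_sqr1 (n x : R) : 0 < n ->
  is_derive x 1 (flat_sqr1 n) (flat_sqr2 n x).
Proof.
move=> n0; have ? := is_derive_expinv_scale 1 n x.
have H : is_derive x 1 (flat_sqr1 n) (expinv 1 (n * x) +
    (x + n^-1 / 2) * (n * expinv ('X^2 * (1 - 1^`())) (n * x))).
  by apply: is_derive_eq; rewrite /GRing.scale/= ; field; rewrite gt_eqF.
apply: is_derive_eq; rewrite /flat_sqr2.
have [x0|x0] := leP x 0.
  by rewrite !expinv_le0 ?pmulr_rle0// !mulr0 addr0.
rewrite !expinv_gt0 ?mulr_gt0// derivC.
rewrite !(hornerM, hornerXn, hornerD, hornerN, hornerC, hornerX, hornerZ).
by field; rewrite !gt_eqF.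
Qed.

Lemma expinv1_itv x : 0 <= expinv 1 x <= 1.
Proof.
rewrite /expinv; case: ifPn => x0; last by rewrite lexx ler01.
rewrite hornerC mul1r expR_ge0/= -[leRHS]expR0 ler_expR oppr_le0 invr_ge0.
exact: ltW.
Qed.

(** With z = 1/(nx), the value is exp(-z) times the Taylor polynomial 1 + z + z^2/2 of exp(z), which
    does not exceed exp(z) for z >= 0. So the upper bound does not depend on n. *)
Lemma flat_sqr2_itv (n x : R) : 0 <= flat_sqr2 n x <= 1.
Proof.
rewrite /flat_sqr2 /expinv; case: ifPn => x0; last by rewrite lexx ler01.
have z0 : 0 <= (n * x)^-1 by rewrite invr_ge0 ltW.
move: (n * x)^-1 z0 => z z0.
have zE : (1 + 'X + 2^-1 *: 'X^2).[z] = 1 + z + 2^-1 * z ^+ 2.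
  by rewrite !hornerD hornerC hornerX hornerZ hornerXn.
have z1 : 0 <= 1 + z + 2^-1 * z ^+ 2.
  by rewrite !addr_ge0// mulr_ge0// sqr_ge0.
rewrite zE mulr_ge0 ?expR_ge0//= expRN ler_pdivrMr ?expR_gt0// mul1r.
have : 1 + 0 + 2^-1 * 0 ^+ 2 <= 1 :> R by rewrite expr0n/=; lra.
have : expR 0 - (1 + 0 + 2^-1 * 0 ^+ 2) <= expR z - (1 + z + 2^-1 * z ^+ 2).
  apply: (@ge0_is_derive_le _ (fun z => expR z - (1 + z + 2^-1 * z ^+ 2))
    (fun z => expR z - (1 + z))) => // y /andP[y0 _].
    by apply: is_derive_eq; rewrite /GRing.scale/=; field.
  by rewrite subr_ge0 expR_ge1Dx.
rewrite expr0n/= expR0; lra.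
Qed.

Lemma flat_sqr_le0 (n x : R) : 0 < n -> x <= 0 ->
  [/\ flat_sqr n x = 0, flat_sqr1 n x = 0 & flat_sqr2 n x = 0].
Proof.
move=> n0 x0.
by rewrite /flat_sqr /flat_sqr1 /flat_sqr2 !expinv_le0 ?pmulr_rle0// !mulr0.
Qed.

Lemma expinv_cvg p x : 0 < x ->
  expinv p (k.+1%:R * x) @[k --> \oo] --> p.[0].
Proof.
move=> x0.
have H : (fun k : nat => p.[(k.+1%:R)^-1 * x^-1] * expR (- ((k.+1%:R)^-1 * x^-1))) @ \oo --> p.[0].
  have c0 : (k.+1%:R : R)^-1 * x^-1 @[k --> \oo] --> (0 : R).
    by rewrite -[X in _ --> X](mul0r x^-1); apply: cvgMr_tmp; exact: cvg_harmonic.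
  rewrite (_ : p.[0] = p.[0] * expR (- 0)); last by rewrite oppr0 expR0 mulr1.
  apply: cvgM.
    by apply: (continuous_cvg _ _ c0); exact: continuous_horner.
  by apply: (continuous_cvg _ _ (cvgN c0)); exact: continuous_expR.
apply: cvg_trans H; apply: near_eq_cvg; near=> k.
by rewrite expinv_gt0 ?mulr_gt0// invfM.
Unshelve. all: by end_near. Qed.

Lemma flat_sqr_cvg x : flat_sqr k.+1%:R x @[k --> \oo] --> Num.max x 0 ^+ 2 / 2.
Proof.
have [x0|x0] := ltP 0 x.
  rewrite -[X in _ --> X]mulr1; apply: cvgMl_tmp.
  by have := @expinv_cvg 1 x x0; rewrite hornerC.
under eq_cvg do rewrite (let: And3 a _ _ := flat_sqr_le0 (ltr0Sn _ _) x0 in a).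
by rewrite expr0n/= mul0r; exact: cvg_cst.
Qed.

Lemma flat_sqr1_cvg x : flat_sqr1 k.+1%:R x @[k --> \oo] --> Num.max x 0.
Proof.
have [x0|x0] := ltP 0 x.
  rewrite -[X in _ --> X]mulr1; apply: cvgM; last first.
    by have := @expinv_cvg 1 x x0; rewrite hornerC.
  rewrite -[X in _ --> X]addr0; apply: cvgD; first exact: cvg_cst.
  by rewrite -[X in _ --> X](mul0r 2^-1); apply: cvgMr_tmp; exact: cvg_harmonic.
under eq_cvg do rewrite (let: And3 _ a _ := flat_sqr_le0 (ltr0Sn _ _) x0 in a).
exact: cvg_cst.
Qed.

Lemma flat_sqr2_cvg x : flat_sqr2 k.+1%:R x @[k --> \oo] --> ((0 < x)%R%:R : R).
Proof.
have [x0|x0] := ltP 0 x.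
  have := @expinv_cvg (1 + 'X + 2^-1 *: 'X^2) x x0.
  by rewrite !hornerD hornerC hornerX hornerZ hornerXn expr0n/= mulr0 !addr0.
under eq_cvg do rewrite (let: And3 _ _ a := flat_sqr_le0 (ltr0Sn _ _) x0 in a).
exact: cvg_cst.
Qed.

(** The bounds are uniform in n, in view of dominated convergence. *)
Lemma flat_sqr_bound (n x b : R) : 1 <= n -> x <= b -> 0 <= b ->
  `|flat_sqr n x| <= b ^+ 2 /\ `|flat_sqr1 n x| <= b + 1.
Proof.
move=> n1 xb b0; have n0 : 0 < n by lra.
have [x0|x0] := leP x 0.
  have [-> -> _] := flat_sqr_le0 n0 x0.
  by rewrite normr0; split; rewrite ?addr_ge0 ?sqr_ge0.
have /andP[E0 E1] := expinv1_itv (n * x).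
split; rewrite normrM [X in _ * X]ger0_norm//.
  rewrite -[leRHS]mulr1; apply: ler_pM => //.
  rewrite ger0_norm ?divr_ge0 ?sqr_ge0//.
  rewrite ler_pdivrMr//; apply: (@le_trans _ _ (b ^+ 2)).
    by rewrite lerXn2r ?nnegrE// ltW.
  by rewrite ler_peMr ?sqr_ge0//; lra.
rewrite -[leRHS]mulr1; apply: ler_pM => //.
have n01 : 0 <= n^-1 <= 1 by rewrite invr_ge0 (ltW n0)/= invf_le1.
by move: n^-1 n01 => m /andP[m0 m1]; rewrite ger0_norm; lra.
Qed.

Lemma measurable_flat_sqr n : 0 < n -> measurable_fun setT (flat_sqr n).
Proof.
move=> n0; apply: continuous_measurable_fun => x.
apply/differentiable_continuous/derivable1_diffP.
by have [] := is_derive_flat_sqr x n0.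
Qed.

Lemma measurable_flat_sqr1 n : 0 < n -> measurable_fun setT (flat_sqr1 n).
Proof.
move=> n0; apply: continuous_measurable_fun => x.
apply/differentiable_continuous/derivable1_diffP.
by have [] := is_derive_flat_sqr1 x n0.
Qed.

Lemma measurable_flat_sqr2 n : measurable_fun setT (flat_sqr2 n).
Proof.
apply: (@measurableT_comp _ _ _ _ _ _ (expinv (1 + 'X + 2^-1 *: 'X^2)) _
  (fun x : R => n * x)).
  by apply: continuous_measurable_fun; exact: continuous_expinv.
exact: mulrl_measurable.
Qed.

End exp_inv.

(** * Radial test functions *)

Section Ck_theory.
Context {R : realType} (N : nat).
Local Notation e_ i := (delta_mx ord0 i : 'rV[R]_N).
Implicit Types (f g : 'rV[R]_N -> R) (i : 'I_N).

(** Reduces partial derivatives to one-variable calculus along a line. *)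
Lemma is_derive_line (f : 'rV[R]_N -> R) (x v : 'rV[R]_N) (d : R) :
  is_derive (0 : R) 1 (fun h : R => f (h *: v + x)) d -> is_derive x v f d.
Proof.
move=> [dh dE].
have E : (fun h : R => h^-1 *: ((f \o shift x) (h *: v) - f x)) =
    (fun h : R => h^-1 *: (((fun h : R => f (h *: v + x)) \o shift 0) (h *: 1) -
       (fun h : R => f (h *: v + x)) 0)).
  by apply/funext => h; rewrite /= addr0 [h *: 1]mulr1 scale0r add0r.
apply: DeriveDef; first by rewrite /derivable E.
by rewrite /derive E.
Qed.

Lemma CkS k f : Ck k.+1 f -> Ck k f.
Proof.
elim: k f => [|k IH] f; first by case.
move=> [cf dCf]; split => // i; have [df Cdf] := dCf i.
by split => //; exact: IH.
Qed.

Lemma Ck_continuous k f : Ck k f -> continuous f.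
Proof. by case: k => [|k] []. Qed.

Lemma Ck_cst k (c : R) : Ck k (fun _ : 'rV[R]_N => c).
Proof.
elim: k c => [|k IH] c; split => //; try exact: cst_continuous.
move=> i; split; first by move=> x; exact: derivable_cst.
rewrite (_ : 'D_(e_ i) _ = cst 0); first exact: IH.
by apply/funext => x; rewrite derive_cst.
Qed.

Lemma Ck_add k f g : Ck k f -> Ck k g -> Ck k (fun x => f x + g x).
Proof.
elim: k f g => [|k IH] f g [cf df] [cg dg]; split => //.
- by move=> x; apply: continuousD; [exact: cf|exact: cg].
- by move=> x; apply: continuousD; [exact: cf|exact: cg].
move=> i; have [dfi Cdf] := df i; have [dgi Cdg] := dg i; split.
  by move=> x; exact: derivableD.
rewrite (_ : 'D_(e_ i) _ = fun x => 'D_(e_ i) f x + 'D_(e_ i) g x); first exact: IH.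
by apply/funext => x; exact: deriveD.
Qed.

Lemma Ck_mul k f g : Ck k f -> Ck k g -> Ck k (fun x => f x * g x).
Proof.
elim: k f g => [|k IH] f g Cf Cg.
  by split => // x; apply: continuousM; [exact: (proj1 Cf)|exact: (proj1 Cg)].
have [cf df] := Cf; have [cg dg] := Cg; split.
  by move=> x; apply: continuousM; [exact: cf|exact: cg].
move=> i; have [dfi Cdf] := df i; have [dgi Cdg] := dg i; split.
  by move=> x; exact: derivableM.
rewrite (_ : 'D_(e_ i) _ = fun x => f x * 'D_(e_ i) g x + g x * 'D_(e_ i) f x).
  by apply: Ck_add; apply: IH => //; exact: CkS.
by apply/funext => x; exact: deriveM.
Qed.

Lemma Ck_sum k (I : Type) (s : seq I) (f : I -> 'rV[R]_N -> R) :
  (forall j : I, Ck k (f j)) -> Ck k (fun x => \sum_(j <- s) f j x).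
Proof.
move=> Cf; elim: s => [|a s IH].
  by under eq_fun do rewrite big_nil; exact: Ck_cst.
by under eq_fun do rewrite big_cons; exact: Ck_add.
Qed.

Lemma is_derive_coord i j (x : 'rV[R]_N) :
  is_derive x (e_ i) (fun y => y ord0 j) ((i == j)%:R).
Proof.
apply: is_derive_line.
rewrite (_ : (fun h : R => _) = (fun h : R => h * (i == j)%:R + x ord0 j)).
  by apply: is_derive_eq; rewrite /GRing.scale/=; ring.
by apply/funext => h; rewrite !mxE eqxx/= eq_sym.
Qed.

Lemma Ck_coord k j : Ck k (fun y : 'rV[R]_N => y ord0 j).
Proof.
case: k => [|k]; (split; first by move=> x; exact: coord_continuous) => //.
move=> i; split; first by move=> x; have [] := is_derive_coord i j x.
have -> : 'D_(e_ i) (fun y : 'rV[R]_N => y ord0 j) = fun=> (i == j)%:R.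
  by apply/funext => x; apply: derive_val; exact: is_derive_coord.
exact: Ck_cst.
Qed.

Lemma Ck_sqnorm k : Ck k (@sqnorm R N).
Proof. by apply: Ck_sum => i; apply: Ck_mul; exact: Ck_coord. Qed.

Lemma sqnorm_line (x : 'rV[R]_N) i (h : R) :
  sqnorm (h *: e_ i + x) = sqnorm x + 2 * h * x ord0 i + h ^+ 2.
Proof.
rewrite /sqnorm (bigD1 i)//= [in RHS](bigD1 i)//= !mxE !eqxx/=.
rewrite (eq_bigr (fun j => x ord0 j ^+ 2)); first by ring.
by move=> j ji; rewrite !mxE eqxx/= (negbTE ji) mulr0 add0r.
Qed.

Lemma is_derive_radial (F : R -> R) (b dF : R) (x : 'rV[R]_N) i :
  is_derive (b - sqnorm x) 1 F dF ->
  is_derive x (e_ i) (fun y => F (b - sqnorm y)) (- (2 * x ord0 i) * dF).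
Proof.
move=> dFx; apply: is_derive_line.
have dq : is_derive (0 : R) 1 (fun h : R => b - sqnorm (h *: e_ i + x)) (- (2 * x ord0 i)).
  under eq_fun do rewrite sqnorm_line.
  by apply: is_derive_eq; rewrite /GRing.scale/=; ring.
rewrite mulrC; apply: (@is_derive1_comp _ F (fun h : R => b - sqnorm (h *: e_ i + x))) dq.
by rewrite scale0r add0r.
Qed.

Lemma continuous_sqnorm : continuous (@sqnorm R N).
Proof. exact: (Ck_continuous (Ck_sqnorm 0)). Qed.

(** The induction runs over all p at once: a partial derivative is a polynomial times a function of
    the same family for another p. *)
Lemma Ck_expinv k (p : {poly R}) (n b : R) :
  Ck k (fun x : 'rV[R]_N => expinv p (n * (b - sqnorm x))).
Proof.
have cont q : continuous (fun x : 'rV[R]_N => expinv q (n * (b - sqnorm x))).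
  move=> x; apply: (@continuous_comp _ _ _ (fun y : 'rV[R]_N => n * (b - sqnorm y)) (expinv q)).
    apply: continuousM; first exact: cst_continuous.
    by apply: continuousB; [exact: cst_continuous|exact: continuous_sqnorm].
  exact: continuous_expinv.
elim: k p => [|k IH] p; split => // i.
have D (x : 'rV[R]_N) : is_derive x (e_ i) (fun x => expinv p (n * (b - sqnorm x)))
    (- (2 * x ord0 i) * (n * expinv ('X^2 * (p - p^`())) (n * (b - sqnorm x)))).
  apply: (@is_derive_radial (fun y => expinv p (n * y))).
  have dE := is_derive_expinv p (n * (b - sqnorm x)).
  have dn : is_derive (b - sqnorm x) 1 (fun y : R => n * y) n.
    by apply: is_derive_eq; rewrite /GRing.scale/= mulr1.
  by rewrite mulrC; exact: (is_derive1_comp dE dn).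
split; first by move=> x; have [] := D x.
rewrite (_ : 'D_(e_ i) _ = fun x => (- 2 * x ord0 i) *
    (n * expinv ('X^2 * (p - p^`())) (n * (b - sqnorm x)))).
  apply: Ck_mul; first by apply: Ck_mul; [exact: Ck_cst|exact: Ck_coord].
  by apply: Ck_mul; [exact: Ck_cst|exact: IH].
by apply/funext => x; rewrite mulNr; apply: derive_val; exact: D.
Qed.

Lemma test_function_ball (phi : 'rV[R]_N -> R) (b : R) :
  (forall k, Ck k phi) -> (forall x, b < sqnorm x -> phi x = 0) ->
  test_function phi.
Proof.
move=> Cphi phi0; split => //.
have clB : closed [set x : 'rV[R]_N | sqnorm x <= b].
  rewrite (_ : mkset _ = @sqnorm R N @^-1` [set y | y <= b])//.
  by apply: closed_comp; [move=> x _; exact: continuous_sqnorm|exact: closed_le].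
have sub : closure [set x | phi x != 0] `<=` [set x | sqnorm x <= b].
  rewrite [X in _ `<=` X](closure_id _).1//; apply: closureS => x /= phix.
  by rewrite leNgt; apply/negP => /phi0 phix0; rewrite phix0 eqxx in phix.
(* The ball of squared radius b lies in this cube because b <= (1 + b)^2. *)
pose A (_ : 'I_N) := `[- (1 + b), 1 + b]%classic.
have cA : compact [set x : 'rV[R]_N | forall i, A i (x ord0 i)].
  by apply: rV_compact => i; exact: segment_compact.
apply: (subclosed_compact _ cA); first exact: closed_closure.
move=> x /sub/= xb i; have b0 : 0 <= b := le_trans (sqnorm_ge0 x) xb.
rewrite /A/= in_itv/= -ler_norml -(@ler_pXn2r _ 2)// ?nnegrE ?addr_ge0//.
rewrite real_normK ?num_real//.
have : x ord0 i ^+ 2 <= sqnorm x.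
  by rewrite /sqnorm (bigD1 i)//= lerDl; apply: sumr_ge0 => j _; exact: sqr_ge0.
have : 0 <= b ^+ 2 by exact: sqr_ge0.
rewrite sqrrD expr1n mul1r mulr2n; lra.
Qed.

Variables (n b : R).
Hypothesis n_gt0 : 0 < n.

Let phi (x : 'rV[R]_N) := flat_sqr n (b - sqnorm x).

Let Ck_shift k : Ck k (fun x : 'rV[R]_N => b - sqnorm x).
Proof.
rewrite (_ : (fun _ => _) = fun x : 'rV[R]_N => b + (- 1) * sqnorm x).
  by apply: Ck_add; [exact: Ck_cst|apply: Ck_mul; [exact: Ck_cst|exact: Ck_sqnorm]].
by apply/funext => x; rewrite mulN1r.
Qed.

Lemma test_function_flat_sqr : test_function phi.
Proof.
apply: (@test_function_ball _ b) => [k|x bx].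
  apply: Ck_mul; last exact: Ck_expinv.
  by apply: Ck_mul; [apply: Ck_mul; exact: Ck_shift|exact: Ck_cst].
by rewrite /phi; have [|->] := @flat_sqr_le0 R n (b - sqnorm x) n_gt0; rewrite ?subr_le0 ?ltW.
Qed.

Lemma derive_flat_sqr i :
  'D_(e_ i) phi = fun x => - (2 * x ord0 i) * flat_sqr1 n (b - sqnorm x).
Proof.
apply/funext => x; apply: derive_val.
by apply: (@is_derive_radial (flat_sqr n)); exact: is_derive_flat_sqr.
Qed.

(** Allows the partial derivative of [phi] itself as a test function in the definition of the weak
    gradient of u. *)
Lemma test_function_derive_flat_sqr i : test_function ('D_(e_ i) phi).
Proof.
apply: (@test_function_ball _ b) => [k|x bx].
  have [Cphi _] := test_function_flat_sqr.
  by have [_ /(_ i)[]] := Cphi k.+1.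
have /(congr1 (fun F => F x))/= -> := derive_flat_sqr i.
by have [|_ -> _] := @flat_sqr_le0 R n (b - sqnorm x) n_gt0; rewrite ?mulr0 ?subr_le0 ?ltW.
Qed.

Lemma derive2_flat_sqr i : 'D_(e_ i) ('D_(e_ i) phi) = fun x =>
  - 2 * flat_sqr1 n (b - sqnorm x) + 4 * x ord0 i ^+ 2 * flat_sqr2 n (b - sqnorm x).
Proof.
apply/funext => x; rewrite derive_flat_sqr; apply: derive_val.
have d1 := is_derive_radial i (is_derive_flat_sqr1 (b - sqnorm x) n_gt0).
have d2 : is_derive x (e_ i) (fun y : 'rV[R]_N => - (2 * y ord0 i)) (- 2).
  have dc := is_derive_coord i i x.
  by apply: is_derive_eq; rewrite eqxx /GRing.scale/=; ring.
by apply: is_derive_eq; rewrite /GRing.scale/=; ring.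
Qed.

End Ck_theory.

(** * The integral identity of a weak radial solution *)

Section ae_integral.
Local Open Scope ereal_scope.
Context d (T : measurableType d) (R : realType) (mu : {measure set T -> \bar R}).
Implicit Types f g : T -> \bar R.
Import HBNNSimple.

(** The integral is a supremum over simple functions below f. Cutting such a function off on the
    null set Z keeps its integral and puts it below g. *)
Let ae_ge0_le_integral f g (Z : set T) : measurable Z -> mu Z = 0 ->
  (forall x, 0 <= f x) -> (forall x, 0 <= g x) -> (forall x, ~ Z x -> f x = g x) ->
  \int[mu]_x f x <= \int[mu]_x g x.
Proof.
move=> mZ Z0 f0 g0 fg; rewrite !ge0_integralTE//.
apply: ge_ereal_sup => _ [h /= hf <-].
have mZC := measurableC mZ.
have hE x : proj_nnsfun h mZC x = (h \_ (~` Z)) x by rewrite mrestrict.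
apply: ereal_sup_ubound; exists (proj_nnsfun h mZC).
  move=> x; rewrite hE patchE; case: ifPn => [|_]; last exact: g0.
  by rewrite inE => /fg <-; exact: hf.
rewrite -!integralT_nnsfun [RHS](@ge0_negligible_integral _ _ _ _ _ Z)//; last 2 first.
- exact/measurable_EFinP.
- by move=> x _; rewrite lee_fin.
rewrite setTD [RHS]integral_mkcond; apply: eq_integral => x _.
by rewrite hE !patchE; case: ifPn.
Qed.

(* Unlike [ae_eq_integral], this does not require measurability. *)
Lemma ae_eq_integral_setT f g : {ae mu, forall x, f x = g x} ->
  \int[mu]_x f x = \int[mu]_x g x.
Proof.
move=> [Z [mZ Z0 fgZ]].
have fg x : ~ Z x -> f x = g x by move=> nZx; apply: contrapT => fgx; exact/nZx/fgZ.
rewrite integralE [RHS]integralE; congr (_ - _); apply/eqP; rewrite eq_le; apply/andP; split;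
  apply: (ae_ge0_le_integral mZ Z0) => // x /fg; by rewrite ?funeposE ?funenegE => ->.
Qed.

End ae_integral.

Section integrable_prod.
Context d (T : measurableType d) (R : realType) (mu : {measure set T -> \bar R}).

(** The product is dominated by C K (1_B + W). *)
Lemma integrable_mul_bounded (B : set T) (w W psi : T -> R) (C K : R) :
  measurable B -> (mu B < +oo)%E -> measurable_fun setT w -> measurable_fun setT psi ->
  mu.-integrable setT (EFin \o W) -> (forall x, 0 <= W x) ->
  (forall x, `|w x| <= C * (1 + W x)) ->
  (forall x, `|psi x| <= K) -> (forall x, ~ B x -> psi x = 0) ->
  mu.-integrable setT (fun x => (w x * psi x)%:E).
Proof.
move=> mB Boo mw mpsi iW W0 wW psiK psi0.
have iB : mu.-integrable setT (fun x => (\1_B x : R)%:E).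
  apply/integrableP; split; first exact/measurable_EFinP.
  under eq_integral do rewrite abse_EFin ger0_norm//.
  by rewrite integral_indic// setIT.
have i1 := integrableZl measurableT (C * K) (integrableD measurableT iB iW).
apply: (le_integrable _ _ _ i1) => //.
  by apply/measurable_EFinP; exact: measurable_funM.
move=> x _; rewrite -EFinD -EFinM !abse_EFin lee_fin.
have [xB|xB] := pselect (B x); last first.
  by rewrite psi0// mulr0 normr0.
rewrite indicE mem_set//= mulrAC [leRHS]ger0_norm.
  by rewrite normrM; apply: ler_pM.
by rewrite mulr_ge0// (le_trans _ (wW x), le_trans _ (psiK x)).
Qed.

(** The factor 1 matches the growth condition of [integrable_mul_bounded] with C = 1. *)
Lemma norm_le_1DpowR (r x : R) : 1 <= r -> `|x| <= 1 * (1 + `|x| `^ r).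
Proof.
move=> r1; rewrite mul1r; have [x1|x1] := leP `|x| 1.
  by rewrite ler_wpDr// powR_ge0.
by rewrite ler_wpDl// le1r_powR// ltW.
Qed.

End integrable_prod.

Section radius2.
Context {R : realType} (N : nat).
Hypothesis N_gt0 : (0 < N)%N.

(* the squared radius of the ball of volume [t] *)
Definition radius2 (t : R) : R := (t / ball_volume N) `^ (2 / N%:R).

Lemma radius2_ge0 t : 0 <= radius2 t.
Proof. exact: powR_ge0. Qed.

Lemma radius2_ball_vol (x : 'rV[R]_N) : radius2 (ball_vol x) = sqnorm x.
Proof. by rewrite [RHS]sqnormE. Qed.

Lemma measurable_radius2 : measurable_fun setT radius2.
Proof.
apply: (@measurableT_comp _ _ _ _ _ _ (@powR R ^~ (2 / N%:R))).
  exact: measurable_powR.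
exact: measurable_funM.
Qed.

Lemma enormE (x : 'rV[R]_N) : enorm x = Num.sqrt (radius2 (ball_vol x)).
Proof. by rewrite radius2_ball_vol. Qed.

End radius2.

Section weak_radial_identity.
Context {R : realType} (N : nat).
Hypothesis N_gt0 : (0 < N)%N.
Local Notation mu := (@lebesgue_rV R N).
Local Notation leb := (@lebesgue_measure R).
Local Notation rho := (@radius2 R N).
Local Notation e_ i := (delta_mx ord0 i : 'rV[R]_N).

Variables (r C : R) (u gu : 'rV[R]_N -> R) (v : 'I_N -> 'rV[R]_N -> R) (f gf : R -> R).
Hypothesis r1 : 1 <= r.
Hypothesis uL : u \in Lfun mu r%:E.
Hypothesis vL : L2_weak_gradient u v.
Hypothesis mf : measurable_fun setT f.
Hypothesis mgf : measurable_fun setT gf.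
Hypothesis gf_le : forall t, `|gf t| <= C * (1 + `|f t| `^ r).
Hypothesis uE : {ae mu, forall x, u x = f (ball_vol x)}.
Hypothesis guE : {ae mu, forall x, gu x = gf (ball_vol x)}.
Hypothesis weak : forall phi, test_function phi ->
  (\int[mu]_x (\sum_i v i x * 'D_(e_ i) phi x)%:E =
   \int[mu]_x (gu x * phi x)%:E)%E.

Let measurable_u : measurable_fun setT u.
Proof. by move: uL; rewrite inE => /andP[]; rewrite inE. Qed.

Let integrable_u : mu.-integrable setT (fun x => (`|u x| `^ r)%:E).
Proof. exact: Lfun_integrable. Qed.

Let measurable_fx : measurable_fun setT (fun x : 'rV[R]_N => f (ball_vol x)).
Proof. by apply: measurableT_comp => //; exact: measurable_ball_vol. Qed.

Let measurable_gfx : measurable_fun setT (fun x : 'rV[R]_N => gf (ball_vol x)).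
Proof. by apply: measurableT_comp => //; exact: measurable_ball_vol. Qed.

Let integrable_fx : mu.-integrable setT (fun x => (`|f (ball_vol x)| `^ r)%:E).
Proof.
have [_ ioo] := integrableP _ _ _ integrable_u.
apply/integrableP; split.
  apply/measurable_EFinP; apply: (@measurableT_comp _ _ _ _ _ _ (@powR R ^~ r)).
    exact: measurable_powR.
  exact: measurableT_comp.
apply: le_lt_trans ioo; rewrite le_eqVlt; apply/orP; left; apply/eqP.
by apply: ae_eq_integral_setT; apply: filterS uE => x ->.
Qed.

Let measurable_v i : measurable_fun setT (v i).
Proof. by have [+ _] := vL i; rewrite inE => /andP[]; rewrite inE. Qed.

Let integrable_v i : mu.-integrable setT (fun x => (`|v i x| `^ 2)%:E).
Proof. by have [? _] := vL i; apply: Lfun_integrable => //; lra. Qed.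

Section at_scale.
Variables (n b : R).
Hypothesis n1 : 1 <= n.
Hypothesis b_gt0 : 0 < b.
Let n_gt0 : 0 < n. Proof. by rewrite (lt_le_trans ltr01). Qed.
Let B := [set x : 'rV[R]_N | sqnorm x <= b].

Let mB : measurable B.
Proof. exact: measurable_sqnorm_le. Qed.

Let B_fin : (mu B < +oo)%E.
Proof. by rewrite /B lebesgue_rV_ball// ltry. Qed.

Let off_B (x : 'rV[R]_N) : ~ B x ->
  [/\ flat_sqr n (b - sqnorm x) = 0, flat_sqr1 n (b - sqnorm x) = 0 &
      flat_sqr2 n (b - sqnorm x) = 0].
Proof.
by move=> /negP; rewrite -ltNge => bx; apply: flat_sqr_le0 => //; rewrite subr_le0 ltW.
Qed.

Let coord_B i (x : 'rV[R]_N) : B x -> `|x ord0 i| <= b + 1.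
Proof.
move=> xb; have b0 := ltW b_gt0.
rewrite -(@ler_pXn2r _ 2)// ?nnegrE ?addr_ge0// real_normK ?num_real//.
have : x ord0 i ^+ 2 <= sqnorm x.
  by rewrite /sqnorm (bigD1 i)//= lerDl; apply: sumr_ge0 => j _; exact: sqr_ge0.
have : 0 <= b ^+ 2 by exact: sqr_ge0.
by move: xb; rewrite /B/= sqrrD expr1n mulr1 mulr2n; lra.
Qed.

Let measurable_radial (F : R -> R) : measurable_fun setT F ->
  measurable_fun setT (fun x : 'rV[R]_N => F (b - sqnorm x)).
Proof.
move=> mF; apply: measurableT_comp => //.
by apply: measurable_funB => //; exact: measurable_sqnorm.
Qed.

Let phi (x : 'rV[R]_N) := flat_sqr n (b - sqnorm x).

Let F_le (x : 'rV[R]_N) : `|flat_sqr n (b - sqnorm x)| <= b ^+ 2 /\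
  `|flat_sqr1 n (b - sqnorm x)| <= b + 1.
Proof. by apply: flat_sqr_bound; rewrite ?(ltW b_gt0)// gerBl sqnorm_ge0. Qed.

Let F2_le (x : 'rV[R]_N) : `|flat_sqr2 n (b - sqnorm x)| <= 1.
Proof. by have /andP[F0 F1] := flat_sqr2_itv n (b - sqnorm x); rewrite ger0_norm. Qed.

Let integrable_v_dphi i : mu.-integrable setT (fun x => (v i x * 'D_(e_ i) phi x)%:E).
Proof.
have dE := derive_flat_sqr b n_gt0 i.
under eq_fun => x do rewrite (congr1 (fun F => F x) dE)/=.
apply: (@integrable_mul_bounded _ _ _ _ B (v i) (fun x => `|v i x| `^ 2) _ 1
  (2 * (b + 1) * (b + 1))) => //.
- apply: measurable_funM; last exact: (measurable_radial (measurable_flat_sqr1 n_gt0)).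
  by apply: measurableT_comp => //; apply: measurable_funM => //; exact: measurable_coord_rV.
- exact: integrable_v.
- by move=> x; apply: norm_le_1DpowR; lra.
- move=> x; have [xB|xB] := pselect (B x); last first.
    have [_ -> _] := off_B xB; rewrite mulr0 normr0 !mulr_ge0// addr_ge0// ltW//.
  rewrite normrM normrN normrM (ger0_norm (_ : 0 <= 2))//; apply: ler_pM => //.
    by rewrite ler_pM2l// coord_B.
  by have [_] := F_le x.
- by move=> x xB; have [_ -> _] := off_B xB; rewrite mulr0.
Qed.

Let integrable_u_d2phi i :
  mu.-integrable setT (fun x => (u x * 'D_(e_ i) ('D_(e_ i) phi) x)%:E).
Proof.
have dE := derive2_flat_sqr b n_gt0 i.
under eq_fun => x do rewrite (congr1 (fun F => F x) dE)/=.
apply: (@integrable_mul_bounded _ _ _ _ B u (fun x => `|u x| `^ r) _ 1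
  (2 * (b + 1) + 4 * (b + 1) ^+ 2)) => //.
- apply: measurable_funD.
    by apply: measurable_funM => //; exact: (measurable_radial (measurable_flat_sqr1 n_gt0)).
  apply: measurable_funM; last exact: (measurable_radial (measurable_flat_sqr2 n)).
  by apply: measurable_funM => //; apply: measurable_funX; exact: measurable_coord_rV.
- by move=> x; exact: norm_le_1DpowR.
- move=> x; have [xB|xB] := pselect (B x); last first.
    have [_ -> ->] := off_B xB; rewrite !mulr0 addr0 normr0.
    by rewrite addr_ge0// mulr_ge0// ?sqr_ge0// addr_ge0// ltW.
  rewrite (le_trans (ler_normD _ _))//; apply: lerD.
    by rewrite normrM normrN (ger0_norm (_ : 0 <= 2))// ler_pM2l//; have [_] := F_le x.
  rewrite normrM -[leRHS]mulr1; apply: ler_pM => //.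
  rewrite normrM (ger0_norm (_ : 0 <= 4))// ler_pM2l// normrX.
  by rewrite lerXn2r ?nnegrE ?coord_B// addr_ge0// ltW.
- by move=> x xB; have [_ -> ->] := off_B xB; rewrite !mulr0 addr0.
Qed.

(** Minus the Laplacian of [phi], as a function of s = |x|^2. *)
Let lap (s : R) := 2 * N%:R * flat_sqr1 n (b - s) - 4 * s * flat_sqr2 n (b - s).

(** Taking the partial derivatives of [phi] as test functions moves the derivative from v to u, so
    the gradient disappears; then u and g(u) can be replaced by their radial representatives. *)
Let weak_laplace : (\int[mu]_x (f (ball_vol x) * lap (sqnorm x))%:E =
  \int[mu]_x (gf (ball_vol x) * flat_sqr n (b - sqnorm x))%:E)%E.
Proof.
have tphi := @test_function_flat_sqr R N n b n_gt0.
transitivity (\int[mu]_x (gu x * phi x)%:E)%E; last first.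
  by apply: ae_eq_integral_setT; apply: filterS guE => x ->.
rewrite -(weak tphi).
under [RHS]eq_integral => x _ do rewrite -sumEFin.
rewrite [RHS]integral_sum//.
have viE i : (\int[mu]_x (v i x * 'D_(e_ i) phi x)%:E =
    \int[mu]_x ((- 1)%:E * (u x * 'D_(e_ i) ('D_(e_ i) phi) x)%:E))%E.
  have [_ wi] := vL i.
  rewrite integralZl// (wi _ (test_function_derive_flat_sqr b n_gt0 i)) mulN1e.
  by rewrite oppeK.
under eq_bigr do rewrite viE.
rewrite -integral_sum//; last by move=> i; exact: integrableZl.
apply: ae_eq_integral_setT; apply: filterS uE => x ->.
under eq_bigr => i _ do rewrite (congr1 (fun F => F x) (derive2_flat_sqr b n_gt0 i))/= -EFinM.
rewrite sumEFin; congr (_%:E); rewrite /lap -mulr_sumr -mulr_sumr big_split/=.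
rewrite sumr_const card_ord -!mulr_suml -mulr_sumr -/(sqnorm x) -mulr_natl.
ring.
Qed.

Let integrable_x (w F : R -> R) (c K : R) :
  measurable_fun setT w -> (forall t, `|w t| <= c * (1 + `|f t| `^ r)) ->
  measurable_fun setT F -> (forall s, 0 <= s <= b -> `|F s| <= K) ->
  (forall s, b < s -> F s = 0) ->
  mu.-integrable setT (fun x => (w (ball_vol x) * F (sqnorm x))%:E).
Proof.
move=> mw wc mF FK F0.
have K0 : 0 <= K by apply: le_trans (FK 0 _) => //; rewrite lexx ltW.
apply: (@integrable_mul_bounded _ _ _ _ B (fun x => w (ball_vol x))
   (fun x => `|f (ball_vol x)| `^ r) (fun x => F (sqnorm x)) c K) => //.
- by apply: measurableT_comp => //; exact: measurable_ball_vol.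
- by apply: measurableT_comp => //; exact: measurable_sqnorm.
- move=> x; have [xB|xB] := leP (sqnorm x) b; first by apply: FK; rewrite sqnorm_ge0.
  by rewrite F0// normr0.
- by move=> x /negP; rewrite -ltNge; exact: F0.
Qed.

Let integral_x (w F : R -> R) (c K : R) :
  measurable_fun setT w -> (forall t, `|w t| <= c * (1 + `|f t| `^ r)) ->
  measurable_fun setT F -> (forall s, 0 <= s <= b -> `|F s| <= K) ->
  (forall s, b < s -> F s = 0) ->
  (\int[mu]_x (w (ball_vol x) * F (sqnorm x))%:E =
   \int[leb]_(t in `[0%R, +oo[) (w t * F (rho t))%:E)%E.
Proof.
move=> mw wc mF FK F0.
rewrite -(@integral_ball_vol R N N_gt0 (fun t => (w t * F (rho t))%:E)).
- by apply: eq_integral => x _; rewrite radius2_ball_vol.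
- apply/measurable_EFinP; apply: measurable_funM => //.
  by apply: measurableT_comp => //; exact: measurable_radius2.
- rewrite (_ : _ \o _ = (fun x => (w (ball_vol x) * F (sqnorm x))%:E)).
    exact: (integrable_x mw wc mF FK F0).
  by apply/funext => x /=; rewrite radius2_ball_vol.
Qed.

Lemma weak_laplace_volume :
  (\int[leb]_(t in `[0%R, +oo[) (f t *
     (2 * N%:R * flat_sqr1 n (b - rho t) - 4 * rho t * flat_sqr2 n (b - rho t)))%:E =
   \int[leb]_(t in `[0%R, +oo[) (gf t * flat_sqr n (b - rho t))%:E)%E.
Proof.
have mshift : measurable_fun setT (fun s : R => b - s) by exact: measurable_funB.
have off s : b < s -> [/\ flat_sqr n (b - s) = 0, flat_sqr1 n (b - s) = 0 &
    flat_sqr2 n (b - s) = 0].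
  by move=> bs; apply: flat_sqr_le0 => //; rewrite subr_le0 ltW.
have bound s : 0 <= s <= b -> `|flat_sqr n (b - s)| <= b ^+ 2 /\
    `|flat_sqr1 n (b - s)| <= b + 1.
  by move=> /andP[s0 sb]; apply: flat_sqr_bound; rewrite ?(ltW b_gt0)// gerBl.
rewrite -(@integral_x f lap 1 (2 * N%:R * (b + 1) + 4 * b)) => //; first last.
- by move=> s /off[_ E1 E2]; rewrite /lap E1 E2 !mulr0 subr0.
- move=> s sb; have [_ F1] := bound s sb; have /andP[s0 sb'] := sb.
  rewrite /lap (le_trans (ler_normB _ _))//; apply: lerD.
    by rewrite normrM ger0_norm ?ler_wpM2l// mulr_ge0.
  rewrite normrM ger0_norm ?mulr_ge0// -[leRHS]mulr1.
  apply: ler_pM => //; rewrite ?mulr_ge0 ?ler_pM2l//.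
  by have /andP[F20 F21] := flat_sqr2_itv n (b - s); rewrite ger0_norm.
- apply: measurable_funB; apply: measurable_funM => //.
  + exact: (measurableT_comp (measurable_flat_sqr1 n_gt0) mshift).
  + exact: (measurableT_comp (measurable_flat_sqr2 n) mshift).
- by move=> t; exact: norm_le_1DpowR.
rewrite weak_laplace.
rewrite (@integral_x gf (fun s => flat_sqr n (b - s)) C (b ^+ 2)) => //.
- exact: (measurableT_comp (measurable_flat_sqr n_gt0) mshift).
- by move=> s /bound[].
- by move=> s /off[].
Qed.

Lemma integrable_volume (w F : R -> R) (c K : R) :
  measurable_fun setT w -> (forall t, `|w t| <= c * (1 + `|f t| `^ r)) ->
  measurable_fun setT F -> (forall s, 0 <= s <= b -> `|F s| <= K) ->
  (forall s, b < s -> F s = 0) ->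
  leb.-integrable `[0%R, +oo[ (fun t => (w t * F (rho t))%:E).
Proof.
move=> mw wc mF FK F0; apply: (integrable_ball_vol N_gt0).
  apply/measurable_EFinP; apply: measurable_funM => //.
  by apply: measurableT_comp => //; exact: measurable_radius2.
rewrite (_ : _ \o _ = (fun x => (w (ball_vol x) * F (sqnorm x))%:E)).
  exact: (integrable_x mw wc mF FK F0).
by apply/funext => x /=; rewrite radius2_ball_vol.
Qed.

End at_scale.

(** Dominated convergence, with K |w| restricted to the ball rho <= b as the dominating function. *)
Lemma cvg_integral_volume (w : R -> R) (F_ : nat -> R -> R) (F : R -> R) (b c K : R) :
  0 < b -> measurable_fun setT w -> (forall t, `|w t| <= c * (1 + `|f t| `^ r)) ->
  (forall n, measurable_fun setT (F_ n)) -> measurable_fun setT F ->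
  (forall n s, 0 <= s <= b -> `|F_ n s| <= K) -> (forall n s, b < s -> F_ n s = 0) ->
  (forall s, 0 <= s -> F_ n s @[n --> \oo] --> F s) ->
  (\int[leb]_(t in `[0%R, +oo[) (w t * F_ n (rho t))%:E @[n --> \oo] -->
   \int[leb]_(t in `[0%R, +oo[) (w t * F (rho t))%:E)%E.
Proof.
move=> b0 mw wc mF_ mF FK F0 FF.
have mrho : measurable_fun setT rho by exact: measurable_radius2.
have K0 : 0 <= K by apply: le_trans (FK 0 0 _) => //; rewrite lexx ltW.
have m1 : measurable_fun setT (fun s : R => K * \1_(`]-oo, b]%classic) s : R).
  by apply: measurable_funM => //; exact: measurable_indic.
have ind1 s : s <= b -> \1_(`]-oo, b]%classic) s = 1 :> R.
  by move=> sb; rewrite indicE mem_set//= in_itv.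
have ind0 s : b < s -> \1_(`]-oo, b]%classic) s = 0 :> R.
  by move=> bs; rewrite indicE memNset//= in_itv/= leNgt bs.
have iG : leb.-integrable `[0%R, +oo[
    (fun t => (`|w t| * (K * \1_(`]-oo, b]%classic) (rho t)))%:E).
  apply: (@integrable_volume b b0 (fun t => `|w t|) (fun s => K * \1_(`]-oo, b]%classic) s) c K) => //.
  - exact: measurableT_comp.
  - by move=> t; rewrite normr_id.
  - by move=> s /andP[_ sb]; rewrite ind1// mulr1 ger0_norm.
  - by move=> s bs; rewrite ind0// mulr0.
have [] := @dominated_convergence _ _ _ leb `[0%R, +oo[%classic (measurable_itv _)
  (fun n t => (w t * F_ n (rho t))%:E) (fun t => (w t * F (rho t))%:E) _ _ _ _ iG _ => //.
- move=> n; apply/measurable_EFinP/measurable_funTS/measurable_funM => //.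
  exact: measurableT_comp.
- apply/measurable_EFinP/measurable_funTS/measurable_funM => //.
  exact: measurableT_comp.
- apply: aeW => t _; apply/fine_cvgP; split; first by near=> n.
  by apply: cvgMl_tmp; apply: FF; exact: radius2_ge0.
- apply: aeW => t n _; rewrite abse_EFin lee_fin normrM ler_wpM2l//.
  have [tb|tb] := leP (rho t) b.
    by rewrite ind1// mulr1 FK// radius2_ge0.
  by rewrite F0// normr0 ind0// mulr0.
Unshelve. all: by end_near.
Qed.

(** The limit of [weak_laplace_volume] as the smoothing is removed. On rho < b the limiting kernels
    are polynomials in rho, so the integrals become combinations of primitives. *)
Lemma radial_identity (b : R) : 0 < b ->
  (\int[leb]_(t in `[0%R, +oo[) (f t *
     (2 * N%:R * Num.max (b - rho t) 0 - 4 * rho t * (0 < b - rho t)%R%:R))%:E =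
   \int[leb]_(t in `[0%R, +oo[) (gf t * (Num.max (b - rho t) 0 ^+ 2 / 2))%:E)%E.
Proof.
move=> b0.
have mshift : measurable_fun setT (fun s : R => b - s) by exact: measurable_funB.
have n1 n : 1 <= n.+1%:R :> R by rewrite ler1n.
have n0 n : 0 < n.+1%:R :> R by [].
have off n s : b < s -> [/\ flat_sqr n.+1%:R (b - s) = 0, flat_sqr1 n.+1%:R (b - s) = 0 &
    flat_sqr2 n.+1%:R (b - s) = 0].
  by move=> bs; apply: flat_sqr_le0 => //; rewrite subr_le0 ltW.
have bound n s : 0 <= s <= b -> `|flat_sqr n.+1%:R (b - s)| <= b ^+ 2 /\
    `|flat_sqr1 n.+1%:R (b - s)| <= b + 1.
  by move=> /andP[s0 sb]; apply: flat_sqr_bound; rewrite ?(ltW b0)// gerBl.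
have mmax : measurable_fun setT (fun s : R => Num.max (b - s) 0).
  by apply: measurable_maxr => //.
have L : (\int[leb]_(t in `[0%R, +oo[) (f t *
     (2 * N%:R * flat_sqr1 n.+1%:R (b - rho t) - 4 * rho t * flat_sqr2 n.+1%:R (b - rho t)))%:E
   @[n --> \oo] --> \int[leb]_(t in `[0%R, +oo[) (f t *
     (2 * N%:R * Num.max (b - rho t) 0 - 4 * rho t * (0 < b - rho t)%R%:R))%:E)%E.
  apply: (@cvg_integral_volume f
    (fun n s => 2 * N%:R * flat_sqr1 n.+1%:R (b - s) - 4 * s * flat_sqr2 n.+1%:R (b - s))
    (fun s => 2 * N%:R * Num.max (b - s) 0 - 4 * s * (0 < b - s)%R%:R)
    b 1 (2 * N%:R * (b + 1) + 4 * b)) => //.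
  - by move=> t; exact: norm_le_1DpowR.
  - move=> n; apply: measurable_funB; apply: measurable_funM => //.
    + exact: (measurableT_comp (measurable_flat_sqr1 (n0 n)) mshift).
    + exact: (measurableT_comp (measurable_flat_sqr2 _) mshift).
  - apply: measurable_funB; apply: measurable_funM => //.
    rewrite (_ : (fun _ => _) = \1_(`]-oo, b[%classic)); first exact: measurable_indic.
    by apply/funext => s; rewrite indicE subr_gt0 mem_setE in_itv.
  - move=> n s sb; have [_ F1] := bound n s sb; have /andP[s0 sb'] := sb.
    rewrite (le_trans (ler_normB _ _))//; apply: lerD.
      by rewrite normrM ger0_norm ?ler_wpM2l// mulr_ge0.
    rewrite normrM ger0_norm ?mulr_ge0// -[leRHS]mulr1.
    apply: ler_pM => //; rewrite ?mulr_ge0 ?ler_pM2l//.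
    by have /andP[F20 F21] := flat_sqr2_itv n.+1%:R (b - s); rewrite ger0_norm.
  - by move=> n s /(off n)[_ -> ->]; rewrite !mulr0 subr0.
  - move=> s _; apply: cvgB; apply: cvgMl_tmp; [exact: flat_sqr1_cvg|exact: flat_sqr2_cvg].
have Rr : (\int[leb]_(t in `[0%R, +oo[) (gf t * flat_sqr n.+1%:R (b - rho t))%:E
   @[n --> \oo] -->
   \int[leb]_(t in `[0%R, +oo[) (gf t * (Num.max (b - rho t) 0 ^+ 2 / 2))%:E)%E.
  apply: (@cvg_integral_volume gf (fun n s => flat_sqr n.+1%:R (b - s))
    (fun s => Num.max (b - s) 0 ^+ 2 / 2) b C (b ^+ 2)) => //.
  - by move=> n; exact: (measurableT_comp (measurable_flat_sqr (n0 n)) mshift).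
  - by apply: measurable_funM => //; exact: measurable_funX.
  - by move=> n s /(bound n)[].
  - by move=> n s /(off n)[].
  - by move=> s _; exact: flat_sqr_cvg.
apply: (@cvg_unique _ (@ereal_hausdorff R) _ _ _ _ L).
apply: cvg_trans Rr; apply: near_eq_cvg; near=> n.
by rewrite weak_laplace_volume.
Unshelve. all: by end_near.
Qed.

End weak_radial_identity.

(** * Reduction to an Emden-Fowler system *)

Section primitive.
Context {R : realType}.
Local Notation leb := (@lebesgue_measure R).
Implicit Types (w : R -> R) (t T : R).

Definition primitive w T : R := \int[leb]_(t in `[0, T]) w t.

Definition locally_integrable0 w :=
  forall T, 0 < T -> leb.-integrable `[0, T] (EFin \o w).

Lemma primitive_continuous w t : locally_integrable0 w -> 0 < t ->
  {for t, continuous (primitive w)}.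
Proof.
move=> iw t0.
have t1 : 0 < t + 1 by rewrite addr_gt0.
have := parameterized_integral_continuous (ltW t1) (iw _ t1).
move=> /(continuous_within_itvP _ t1)[+ _ _]; apply.
by rewrite in_itv/= t0 ltrDl ltr01.
Qed.

Lemma primitive_cvg0 w : locally_integrable0 w -> primitive w t @[t --> 0^'+] --> 0.
Proof.
move=> iw; have := parameterized_integral_cvg_left ltr01 (iw _ ltr01).
exact: cvg_at_right_filter.
Qed.

(** The endpoint 0, where the two functions may differ, is negligible. *)
Let ae_eq_restrict w1 w2 T (F : R -> \bar R) :
  {ae leb, forall t : R, 0 < t -> w1 t = w2 t} ->
  {ae leb, forall t : R, ((F \o w1) \_ `[0, T]) t = ((F \o w2) \_ `[0, T]) t}.
Proof.
move=> w12; have n0 : {ae leb, forall t : R, t != 0}.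
  exists [set 0]; split; [exact: measurable_set1|exact: lebesgue_measure_set1|].
  by move=> t /= /negP; rewrite negbK => /eqP.
apply: (@filterS2 _ _ (ae_filter_ringOfSetsType leb) _ _ _ _ w12 n0) => {w12} t w12 tn0; rewrite !patchE.
case: ifPn => //; rewrite inE/= in_itv/= => /andP[t0 _].
by rewrite /= w12// lt_neqAle eq_sym tn0.
Qed.

Lemma ae_eq_primitive w1 w2 T :
  {ae leb, forall t : R, 0 < t -> w1 t = w2 t} -> primitive w1 T = primitive w2 T.
Proof.
move=> w12; rewrite /primitive /Rintegral integral_mkcond [in RHS]integral_mkcond.
by congr fine; apply: ae_eq_integral_setT; exact: (ae_eq_restrict T EFin w12).
Qed.

Lemma ae_locally_integrable0 w1 w2 : measurable_fun setT w2 ->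
  {ae leb, forall t : R, 0 < t -> w1 t = w2 t} ->
  locally_integrable0 w1 -> locally_integrable0 w2.
Proof.
move=> mw2 w12 iw T T0; have /integrableP[_ ioo] := iw T T0.
apply/integrableP; split; first exact/measurable_EFinP/measurable_funTS.
apply: le_lt_trans ioo; rewrite le_eqVlt; apply/orP; left; apply/eqP.
rewrite integral_mkcond [RHS]integral_mkcond; apply: ae_eq_integral_setT.
apply: (@filterS _ _ (ae_filter_ringOfSetsType leb) _ _ _
  (ae_eq_restrict T (fun x => `|x%:E|%E) w12)) => t.
by rewrite !patchE; case: ifPn => [_ E|_ _]; [exact: esym|reflexivity].
Qed.

Lemma is_derive_primitive_continuous w t : locally_integrable0 w -> 0 < t ->
  {for t, continuous w} -> is_derive t 1 (primitive w) (w t).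
Proof.
move=> iw t0 cw.
have tt1 : t < t + 1 by rewrite ltrDl.
have [d dE] := continuous_FTC1_closed tt1 (iw _ (lt_trans t0 tt1)) t0 cw.
by apply: DeriveDef; [exact: d|rewrite -derive1E; exact: dE].
Qed.

Lemma ae_is_derive_primitive w : measurable_fun setT w -> locally_integrable0 w ->
  {ae leb, forall t : R, 0 < t -> is_derive t 1 (primitive w) (w t)}.
Proof.
(* Extension by 0 to the negative half-line makes w locally integrable on the whole line, as
   Lebesgue's differentiation theorem asks. *)
move=> mw iw; pose w0 := w \_ `[0, +oo[.
have w0E t : 0 <= t -> w0 t = w t.
  by move=> t0; rewrite /w0 patchE mem_set//= in_itv/= t0.
have mw0 : measurable_fun setT w0.
  by apply/(measurable_restrictT _ _).1 => //; exact: measurable_funTS.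
have lw0 : locally_integrable setT w0.
  split; [exact: mw0|exact: openT|move=> K _ cK].
  have [A [Areal AK]] := compact_bounded cK.
  pose T := Num.max A 0 + 1.
  have T0 : 0 < T by rewrite ltr_wpDl// le_max lexx orbT.
  have KT t : K t -> t <= T.
    move=> Kt; apply: le_trans (ler_norm t) _; apply: (AK T) => //.
    by rewrite ltr_pwDr// le_max lexx.
  have /integrableP[_] := iw T T0; apply: le_lt_trans.
  have mK : measurable K by exact: compact_measurable.
  rewrite integral_mkcond [leRHS]integral_mkcond.
  apply: ge0_le_integral => //.
  - by move=> t _; apply: erestrict_ge0 => ? _; rewrite lee_fin.
  - apply/(measurable_restrictT _ _).1 => //.
    by apply/measurable_EFinP/measurable_funTS; exact: measurableT_comp.
  - apply/(measurable_restrictT _ _).1 => //.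
    by apply: measurableT_comp => //; apply/measurable_EFinP/measurable_funTS.
  move=> t _.
  have R0 : (0 <= ((fun s => `|(EFin \o w) s|) \_ `[0%R, T]) t)%E.
    by apply: erestrict_ge0 => s _; exact: abse_ge0.
  rewrite [X in (X <= _)%E]patchE; case: ifPn => [|_]; last exact: R0.
  rewrite inE => Kt; have [t0|t0] := leP 0 t.
    by rewrite patchE mem_set ?w0E//= in_itv/= t0 KT.
  have -> : w0 t = 0 by rewrite /w0 patchE memNset//= in_itv/= andbT; apply/negP; rewrite -ltNge.
  by rewrite normr0; exact: R0.
apply: (@filterS _ _ (ae_filter_ringOfSetsType leb) _ _ _ (lebesgue_differentiation lw0)) => t lt t0.
have tt1 : t < t + 1 by rewrite ltrDl.
have iw0 : leb.-integrable [set` Interval (BLeft 0) (BRight (t + 1))] (EFin \o w0).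
  apply: eq_integrable (iw _ (lt_trans t0 tt1)) => //= s.
  by rewrite inE/= in_itv/= => /andP[s0 _]; rewrite w0E.
have [d dE] := @FTC1_lebesgue_pt _ w0 (BLeft 0) t (t + 1) tt1 iw0 t0 lt.
rewrite (_ : primitive w = fun y => \int[leb]_(t in [set` Interval (BLeft 0) (BRight y)]) w0 t).
  by apply: DeriveDef; [exact: d|rewrite -derive1E dE w0E// ltW].
apply/funext => y; apply: eq_Rintegral => s.
by rewrite inE/= in_itv/= => /andP[s0 _]; rewrite w0E.
Qed.

Lemma ae_and (P Q : R -> Prop) : {ae leb, forall t : R, P t} ->
  {ae leb, forall t : R, Q t} -> {ae leb, forall t : R, P t /\ Q t}.
Proof. exact: (@filterI _ _ (ae_filter_ringOfSetsType leb)). Qed.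

(** A null set contains no interval of positive length. *)
Lemma ae_itv (P : R -> Prop) (a b : R) : a < b -> {ae leb, forall t : R, P t} ->
  exists2 t, a < t < b & P t.
Proof.
move=> ab [Z [mZ Z0 PZ]]; apply: contrapT => /forall2NP H.
have : (leb `]a, b[%classic <= leb Z)%E.
  apply: le_measure; rewrite ?inE//.
  move=> t /=; rewrite in_itv/= => tab; apply: PZ => /= Pt.
  by have [/(_ tab)|/(_ Pt)] := H t.
rewrite Z0 lebesgue_measure_itv/= lte_fin ab -EFinB lee_fin.
by apply/negP; rewrite -ltNge subr_gt0.
Qed.

End primitive.

(** The maximum keeps the base of the power nonnegative, so that continuity holds across 0. *)
Lemma continuous_powR_max (R : realType) (r : R) : 0 < r ->
  continuous (fun s : R => Num.max s 0 `^ r).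
Proof.
move=> r0 x; have [x0|x0] := ltP 0 x.
  have xp : {for x, continuous (fun s : R => s `^ r)}.
    have ? := is_derive1_powR r x0.
    exact/differentiable_continuous/derivable1_diffP.
  rewrite /continuous_at max_l ?(ltW x0)//.
  apply: cvg_trans xp; apply: near_eq_cvg; near=> s.
  by rewrite max_l// ltW//; near: s; exact: lt_nbhsr.
apply/cvgrPdist_lt => eps eps0.
rewrite [X in X `^ r]max_r// powR0 ?gt_eqF//; near=> s.
rewrite sub0r normrN ger0_norm ?powR_ge0//.
have -> : eps = (eps `^ r^-1) `^ r by rewrite -powRrM mulVf ?gt_eqF// powRr1// ltW.
apply: gt0_ltr_powR => //; rewrite ?nnegrE ?le_max ?lexx ?orbT ?powR_ge0//.
rewrite gt_max powR_gt0// andbT.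
by near: s; apply: lt_nbhsl; rewrite (le_lt_trans x0)// powR_gt0.
Unshelve. all: by end_near. Qed.

(** * From the integral identity to the differential system *)

Section radial_ode.
Context {R : realType} (N : nat).
Hypothesis N_gt0 : (0 < N)%N.
Local Notation leb := (@lebesgue_measure R).
Local Notation rho := (@radius2 R N).
Local Notation e := (2 / N%:R : R).
Implicit Types (s t T : R).
Variables (f gp : R -> R) (r C : R).
Hypothesis r1 : 1 <= r.
Hypothesis mf : measurable_fun setT f.
Hypothesis f_ge0 : forall t, 0 <= f t.
Hypothesis gp_cont : continuous gp.
Hypothesis gp_le : forall s, 0 <= s -> `|gp s| <= C * (1 + s `^ r).
Hypothesis if_ : leb.-integrable `[0%R, +oo[ (fun t => (f t `^ r)%:E).
Hypothesis identity : forall b : R, 0 < b ->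
  (\int[leb]_(t in `[0%R, +oo[) (f t *
     (2 * N%:R * Num.max (b - rho t) 0 - 4 * rho t * (0 < b - rho t)%R%:R))%:E =
   \int[leb]_(t in `[0%R, +oo[) (gp (f t) * (Num.max (b - rho t) 0 ^+ 2 / 2))%:E)%E.

Let gf t := gp (f t).

Let e_gt0 : 0 < e. Proof. by rewrite divr_gt0// ltr0n. Qed.

Let kap : R := (ball_volume N)^-1 `^ e.

Let kap_gt0 : 0 < kap.
Proof. by rewrite powR_gt0// invr_gt0 ball_volume_gt0. Qed.

Let rhoE t : 0 <= t -> rho t = kap * t `^ e.
Proof.
by move=> t0; rewrite /radius2 mulrC powRM// invr_ge0 ltW// ball_volume_gt0.
Qed.

Let rho_lt s t : 0 <= s -> s < t -> rho s < rho t.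
Proof.
move=> s0 st; have t0 := le_lt_trans s0 st.
rewrite !rhoE ?(ltW t0)// ltr_pM2l//.
by apply: gt0_ltr_powR => //; rewrite nnegrE// ltW.
Qed.

Let rho_gt0 t : 0 < t -> 0 < rho t.
Proof. by move=> t0; rewrite rhoE ?(ltW t0)// mulr_gt0// powR_gt0. Qed.

Let is_derive_rho t : 0 < t -> is_derive t 1 rho (e * rho t / t).
Proof.
move=> t0.
have H : is_derive t 1 (fun s => kap * s `^ e) (e * rho t / t).
  have ? := is_derive1_powR e t0.
  apply: is_derive_eq; rewrite /GRing.scale/= rhoE ?(ltW t0)//.
  rewrite powRB; last by rewrite (gt_eqF t0) implybT.
  by rewrite powRr1 ?(ltW t0)//; ring.
apply: near_eq_is_derive H; near=> s; rewrite rhoE// ltW//.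
by near: s; exact: lt_nbhsr.
Unshelve. all: by end_near. Qed.

Let mrho : measurable_fun setT rho. Proof. exact: measurable_radius2. Qed.

Let mgp : measurable_fun setT gp. Proof. exact: continuous_measurable_fun. Qed.

Let mgf : measurable_fun setT gf. Proof. exact: measurableT_comp. Qed.

Let loc_int (w : R -> R) c : measurable_fun setT w -> (forall t, `|w t| <= c * (1 + f t `^ r)) ->
  forall j : nat, locally_integrable0 (fun t => w t * rho t ^+ j).
Proof.
move=> mw wc j T T0.
have i1 : leb.-integrable `[0, T] (fun t => (f t `^ r)%:E).
  apply: integrableS if_ => //; try exact: measurable_itv.
  by apply: subset_itvl; rewrite bnd_simp.
have ic : leb.-integrable `[0, T] (EFin \o cst 1).
  apply: measurable_bounded_integrable => //.
  - by rewrite /= lebesgue_measure_itv/=; case: ifP => // _; rewrite -EFinB ltry.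
  - by exists 1; split => // x x1 y _ /=; rewrite normr1 ltW.
have mT : measurable (`[0, T]%classic : set (measurableTypeR R)).
  exact: measurable_itv.
have i2 := integrableZl mT (c * rho T ^+ j) (integrableD mT ic i1).
apply: le_integrable i2 => //.
  apply/measurable_EFinP/measurable_funTS/measurable_funM => //.
  exact: measurable_funX.
move=> t; rewrite /= in_itv/= => /andP[t0 tT].
rewrite lee_fin normrM normrX (ger0_norm (radius2_ge0 _ _)).
have c0 : 0 <= c.
  have := le_trans (normr_ge0 _) (wc 0); rewrite pmulr_lge0//.
  by rewrite ltr_pwDl// powR_ge0.
rewrite [leRHS]ger0_norm ?mulr_ge0 ?exprn_ge0 ?radius2_ge0 ?addr_ge0 ?powR_ge0//.
rewrite mulrAC; apply: ler_pM; rewrite ?exprn_ge0 ?radius2_ge0//.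
rewrite lerXn2r ?nnegrE ?radius2_ge0//.
by move: tT; rewrite le_eqVlt => /predU1P[->//|/(rho_lt t0)/ltW].
Qed.

Let f_le t : `|f t| <= 1 * (1 + f t `^ r).
Proof. by rewrite -{2}(ger0_norm (f_ge0 t)); exact: norm_le_1DpowR. Qed.

Let gf_le t : `|gf t| <= C * (1 + f t `^ r).
Proof. exact: gp_le. Qed.

Let loc_f := loc_int mf f_le.
Let loc_g := loc_int mgf gf_le.

(** F j and G j are the moments of f and g(f) that appear when the kernels are expanded in powers of
    rho. *)
Let F j := primitive (fun t => f t * rho t ^+ j).
Let G j := primitive (fun t => gf t * rho t ^+ j).

Let integral_vanish (w : R -> R) T : 0 < T -> (forall t, T <= t -> w t = 0) ->
  fine (\int[leb]_(t in `[0%R, +oo[) (w t)%:E)%E = \int[leb]_(t in `[0, T[) w t.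
Proof.
move=> T0 w0; rewrite /Rintegral [in LHS]integral_mkcond [in RHS]integral_mkcond.
congr fine; apply: eq_integral => t _; rewrite !patchE.
have [tT|tT] := ltP t T.
  case: ifPn; rewrite ?inE/= ?notin_setE/= !in_itv/= ?andbT => t0.
    by rewrite mem_set//= in_itv/= t0.
  by rewrite memNset//= in_itv/= tT andbT.
by rewrite w0//; case: ifPn => _; case: ifPn.
Qed.

(** The identity at b = rho(T): the kernels vanish for t >= T, and for t < T they are polynomials in
    rho(t) with coefficients depending on rho(T). *)
Let integral_equation T : 0 < T ->
  (2 * N%:R + 4) * F 1 T - 2 * N%:R * rho T * F 0 T +
  (rho T ^+ 2 * G 0 T - 2 * rho T * G 1 T + G 2 T) / 2 = 0.
Proof.
move=> T0; have := congr1 fine (identity (rho_gt0 T0)).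
have big t : T <= t -> rho T - rho t <= 0.
  rewrite subr_le0 le_eqVlt => /predU1P[->//|]; move=> /(rho_lt (ltW T0)); exact: ltW.
rewrite (@integral_vanish (fun t => f t * (2 * N%:R * Num.max (rho T - rho t) 0
   - 4 * rho t * (0 < rho T - rho t)%R%:R)) T T0); last first.
  by move=> t /big H; rewrite max_r// ltNge H/= !mulr0 subr0 mulr0.
rewrite (@integral_vanish (fun t => gp (f t) * (Num.max (rho T - rho t) 0 ^+ 2 / 2)) T T0); last first.
  by move=> t /big H; rewrite max_r// expr0n/= mul0r mulr0.
have small t : t \in `[0, T[%classic -> 0 < rho T - rho t.
  by rewrite inE/= in_itv/= => /andP[t0 tT]; rewrite subr_gt0 rho_lt.
rewrite (@eq_Rintegral _ _ _ leb `[0, T[%classic (fun t =>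
   2 * N%:R * rho T * (f t * rho t ^+ 0) - (2 * N%:R + 4) * (f t * rho t ^+ 1))); last first.
  by move=> t /small H; rewrite max_l ?(ltW H)// H mulr1n; ring.
rewrite [in RHS](@eq_Rintegral _ _ _ leb `[0, T[%classic (fun t =>
   (rho T ^+ 2 / 2 * (gf t * rho t ^+ 0) - rho T * (gf t * rho t ^+ 1)) +
   2^-1 * (gf t * rho t ^+ 2))); last first.
  by move=> t /small H; rewrite max_l ?(ltW H)// /gf; field.
have sub : (`[0, T[%classic : set R) `<=` `[0, T]%classic.
  by apply: subset_itvl; rewrite bnd_simp.
have iF j : leb.-integrable `[0, T[ (EFin \o (fun t => f t * rho t ^+ j)).
  by apply: integrableS (loc_f j T0) => //; exact: measurable_itv.
have iG j : leb.-integrable `[0, T[ (EFin \o (fun t => gf t * rho t ^+ j)).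
  by apply: integrableS (loc_g j T0) => //; exact: measurable_itv.
have mT : measurable (`[0, T[%classic : set (measurableTypeR R)) by exact: measurable_itv.
have iZ (w : R -> R) (c : R) : leb.-integrable `[0, T[ (EFin \o w) ->
    leb.-integrable `[0, T[ (EFin \o (fun t => c * w t)).
  by move=> iw; exact: (integrableZl mT c iw).
rewrite RintegralB ?RintegralZl//; [|exact: iZ|exact: iZ].
have iB := integrableB mT (iZ _ (rho T ^+ 2 / 2) (iG 0%N)) (iZ _ (rho T) (iG 1%N)).
rewrite RintegralD//; try exact: iB; try exact: iZ.
rewrite RintegralB ?RintegralZl//; [|exact: iZ|exact: iZ].
rewrite !Rintegral_itv_bndo_bndc//.
rewrite -!/(primitive _ T) -!/(F _ T) -!/(G _ T) => H.
by apply/eqP; rewrite -(subr_eq0 _ 0) subr0; apply/eqP; move: H; lra.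
Qed.

(** The coefficient of -rho' when [integral_equation] is differentiated. The terms in rho^2 g(f)
    cancel, which leaves 4 f rho - rho' num = 0, where rho' = e rho/t. *)
Let num t := 2 * N%:R * F 0 t - rho t * G 0 t + G 1 t.

(* Differentiating [integral_equation] at almost every [t]; the right-hand side
   is continuous, which gives [f] a regular representative. *)
Let f_num : {ae leb, forall t : R, 0 < t -> f t = num t / (2 * N%:R * t)}.
Proof.
have mw (w : R -> R) j : measurable_fun setT w -> measurable_fun setT (fun t => w t * rho t ^+ j).
  by move=> ?; apply: measurable_funM => //; exact: measurable_funX.
have dF j := ae_is_derive_primitive (mw _ j mf) (loc_f j).
have dG j := ae_is_derive_primitive (mw _ j mgf) (loc_g j).
have := ae_and (ae_and (ae_and (dF 0%N) (dF 1%N)) (ae_and (dG 0%N) (dG 1%N))) (dG 2%N).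
apply: (@filterS _ _ (ae_filter_ringOfSetsType leb)).
move=> t [[[dF0 dF1] [dG0 dG1]] dG2] t0.
have {}dF0 := dF0 t0. have {}dF1 := dF1 t0. have {}dG0 := dG0 t0.
have {}dG1 := dG1 t0. have {}dG2 := dG2 t0. have drho := is_derive_rho t0.
rewrite -/(F 0) -/(F 1) -/(G 0) -/(G 1) -/(G 2) in dF0 dF1 dG0 dG1 dG2.
have N0 : N%:R != 0 :> R by rewrite pnatr_eq0 -lt0n.
have dE : is_derive t 1 (fun T =>
  (2 * N%:R + 4) * F 1 T - 2 * N%:R * rho T * F 0 T +
  (rho T ^+ 2 * G 0 T - 2 * rho T * G 1 T + G 2 T) / 2)
  (4 * f t * rho t - e * rho t / t * num t).
  apply: is_derive_eq; rewrite /GRing.scale/= /num.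
  by field; rewrite N0 gt_eqF.
have : is_derive t 1 (cst 0 : R -> R) (4 * f t * rho t - e * rho t / t * num t).
  apply: near_eq_is_derive dE; near=> T; rewrite integral_equation//.
  by near: T; exact: lt_nbhsr.
move=> [_]; rewrite derive_cst => /eqP; rewrite eq_sym subr_eq0 => /eqP E.
have rt := rho_gt0 t0.
apply: (mulfI (_ : 4 * rho t != 0)); first by rewrite mulf_neq0 ?pnatr_eq0// gt_eqF.
transitivity (4 * f t * rho t); first by ring.
rewrite E; field; by rewrite N0 gt_eqF.
Unshelve. all: by end_near. Qed.

(** The value 0 for t <= 0 makes this representative measurable and nonnegative on the whole
    line. *)
Let ft : R -> R := (fun t => num t / (2 * N%:R * t)) \_ `]0, +oo[.

Let ftE t : 0 < t -> ft t = num t / (2 * N%:R * t).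
Proof. by move=> t0; rewrite /ft patchE mem_set//= in_itv/= t0. Qed.

Let N2t t : 0 < t -> 2 * N%:R * t != 0.
Proof. by move=> t0; rewrite gt_eqF// !mulr_gt0// ltr0n. Qed.

Let num_cont t : 0 < t -> {for t, continuous num}.
Proof.
move=> t0; have /derivable1_diffP/differentiable_continuous rt :=
  @ex_derive _ _ _ _ _ _ _ (is_derive_rho t0).
have FC j := primitive_continuous (loc_f j) t0.
have GC j := primitive_continuous (loc_g j) t0.
apply: cvgD; last exact: GC.
by apply: cvgB; [apply: cvgMl_tmp; exact: FC|apply: cvgM; [exact: rt|exact: GC]].
Qed.

Let quot_cont t : 0 < t -> {for t, continuous (fun t => num t / (2 * N%:R * t))}.
Proof.
move=> t0; apply: cvgM; first exact: num_cont.
by apply: cvgV; [exact: N2t|apply: cvgMl_tmp; exact: cvg_id].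
Qed.

Let ft_near (P : R -> R) t : 0 < t -> (forall s, 0 < s -> ft s = P s) ->
  \near t, P t = ft t.
Proof.
by move=> t0 H; near=> s; rewrite H//; near: s; exact: lt_nbhsr.
Unshelve. all: by end_near. Qed.

Let ft_cont t : 0 < t -> {for t, continuous ft}.
Proof.
move=> t0; suff : ft s @[s --> t] --> ft t by []; rewrite (ftE t0).
apply: cvg_trans (quot_cont t0); apply: near_eq_cvg.
exact: (ft_near t0 ftE).
Qed.

Let mft : measurable_fun setT ft.
Proof.
apply/(measurable_restrictT _ _).1; first exact: measurable_itv.
apply: open_continuous_measurable_fun; first exact: interval_open.
by move=> t; rewrite inE/= in_itv/= andbT => /quot_cont.
Qed.

Let f_ft : {ae leb, forall t : R, 0 < t -> f t = ft t}.
Proof.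
apply: (@filterS _ _ (ae_filter_ringOfSetsType leb) _ _ _ f_num) => t H t0.
by rewrite ftE ?H.
Qed.

(** By continuity a negative value would persist on an interval, which contains a point where [ft]
    agrees with f. *)
Let ft_ge0 t : 0 <= ft t.
Proof.
have [t0|t0] := ltP 0 t; last by rewrite /ft patchE memNset//= in_itv/= andbT; apply/negP; rewrite -leNgt.
rewrite leNgt; apply/negP => ft0.
have [a [b [ab H]]] : exists a b : R, a < b /\ forall s, a < s < b -> 0 < s /\ ft s < 0.
  have : \near t, 0 < t /\ ft t < 0.
    near=> s; split; first by near: s; exact: lt_nbhsr.
    near: s; have /cvgrPdist_lt /(_ (- ft t)) := ft_cont t0.
    rewrite oppr_gt0 => /(_ ft0); apply: filterS => s; rewrite ltr_norml => /andP[+ _].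
    by rewrite opprK; lra.
  move=> /nbhs_ballP[d /= d0 H]; exists (t - d), (t + d); split.
    by rewrite ltrBlDr -addrA ltrDl addr_gt0.
  by move=> s sd; apply: H; rewrite ball_itv/= in_itv.
have [s /H[s0 fs]] := ae_itv ab f_ft.
by move=> /(_ s0) E; move: fs; rewrite -E ltNge f_ge0.
Unshelve. all: by end_near. Qed.

(** M is G 0. Since [ft] is continuous, the moments are differentiable at every t > 0; in the
    derivative of num/(2Nt) the terms in [ft] cancel and only the one in rho' G 0 remains. *)
Lemma radial_representative : exists f' M J : R -> R,
  [/\ {ae leb, forall t : R, 0 < t -> f t = f' t},
      forall t, 0 <= f' t,
      forall t, 0 < t -> is_derive t 1 f'
        (- (e * (ball_volume N)^-1 `^ e / (2 * N%:R) * t `^ (e - 2) * M t)),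
      forall t, 0 < t -> is_derive t 1 M (gp (f' t)) &
      M t @[t --> 0^'+] --> 0] /\
  [/\ forall t, 0 < t -> is_derive t 1 J (f' t `^ r),
      forall t, 0 < t -> 0 <= J t <= fine (\int[leb]_(t in `[0%R, +oo[) (f t `^ r)%:E) &
      J t @[t --> 0^'+] --> 0].
Proof.
(* Used to replace f by [ft] under the integrals: the moments become primitives of functions
   continuous on (0, +oo). *)
have aew (w : R -> R -> R) : {ae leb, forall t, 0 < t -> w t (f t) = w t (ft t)}.
  by apply: (@filterS _ _ (ae_filter_ringOfSetsType leb) _ _ _ f_ft) => t H t0; rewrite -H.
have r0 : 0 < r by rewrite (lt_le_trans _ r1).
have mX j : measurable_fun setT (fun t => rho t ^+ j) by exact: measurable_funX.
have loc_ft j : locally_integrable0 (fun t => ft t * rho t ^+ j).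
  apply: ae_locally_integrable0 (aew (fun t s => s * rho t ^+ j)) (loc_f j).
  exact: measurable_funM.
have loc_gft j : locally_integrable0 (fun t => gp (ft t) * rho t ^+ j).
  apply: ae_locally_integrable0 (aew (fun t s => gp s * rho t ^+ j)) (loc_g j).
  by apply: measurable_funM => //; exact: measurableT_comp.
have Ff j : F j = primitive (fun t => ft t * rho t ^+ j).
  by apply/funext => t; exact: ae_eq_primitive (aew (fun t s => s * rho t ^+ j)).
have Gg j : G j = primitive (fun t => gp (ft t) * rho t ^+ j).
  by apply/funext => t; exact: ae_eq_primitive (aew (fun t s => gp s * rho t ^+ j)).
have rho_cont t : 0 < t -> {for t, continuous (fun t => rho t)}.
  move=> t0; have /derivable1_diffP/differentiable_continuous rt :=
    @ex_derive _ _ _ _ _ _ _ (is_derive_rho t0); exact: rt.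
have gft_cont t : 0 < t -> {for t, continuous (fun t => gp (ft t))}.
  by move=> t0; apply: continuous_comp; [exact: ft_cont|exact: gp_cont].
have rhoX_cont j t : 0 < t -> {for t, continuous (fun t => rho t ^+ j)}.
  move=> t0; apply: (@continuous_comp _ _ _ rho (fun s => s ^+ j)); [exact: rho_cont|exact: exprn_continuous].
have dF j t : 0 < t -> is_derive t 1 (F j) (ft t * rho t ^+ j).
  move=> t0; rewrite Ff; apply: is_derive_primitive_continuous => //.
  by apply: cvgM; [exact: ft_cont|exact: rhoX_cont].
have dG j t : 0 < t -> is_derive t 1 (G j) (gp (ft t) * rho t ^+ j).
  move=> t0; rewrite Gg; apply: is_derive_primitive_continuous => //.
  by apply: cvgM; [exact: gft_cont|exact: rhoX_cont].
pose J := primitive (fun t => ft t `^ r).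
have loc_J : locally_integrable0 (fun t => f t `^ r).
  move=> T T0; apply: integrableS if_ => //; try exact: measurable_itv.
  by apply: subset_itvl; rewrite bnd_simp.
have mftr : measurable_fun setT (fun t => ft t `^ r).
  exact: (measurableT_comp (measurable_powR r) mft).
have loc_Jt := ae_locally_integrable0 mftr (aew (fun _ s => s `^ r)) loc_J.
exists ft, (G 0), J; split; split; [exact: f_ft|exact: ft_ge0|..].
- move=> t t0; have drho := is_derive_rho t0; have dF0 := dF 0%N t t0.
  have dG0 := dG 0%N t t0; have dG1 := dG 1%N t t0.
  have N0 : N%:R != 0 :> R by rewrite pnatr_eq0 -lt0n.
  have t2 : 2 * N%:R * t != 0 by exact: N2t.
  have dnum : is_derive t 1 num (2 * N%:R * ft t - e * rho t / t * G 0 t).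
    by apply: is_derive_eq; rewrite /GRing.scale/= !expr0 !expr1; ring.
  have dD : is_derive t 1 (fun t : R => 2 * N%:R * t) (2 * N%:R).
    by apply: is_derive_eq; rewrite /GRing.scale/= mulr1.
  have dV := is_deriveV t2.
  have : is_derive t 1 (fun t => num t / (2 * N%:R * t))
    (- (e * (ball_volume N)^-1 `^ e / (2 * N%:R) * t `^ (e - 2) * G 0 t)).
    apply: is_derive_eq; rewrite /GRing.scale/= (ftE t0).
    rewrite rhoE ?(ltW t0)// powRB ?(gt_eqF t0) ?implybT// (_ : t `^ 2 = t ^+ 2); last first.
      by rewrite -powR_mulrn ?ltW.
    rewrite /kap; field; by rewrite N0 gt_eqF.
  exact: near_eq_is_derive (ft_near t0 ftE).
- by move=> t t0; have := dG 0%N t t0; rewrite expr0 mulr1.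
- by rewrite Gg; exact: primitive_cvg0.
- move=> t t0; apply: is_derive_primitive_continuous => //.
  (* The maximum does not change [ft], which is nonnegative, but exhibits a composition with a
     function continuous on the whole line. *)
  have : {for t, continuous (fun t => Num.max (ft t) 0 `^ r)}.
    apply: (@continuous_comp _ _ _ ft (fun s => Num.max s 0 `^ r)); first exact: ft_cont.
    exact: continuous_powR_max.
  suff -> : (fun t => Num.max (ft t) 0 `^ r) = (fun t => ft t `^ r) by [].
  by apply/funext => s; rewrite max_l ?ft_ge0.
- move=> t t0; rewrite /J -(ae_eq_primitive t (aew (fun _ s => s `^ r))).
  have i0 : (0 <= \int[leb]_(x in `[0%R, t]) (f x `^ r)%:E)%E.
    by apply: integral_ge0 => x _; rewrite lee_fin powR_ge0.
  have i01 : (\int[leb]_(x in `[0%R, t]) (f x `^ r)%:E <=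
      \int[leb]_(x in `[0%R, +oo[) (f x `^ r)%:E)%E.
    apply: ge0_subset_integral => //; try exact: measurable_itv.
    + by case/integrableP: if_.
    + by move=> x _; rewrite lee_fin powR_ge0.
    + by apply: subset_itvl; rewrite bnd_simp.
  rewrite fine_ge0//=; apply: fine_le => //.
    by apply: integrable_fin_num (loc_J _ t0); exact: measurable_itv.
  by apply: integrable_fin_num if_; exact: measurable_itv.
- exact: primitive_cvg0.
Qed.

End radial_ode.

(** * Perturbations of a power *)

(** The difference of the two sides is nondecreasing and tends to 0 at 0. The constant a may be
    negative, so that the lemma also yields upper bounds, through -F. *)
Lemma powR_le_primitive (R : realType) (p a d : R) (F w : R -> R) : 1 <= p ->
  (forall s : R, 0 < s -> is_derive s 1 F (w s)) -> F s @[s --> 0^'+] --> 0 ->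
  (forall s : R, 0 < s < d -> a * s `^ p <= w s) ->
  forall s : R, 0 < s < d -> a / (p + 1) * s `^ (p + 1) <= F s.
Proof.
move=> p1 dF F0 aw s /andP[s0 sd].
have p10 : 0 < p + 1 by lra.
pose K t := F t - a / (p + 1) * t `^ (p + 1).
have dK (t : R) : 0 < t -> is_derive t 1 K (w t - a * t `^ p).
  move=> t0; have ? := dF _ t0; have ? := is_derive1_powR (p + 1) t0.
  apply: is_derive_eq; rewrite /GRing.scale/= addrK; field.
  by rewrite gt_eqF.
have K0 : K t @[t --> 0^'+] --> 0.
  rewrite -[X in _ --> X]subr0; apply: cvgB => //.
  rewrite -[X in _ --> X](mulr0 (a / (p + 1))); apply: cvgMl_tmp.
  exact: powR_cvg0.
rewrite -subr_ge0 -/(K s); apply: (cvgr_to_le K0); near=> t.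
have t0 : 0 < t by near: t; exact: nbhs_right_gt.
have ts : t <= s by near: t; exact: nbhs_right_le.
apply: (@ge0_is_derive_le _ K (fun t => w t - a * t `^ p)) => // x /andP[tx xs].
  by apply: dK; exact: lt_le_trans tx.
by rewrite subr_ge0 aw// (lt_le_trans t0 tx)//= (le_lt_trans xs).
Unshelve. all: by end_near. Qed.

Section power_perturbation.
Context {R : realType}.
Variables (p : R) (g h : R -> R).
Hypothesis p_gt1 : 1 < p.
Hypothesis g_cont : {within `[0, +oo[, continuous g}.
Hypothesis g_def : forall s : R, 0 <= s -> g s = `|s| `^ (p - 1) * s + h s.
Hypothesis h_at0 : h s / (`|s| `^ (p - 1) * s) @[s --> 0^'+] --> 0.
Hypothesis h_atoo : h s / s @[s --> +oo] --> 0.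

Let p_gt0 : 0 < p. Proof. by rewrite (lt_trans _ p_gt1). Qed.

Let powE s : 0 < s -> `|s| `^ (p - 1) * s = s `^ p.
Proof.
move=> s0; rewrite gtr0_norm// -[X in _ * X]powRr1 ?(ltW s0)//.
by rewrite -powRD ?subrK// (gt_eqF s0) implybT.
Qed.

Let gE s : 0 < s -> g s = s `^ p + h s.
Proof. by move=> s0; rewrite g_def ?(ltW s0)// powE. Qed.

Lemma near0_powR (eps : R) : 0 < eps -> exists2 d : R, 0 < d &
  forall s : R, 0 < s < d -> `|g s - s `^ p| <= eps * s `^ p.
Proof.
move=> eps0; have /cvgrPdist_lt/(_ _ eps0) := h_at0.
move=> [d /= d0 H]; exists d => // s /andP[s0 sd].
have sp : 0 < s `^ p by exact: powR_gt0.
have /= := H s; rewrite powE// !sub0r !normrN (gtr0_norm s0) => /(_ sd s0).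
rewrite ltr_norml => /andP[h1 h2].
rewrite gE// addrAC subrr add0r -[h s](divfK (lt0r_neq0 sp)) normrM (gtr0_norm sp).
by rewrite ler_pM2r// ler_norml (ltW h1) ltW.
Qed.

Let gpos_cont s : 0 < s -> {for s, continuous g}.
Proof.
have /continuous_within_itvcyP[+ _] := g_cont.
by move=> H s0; apply: H; rewrite in_itv/= s0.
Qed.

(** By continuity, g(0) is the limit of g at 0 from the right, where |g(s)| <= 2 s^p. *)
Let g0 : g 0 = 0.
Proof.
have /continuous_within_itvcyP[_ gc] := g_cont.
apply/esym/(cvg_unique _ _ gc) => //.
have [d d0 dP] := near0_powR ltr01.
have L : 2 * s `^ p @[s --> 0^'+] --> 0.
  by rewrite -[X in _ --> X](mulr0 2); apply: cvgMl_tmp; exact: powR_cvg0.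
apply: norm_cvg0; apply: (squeeze_cvgr _ _ L); last exact: cvg_cst.
near=> s; rewrite normr_ge0/=.
have s0 : 0 < s by near: s; exact: nbhs_right_gt.
have sd : 0 < s < d by rewrite s0/=; near: s; exact: nbhs_right_lt.
have := dP s sd; rewrite !ler_norml => /andP[? ?].
have ? := powR_ge0 s p; apply/andP; split; lra.
Unshelve. all: by end_near. Qed.

(** Three ranges: near 0 the power dominates h; on a compact segment g is bounded; for large s,
    |h(s)| <= s <= s^p. *)
Lemma le_powR : exists2 C : R, 0 < C & forall s : R, 0 <= s -> `|g s| <= C * s `^ p.
Proof.
have [d d0 dP] := near0_powR ltr01.
have [A0 [A0real A0P]] : exists A, A \is Num.real /\ forall s : R, A < s -> `|h s / s| <= 1.
  by have /cvgrPdist_le/(_ _ ltr01)[A [Ar H]] := h_atoo; exists A; split => // s /H /=;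
     rewrite sub0r normrN.
pose A := Num.max A0 1 + 1.
have A0A : A0 < A by rewrite /A ltr_pwDr// le_max lexx.
have A1 : 1 < A by rewrite /A ltr_pwDr// le_max lexx orbT.
have [K [Kreal KP]] : bounded_set (g @` `[d / 2, A]).
  apply: compact_bounded; apply: continuous_compact; last exact: segment_compact.
  apply: continuous_subspaceW g_cont => s /=; rewrite !in_itv/= andbT => /andP[+ _].
  by apply: le_trans; rewrite divr_ge0 ?ltW.
pose K1 := Num.max K 0 + 1.
have K1P s : d / 2 <= s <= A -> `|g s| <= K1.
  move=> sdA; apply: (KP K1); first by rewrite /K1 ltr_pwDr// le_max lexx.
  by exists s => //=; rewrite in_itv.
have K10 : 0 < K1 by rewrite /K1 ltr_pwDr// le_max lexx orbT.
have dp0 : 0 < (d / 2) `^ p by rewrite powR_gt0// divr_gt0.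
(* The summand 2 serves the two extreme ranges, the other one the middle range, where s >= d/2. *)
exists (2 + K1 / (d / 2) `^ p); first by rewrite addr_gt0// divr_gt0.
move=> s; rewrite le_eqVlt => /predU1P[<-|s0].
  by rewrite g0 normr0 mulr_ge0 ?powR_ge0// addr_ge0// divr_ge0// ltW.
have sp0 := powR_gt0 p s0.
have le2 : `|g s| <= 2 * s `^ p -> `|g s| <= (2 + K1 / (d / 2) `^ p) * s `^ p.
  by move=> /le_trans; apply; rewrite ler_pM2r// lerDl divr_ge0 ?ltW.
have [sd|ds] := ltP s d.
  apply: le2; have := dP s; rewrite s0 sd => /(_ isT).
  by rewrite !ler_norml => /andP[? ?]; apply/andP; split; lra.
have [sA|As] := leP s A.
  apply: (le_trans (K1P _ _)); first by rewrite sA andbT; apply: le_trans ds; lra.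
  rewrite mulrDl ler_wpDl ?mulr_ge0 ?(ltW sp0)// -mulrA ler_peMr ?(ltW K10)//.
  rewrite mulrC ler_pdivlMr// mul1r ge0_ler_powR ?nnegrE ?(ltW p_gt0) ?(ltW s0)//; lra.
apply: le2; rewrite gE// (le_trans (ler_normD _ _))// (gtr0_norm sp0).
rewrite mulrDl mul1r lerD2l.
have s1 : 1 <= s by rewrite ltW// (lt_trans A1).
have hs : `|h s| <= s.
  have := A0P s (lt_trans A0A As); rewrite normrM normfV (gtr0_norm s0).
  by rewrite ler_pdivrMr// mul1r.
by apply: (le_trans hs); rewrite -{1}(powRr1 (ltW s0)) ler_powR// ltW.
Qed.

(** A continuous function on the whole line that agrees with g on [0, +oo), so that composition with
    it preserves measurability. *)
Definition extend0 (s : R) : R := g (Num.max s 0).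

Lemma extend0_continuous : continuous extend0.
Proof.
move=> x; have [x0|x0] := ltP 0 x.
  suff : extend0 s @[s --> x] --> g x by rewrite /extend0 /continuous_at max_l// ltW.
  apply: cvg_trans (gpos_cont x0); apply: near_eq_cvg; near=> s.
  by rewrite /extend0 max_l// ltW//; near: s; exact: lt_nbhsr.
have [C C0 CP] := le_powR.
have E : extend0 x = 0 by rewrite /extend0 max_r.
rewrite /continuous_at E; apply: norm_cvg0.
have L : C * (Num.max s 0 `^ p) @[s --> x] --> 0.
  have : Num.max s 0 `^ p @[s --> x] --> Num.max x 0 `^ p by exact: continuous_powR_max.
  rewrite [X in _ --> X `^ p -> _](max_r x0) powR0 ?lt0r_neq0// => L.
  by rewrite -[X in _ --> X](mulr0 C); apply: cvgMl_tmp.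
apply: (squeeze_cvgr _ _ L); last exact: cvg_cst.
by near=> s; rewrite normr_ge0 CP// le_max lexx orbT.
Unshelve. all: by end_near. Qed.

Let loc_g : locally_integrable0 extend0.
Proof.
move=> T T0; apply: continuous_compact_integrable; first exact: segment_compact.
by apply: continuous_subspaceT; exact: extend0_continuous.
Qed.

Let GE : primitive0 g = primitive extend0.
Proof.
apply/funext => s; apply: eq_Rintegral => t.
by rewrite inE/= in_itv/= => /andP[t0 _]; rewrite /extend0 max_l.
Qed.

Lemma is_derive_primitive0 (s : R) : 0 < s -> is_derive s 1 (primitive0 g) (g s).
Proof.
move=> s0; rewrite GE -{2}(max_l (ltW s0)).
by apply: is_derive_primitive_continuous => //; exact: extend0_continuous.
Qed.

Lemma primitive0_cvg0 : primitive0 g s @[s --> 0^'+] --> 0.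
Proof. by rewrite GE; exact: primitive_cvg0. Qed.

Lemma primitive0_le (C : R) : (forall s : R, 0 <= s -> `|g s| <= C * s `^ p) ->
  forall s : R, 0 < s -> `|primitive0 g s| <= C * s `^ (p + 1).
Proof.
move=> CP s s0; have ss : 0 < s < s + 1 by rewrite s0 ltrDl ltr01.
have C0 : 0 <= C.
  by have := le_trans (normr_ge0 _) (CP s (ltW s0)); rewrite pmulr_lge0// powR_gt0.
have Cp : C / (p + 1) * s `^ (p + 1) <= C * s `^ (p + 1).
  rewrite ler_wpM2r ?powR_ge0// ler_pdivrMr; last by rewrite addr_gt0.
  by rewrite ler_peMr// lerDr ltW.
apply: le_trans Cp; rewrite ler_norml; apply/andP; split.
  rewrite -!mulNr; apply: (@powR_le_primitive _ p (- C) (s + 1) _ g) => //.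
  - exact: ltW.
  - exact: is_derive_primitive0.
  - exact: primitive0_cvg0.
  - by move=> t /andP[t0 _]; have := CP _ (ltW t0); rewrite mulNr ler_norml => /andP[].
rewrite -lerN2 -!mulNr.
apply: (@powR_le_primitive _ p (- C) (s + 1) (fun t => - primitive0 g t) (fun t => - g t)) => //.
- exact: ltW.
- by move=> t t0; have ? := is_derive_primitive0 t0; exact: is_deriveN.
- by rewrite -[X in _ --> X]oppr0; apply: cvgN; exact: primitive0_cvg0.
- by move=> t /andP[t0 _]; have := CP _ (ltW t0); rewrite mulNr lerN2 ler_norml => /andP[].
Qed.

(** Near 0, G(s) behaves like s^(p+1)/(p+1) and s g(s) like s^(p+1), so the sign is that of 1/(p+1)
    - k. *)
Lemma primitive0_gt0 (k : R) : 0 <= k < (p + 1)^-1 -> exists2 r : R, 0 < r &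
  forall s : R, 0 < s < r -> 0 < primitive0 g s - k * (s * g s).
Proof.
move=> /andP[k0 kp]; have p10 : 0 < p + 1 by rewrite addr_gt0.
(* Solves eps (1 + k(p+1)) = (1 - k(p+1))/2, which ensures k (1 + eps) < (1 - eps)/(p+1). *)
pose eps := (1 - k * (p + 1)) / 2 / (1 + k * (p + 1)).
have kp1 : k * (p + 1) < 1 by move: kp; rewrite -(ltr_pM2r p10) mulVf// gt_eqF.
have kp0 : 0 <= k * (p + 1) by rewrite mulr_ge0// ltW.
have eps0 : 0 < eps by rewrite !divr_gt0//; lra.
have [d d0 dP] := near0_powR eps0; exists d => // s sd.
have /andP[s0 _] := sd; have sp := powR_gt0 (p + 1) s0.
have spE : s * s `^ p = s `^ (p + 1).
  by rewrite addrC powRD ?powRr1 ?(ltW s0)// (gt_eqF s0) implybT.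
have G1 : (1 - eps) / (p + 1) * s `^ (p + 1) <= primitive0 g s.
  apply: (@powR_le_primitive _ p (1 - eps) d _ g) => //.
  - exact: ltW.
  - exact: is_derive_primitive0.
  - exact: primitive0_cvg0.
  - by move=> t /dP; rewrite ler_norml => /andP[+ _]; lra.
have G2 : k * (s * g s) <= k * (1 + eps) * s `^ (p + 1).
  rewrite -mulrA ler_wpM2l// -spE mulrCA ler_pM2l//.
  by have := dP s sd; rewrite ler_norml => /andP[_]; lra.
rewrite subr_gt0 (le_lt_trans G2)// (lt_le_trans _ G1)// ltr_pM2r//.
rewrite ltr_pdivlMr//.
have E : eps * (1 + k * (p + 1)) = (1 - k * (p + 1)) / 2.
  by rewrite /eps divfK//; rewrite gt_eqF//; lra.
by move: E kp1; nra.
Qed.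

End power_perturbation.

(** * Property (L) *)

Section property_L_radial.
Context {R : realType} (N : nat).
Local Notation leb := (@lebesgue_measure R).
Local Notation mu := (@lebesgue_rV R N).
Local Notation e := (2 / N%:R : R).
Variables (p : R) (g : R -> R).
Hypothesis N_gt0 : (0 < N)%N.
Hypothesis p_ge0 : 0 <= p.

Lemma ae_ball_vol_eq0 (u : 'rV[R]_N -> R) (w : R -> R) :
  {ae mu, forall x, u x = w (ball_vol x)} ->
  {ae leb, forall t : R, 0 < t -> w t = 0} -> {ae mu, forall x, u x = 0}.
Proof.
move=> uw [Z [mZ Z0 wZ]].
have m0 : measurable ([set 0] : set R) by exact: measurable_set1.
(* The point 0 is added because w is controlled only for t > 0; the intersection brings the set into
   the range of [image_ball_vol]. *)
have mA : measurable ((Z `|` [set 0]) `&` `[0, +oo[).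
  by apply: measurableI; [exact: measurableU|exact: measurable_itv].
have A0 : leb ((Z `|` [set 0]) `&` `[0, +oo[) = 0%E.
  apply/eqP; rewrite -measure_le0.
  apply: (@le_trans _ _ (leb (Z `|` [set 0]))).
    by apply: le_measure; rewrite ?inE//; exact: measurableU.
  apply: (le_trans (measureU2 _ mZ m0)).
  by rewrite [X in (X + _ <= _)%E]Z0 [X in (_ + X <= _)%E]lebesgue_measure_set1 adde0.
have nA : {ae mu, forall x, ~ ((Z `|` [set 0]) `&` `[0, +oo[) (ball_vol x)}.
  exists (@ball_vol R N @^-1` ((Z `|` [set 0]) `&` `[0, +oo[)); split.
  - by rewrite -[X in measurable X]setTI; exact: measurable_ball_vol.
  - by rewrite image_ball_vol.
  - by move=> x /= /contrapT.
apply: filterS2 uw nA => x -> nA.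
apply: contrapT => wx; apply: nA; have x0 := ball_vol_ge0 x; split => /=.
  move: x0; rewrite le_eqVlt => /predU1P[<-|x0]; [by right|left].
  by apply: wZ => /= /(_ x0).
by rewrite in_itv/= x0.
Qed.

(** Isolates the passage from weak solutions to the differential system, so that each case of the
    theorem only has to show that the system has no nonzero solution. *)
Lemma property_L_radial (C : R) : continuous (extend0 g) ->
  (forall s, 0 <= s -> `|g s| <= C * (1 + s `^ (p + 1))) ->
  (forall (c J1 : R) (f M J : R -> R), 0 < c ->
    (forall t, 0 <= f t) ->
    (forall t : R, 0 < t -> is_derive t 1 f (- (c * t `^ (e - 2) * M t))) ->
    (forall t : R, 0 < t -> is_derive t 1 M (g (f t))) ->
    M t @[t --> 0^'+] --> 0 ->
    (forall t : R, 0 < t -> is_derive t 1 J (f t `^ (p + 1))) ->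
    (forall t : R, 0 < t -> 0 <= J t <= J1) ->
    J t @[t --> 0^'+] --> 0 ->
    forall t, 0 < t -> f t = 0) ->
  property_L N p g.
Proof.
move=> gc g_le ode u [uL _ [f0 mf0 uf0]] [v vL weak] u0.
have p1 : 1 <= p + 1 by rewrite lerDr.
(* The maximum with 0 turns nonnegativity almost everywhere into nonnegativity everywhere. *)
pose f t := Num.max (f0 (Num.sqrt (radius2 N t))) 0.
have f_ge0 t : 0 <= f t by rewrite le_max lexx orbT.
have mf : measurable_fun setT f.
  have msqrt : measurable_fun setT (@Num.sqrt R).
    by apply: continuous_measurable_fun; exact: sqrt_continuous.
  apply: measurable_maxr => //; apply: measurableT_comp => //.
  exact: (measurableT_comp msqrt (measurable_radius2 N)).
have uf : {ae mu, forall x, u x = f (ball_vol x)}.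
  by apply: filterS2 uf0 u0 => x E u0; rewrite /f -enormE// -E max_l.
have guf : {ae mu, forall x, g (u x) = extend0 g (f (ball_vol x))}.
  by apply: filterS uf => x ->; rewrite /extend0 max_l.
have gf_le t : `|extend0 g (f t)| <= C * (1 + `|f t| `^ (p + 1)).
  by rewrite /extend0 max_l// (ger0_norm (f_ge0 t)) g_le.
have mgf : measurable_fun setT (extend0 g \o f).
  by apply: measurableT_comp mf; exact: continuous_measurable_fun.
have mfr : measurable_fun setT (fun t => f t `^ (p + 1)).
  exact: (measurableT_comp (measurable_powR (p + 1)) mf).
have if_ : leb.-integrable `[0%R, +oo[ (fun t => (f t `^ (p + 1))%:E).
  apply: (integrable_ball_vol N_gt0); first exact/measurable_EFinP.
  have /integrableP[_ ioo] := Lfun_integrable p1 uL.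
  apply/integrableP; split.
    by apply/measurable_EFinP; apply: (measurableT_comp mfr); exact: measurable_ball_vol.
  apply: le_lt_trans ioo; rewrite le_eqVlt; apply/orP; left; apply/eqP.
  apply: ae_eq_integral_setT; apply: (filterS _ uf) => x ->.
  by rewrite (ger0_norm (f_ge0 _)).
have identity := @radial_identity _ _ N_gt0 (p + 1) C u (g \o u) v f (extend0 g \o f)
  p1 uL vL mf mgf gf_le uf guf weak.
have g_le' s : 0 <= s -> `|extend0 g s| <= C * (1 + s `^ (p + 1)).
  by move=> s0; rewrite /extend0 max_l// g_le.
have [f' [M [J [[ff' f'0 df dM M0] [dJ J_le J0]]]]] :=
  radial_representative N_gt0 p1 mf f_ge0 gc g_le' if_ identity.
apply: (ae_ball_vol_eq0 uf).
have gE t : extend0 g (f' t) = g (f' t) by rewrite /extend0 max_l.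
have f'E : forall t, 0 < t -> f' t = 0.
  apply: ode f'0 df _ M0 dJ J_le J0.
    by rewrite !(mulr_gt0, powR_gt0, invr_gt0, ltr0n, ball_volume_gt0).
  by move=> t t0; have := dM t t0; rewrite gE.
by apply: (@filterS _ _ (ae_filter_ringOfSetsType leb) _ _ _ ff') => t E t0; rewrite E// f'E.
Qed.

End property_L_radial.

(* The functions g and h are only used on [0, +oo). *)
Theorem proposition1p2 (R : realType) (N : nat) (p : R) (g h : R -> R)
    (N_ge2 : (2 <= N)%N)
    (p_def : p = 1 + 4 / N%:R)
    (g_cont : {within `[0, +oo[, continuous g})
    (h_cont : {within `[0, +oo[, continuous h})
    (g_def : forall s, 0 <= s -> g s = `|s| `^ (p - 1) * s + h s)
    (h_at0 : h s / (`|s| `^ (p - 1) * s) @[s --> 0^'+] --> 0)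
    (h_atoo : h s / s @[s --> +oo] --> 0) :
  ((N = 2 \/ N = 3 \/ N = 4)%N -> property_L N p g) /\
  ((5 <= N)%N ->
   (forall s, 0 <= s ->
      0 <= N%:R * primitive0 g s - (N%:R - 2) / 2 * g s * s) ->
   property_L N p g).
Proof.
have N_gt0 : (0 < N)%N by exact: leq_trans N_ge2.
have Nr0 : 0 < N%:R :> R by rewrite ltr0n.
pose e : R := 2 / N%:R.
have e0 : 0 < e by rewrite divr_gt0.
have e01 : 0 < e <= 1 by rewrite e0 ler_pdivrMr// mul1r ler_nat.
have pE : p = 1 + 2 * e by rewrite p_def /e; congr (_ + _); field; rewrite gt_eqF.
have pE1 : p + 1 = 2 + 2 * e by rewrite pE; ring.
have p1 : 1 < p by rewrite pE ltrDl mulr_gt0.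
have p0 : 0 <= p by rewrite ltW// (lt_trans _ p1).
have [C C0 CP] := le_powR p1 g_cont g_def h_at0 h_atoo.
have gc := extend0_continuous p1 g_cont g_def h_at0 h_atoo.
have half0 : 0 < 1 / 2 :> R by rewrite divr_gt0.
(* Closeness 1/2 to the power gives g(s) >= s^p/2; halving d turns the strict bound on s into the
   large one of [g_ge]. *)
have [d d0 dP] := near0_powR g_def h_at0 half0.
have g_ge s : 0 < s <= d / 2 -> s `^ (1 + 2 * e) / 2 <= g s.
  move=> /andP[s0 sd]; have := dP s; rewrite s0 (le_lt_trans sd) ?ltr_pdivrMr//; last first.
    by rewrite ltr_pMr// ltr1n.
  by move=> /(_ isT); rewrite -pE ler_norml => /andP[+ _]; lra.
have g_le s : 0 <= s -> `|g s| <= C * s `^ (1 + 2 * e) by rewrite -pE; exact: CP.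
have g_le1 s : 0 <= s -> `|g s| <= C * (1 + s `^ (p + 1)).
  move=> s0; apply: (le_trans (CP s s0)); rewrite ler_pM2l//.
  have [s1|s1] := leP 1 s.
    by rewrite ler_wpDl// ler_powR// lerDl.
  rewrite ler_wpDr ?powR_ge0// (_ : 1 = 1 `^ p); last by rewrite powR1.
  by rewrite ge0_ler_powR ?nnegrE// ltW.
have d2 : 0 < d / 2 by rewrite divr_gt0.
split.
  move=> N234; apply: (property_L_radial N_gt0 p0 gc g_le1).
  move=> c J1 f M J c0 f_ge0 df dM M0 dJ J_le J0.
  rewrite pE1 in dJ.
  apply: (@emden_fowler_eq0_half_le _ e c C (d / 2) g f M e01 c0 C0 d2 g_le g_ge _ df dM J J1 dJ J_le).
    by move=> t _; exact: f_ge0.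
  have N4 : N%:R <= 4 :> R by rewrite ler_nat; case: N234 => [->|[->|->]].
  by rewrite /e ler_pdivlMr//; lra.
move=> N5 G_ge0; apply: (property_L_radial N_gt0 p0 gc g_le1).
move=> c J1 f M J c0 f_ge0 df dM M0 dJ J_le J0.
rewrite pE1 in dJ.
have e1 : e < 1 by rewrite ltr_pdivrMr// mul1r ltr_nat (leq_trans _ N5).
apply: (@emden_fowler_eq0_pohozaev _ e c C (d / 2) g f M e01 c0 C0 d2 g_le g_ge _ df dM J J1 dJ J_le
  (primitive0 g) e1) => //.
- exact: (is_derive_primitive0 p1 g_cont g_def h_at0 h_atoo).
- by rewrite -pE1; exact: (primitive0_le p1 g_cont g_def h_at0 h_atoo CP).
(* Multiplication by N recovers the assumption, since N (1-e)/2 = (N-2)/2. *)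
- move=> s s0; rewrite -(pmulr_rge0 _ Nr0).
  have := G_ge0 s (ltW s0); congr (_ <= _); rewrite /e; field.
  by rewrite gt_eqF.
(* The condition (1-e)/2 < 1/(p+1) says that p is below the critical Sobolev exponent; it reduces to
   1 - e^2 < 1. *)
- apply: (primitive0_gt0 p1 g_cont g_def h_at0 h_atoo).
  rewrite divr_ge0/= ?subr_ge0 ?(ltW e1)// pE1.
  rewrite -[ltRHS]div1r ltr_pdivlMr; last by rewrite addr_gt0// mulr_gt0.
  have ee : 0 < e * e by rewrite mulr_gt0.
  have -> : (1 - e) / 2 * (2 + 2 * e) = 1 - e * e by field.
  by rewrite gtrBl.
Qed.
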